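(* Let $\Delta$ be a positive integer. Then there exists an integer $n_0 = n_0(\Delta)$ such that for every $n \geq n_0$ and for every tree $T = (V,E)$ with $|V| = n$ and maximum degree $\Delta(T) \leq \Delta$, Maker has a strategy to win the tree embedding game $(E(K_n), \mathcal{T}_n)$ within $n+1$ moves (of Maker).
   Context: Maker-Breaker game: Let $X$ be a finite set (the board) and $\mathcal{F} \subseteq 2^X$ a family of winning sets. In the Maker-Breaker game $(X, \mathcal{F})$, Maker and Breaker alternately claim one previously unclaimed element of $X$ per move, with Breaker going first. Maker wins as soon as she has claimed all elements of some winning set. ''Maker has a strategy to win within $k$ moves'' means that she has a strategy that, against any strategy of Breaker, ensures that she has fully claimed a winning set after making at most $k$ moves of her own. Tree embedding game: For a tree $T$ on $n$ vertices, the tree embedding game $(E(K_n), \mathcal{T}_n)$ is the Maker-Breaker game whose board is the edge set of the complete graph $K_n$ and whose (minimal) winning sets are the edge sets of all labeled copies of $T$ in $K_n$; so Maker wins as soon as the graph formed by her edges contains a copy of $T$. *)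

(* Defs.v *)
From mathcomp Require Import all_boot.

Set Implicit Arguments.
Unset Strict Implicit.
Unset Printing Implicit Defensive.

Record sgraph := SGraph {
  vertex :> finType;
  adj : rel vertex;
  adj_sym : symmetric adj;
  adj_irrefl : irreflexive adj
}.

Definition edges (G : sgraph) : {set {set G}} :=
  [set [set p.1; p.2] | p : G * G & adj p.1 p.2].

Definition degree (G : sgraph) (x : G) : nat := #|[set y | adj x y]|.

Definition max_degree (G : sgraph) : nat := \max_(x : G) degree x.

Definition connected_graph (G : sgraph) : Prop :=
  0 < #|G| /\ forall x y : G, connect (@adj G) x y.

(* The bound on the size excludes the closed walks [:: x; y] along one edge. *)
Definition acyclic_graph (G : sgraph) : Prop :=
  forall c : seq G, 2 < size c -> ~ ucycle (@adj G) c.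

Definition is_tree (G : sgraph) : Prop := connected_graph G /\ acyclic_graph G.

Definition distinct (n : nat) : rel 'I_n := fun i j => i != j.

Fact distinct_sym n : symmetric (@distinct n).
Proof. by move=> i j; rewrite /distinct eq_sym. Qed.

Fact distinct_irrefl n : irreflexive (@distinct n).
Proof. by move=> i; rewrite /distinct eqxx. Qed.

Definition complete_graph (n : nat) : sgraph :=
  SGraph (@distinct_sym n) (@distinct_irrefl n).

Definition is_embedding (T G : sgraph) (f : {ffun T -> G}) : bool :=
  injectiveb f && [forall x, forall y, adj x y ==> adj (f x) (f y)].

(* Copies need not be induced. *)
Definition copies (T G : sgraph) : {set {set {set G}}} :=
  [set [set f @: (e : {set T}) | e in edges T]
     | f : {ffun T -> G} & is_embedding f].

Section MakerBreaker.
Variables (U : finType) (X : {set U}) (F : {set {set U}}).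

(* A history lists the claimed elements in the order of play. Breaker moves
   first, so that Maker is to move exactly when the history has odd size. *)
Definition strategy := seq U -> option U.

(* A player passes only when the board is exhausted. *)
Definition legal (s : strategy) : Prop :=
  forall h : seq U,
    match s h with
    | Some x => x \in X /\ x \notin h
    | None => {subset X <= h}
    end.

Definition next_position (maker breaker : strategy) (h : seq U) : seq U :=
  if (if odd (size h) then maker h else breaker h) is Some x
  then rcons h x else h.

Definition play (maker breaker : strategy) (m : nat) : seq U :=
  iter m (next_position maker breaker) [::].

Definition maker_claimed (h : seq U) : {set U} :=
  [set x in h | odd (index x h)].

Definition maker_wins_within (k : nat) : Prop :=
  exists2 maker : strategy, legal maker &
    forall breaker : strategy, legal breaker ->
      exists2 j, j <= k &
        exists2 W, W \in F & W \subset maker_claimed (play maker breaker j.*2).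

End MakerBreaker.

(* Main.v *)
Require Import Defs.
From mathcomp Require Import all_boot all_order all_algebra.
From mathcomp Require Import zify ring lra.
Import Order.TTheory GRing.Theory Num.Theory.

(** Maker embeds the tree vertex by vertex. Every move but two claims an edge of
    the final copy, and the order in which the vertices are embedded is dictated
    by Breaker's graph.

    The danger is a vertex of large degree in Breaker's graph if it is still
    needed: an unused vertex, or the image of a tree vertex with children that
    are not embedded yet. These active vertices are controlled by a potential,
    the sum of q ^ deg with q slightly larger than 1. Maker can make any active
    vertex inactive in Delta + 3 moves (process_vertex), and if she does so with
    a vertex of largest degree, then the potential does not increase
    (potential_kill). Hence the degrees stay small while most of the tree is
    embedded (main_growth). The main difficulty is an unused vertex that Breaker
    has separated from the embedded part; embed_deep reaches it without wasting
    a move.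

    The last part of the tree is chosen such that embedding it amounts to joining
    2m ports in pairs, and this takes m + 2 moves (port_game). Each move joins a
    port of largest degree to a partner of at least nearly average degree. This
    makes Breaker's graph between the ports sparser until it is a matching, and
    then Maker can keep it a matching until two ports are left. If their edge is
    taken, the copy is repaired with two additional moves.

    A bounded degree tree has many leaves or a long path without branches
    (bare_chain), where both numbers can be chosen such that all thresholds are
    polynomials in log n. In the first case (many_leaves_win) some leaves with
    distinct parents are left to the end; the ports are the unused vertices and
    the images of the parents, and last_leaf is the repair. In the second case
    (long_chain_win) the middle of the bare path is left to the end, so that the
    unused vertices have to be arranged into a path between two given vertices.
    Maker first covers them by paths with two ends each (pair_singles); these
    ends are the ports, and rotate_twice is the repair. *)

Set Implicit Arguments.
Unset Strict Implicit.
Unset Printing Implicit Defensive.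


(** * Positions and strategies *)

Section Game.
Variables (U : finType) (X : {set U}) (F : {set {set U}}).

Definition wins (M : {set U}) : bool := [exists W in F, W \subset M].

(** Breaker is to move and Maker may make k further moves. Maker is allowed to
    claim an edge that she owns already, so that a plan does not have to watch out
    for edges which Maker happens to have. *)
Fixpoint winning (k : nat) (M B : {set U}) : bool :=
  wins M ||
  if k is k'.+1 then
    [forall b in X :\: (M :|: B),
      [exists m in X :\: (b |: B), winning k' (m |: M) (b |: B)]]
  else false.

Lemma wins_mono (M M' : {set U}) : M \subset M' -> wins M -> wins M'.
Proof.
move=> sM /existsP[W /andP[WF WM]]; apply/existsP; exists W.
by rewrite WF (subset_trans WM).
Qed.

Lemma winning_wins k M B : wins M -> winning k M B.
Proof. by case: k => [|k] /= ->. Qed.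

(** Spare edges never hurt Maker; this is what allows a wasted move to be
    replaced by any legal one. *)
Lemma winning_mono k (M M' B : {set U}) :
  M \subset M' -> winning k M B -> winning k M' B.
Proof.
elim: k M M' B => [|k IH] M M' B sM /=.
  by rewrite !orbF; apply: wins_mono.
case/orP=> [/(wins_mono sM) -> //|/forallP H].
apply/orP; right; apply/forallP=> b; apply/implyP=> bX.
have bX' : b \in X :\: (M :|: B).
  move: bX; rewrite !inE !negb_or => /andP[/andP[bM ->] ->].
  by rewrite !andbT; apply: contra bM; apply: (subsetP sM).
have /existsP[m /andP[mX mW]] := implyP (H b) bX'.
apply/existsP; exists m; rewrite mX; apply: IH mW; exact: setUS.
Qed.

Definition breaker_claimed (h : seq U) : {set U} :=
  [set x in h | ~~ odd (index x h)].

Lemma claimedU h x : (x \in maker_claimed h :|: breaker_claimed h) = (x \in h).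
Proof. by rewrite !inE -andb_orr orbN andbT. Qed.

Lemma index_rcons_old (h : seq U) x y : y \in h -> index y (rcons h x) = index y h.
Proof. by move=> yh; rewrite -cats1 index_cat yh. Qed.

Lemma index_rcons_new (h : seq U) x : x \notin h -> index x (rcons h x) = size h.
Proof. by move=> xh; rewrite -cats1 index_cat (negbTE xh) /= eqxx addn0. Qed.

Lemma maker_rcons (h : seq U) x : x \notin h ->
  maker_claimed (rcons h x) = if odd (size h) then x |: maker_claimed h else maker_claimed h.
Proof.
move=> xh; apply/setP=> y.
have [->|nyx] := eqVneq y x.
  rewrite !inE mem_rcons mem_head (index_rcons_new xh) /=.
  by case: (odd _); rewrite ?inE ?eqxx ?(negbTE xh).
have E : (y \in maker_claimed (rcons h x)) = (y \in maker_claimed h).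
  rewrite !inE mem_rcons inE (negbTE nyx) /=.
  by case yh: (y \in h) => //=; rewrite index_rcons_old.
by rewrite E; case: ifP => _; rewrite ?in_setU1 ?(negbTE nyx).
Qed.

Lemma breaker_rcons (h : seq U) x : x \notin h ->
  breaker_claimed (rcons h x) =
  if odd (size h) then breaker_claimed h else x |: breaker_claimed h.
Proof.
move=> xh; apply/setP=> y.
have [->|nyx] := eqVneq y x.
  rewrite !inE mem_rcons mem_head (index_rcons_new xh) /=.
  by case: (odd _); rewrite ?inE ?eqxx ?(negbTE xh).
have E : (y \in breaker_claimed (rcons h x)) = (y \in breaker_claimed h).
  rewrite !inE mem_rcons inE (negbTE nyx) /=.
  by case yh: (y \in h) => //=; rewrite index_rcons_old.
by rewrite E; case: ifP => _; rewrite ?in_setU1 ?(negbTE nyx).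
Qed.

Section Strategy.
Variable k : nat.

Definition good_reply (h : seq U) : pred U := fun m =>
  [&& m \in X, m \notin h &
      winning (k - (size h)./2.+1) (m |: maker_claimed h) (breaker_claimed h)].

Definition maker_strategy : strategy U := fun h =>
  if [pick m | good_reply h m] is Some m then Some m
  else [pick m | (m \in X) && (m \notin h)].

Lemma maker_strategy_legal : legal X maker_strategy.
Proof.
move=> h; rewrite /maker_strategy.
case: pickP => [m /and3P[-> ->]//|_].
case: pickP => [m /andP[-> ->]//|H] x xX.
by have := H x; rewrite xX /= => /negbFE.
Qed.

(** Along the play the position stays winning with one move fewer. The bound
    on the size of X ensures that Breaker and Maker never run out of moves before. *)
Lemma maker_strategy_wins : k.+1.*2 <= #|X| -> winning k set0 set0 ->
  forall breaker, legal X breaker ->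
  exists2 j, j <= k & wins (maker_claimed (play maker_strategy breaker j.*2)).
Proof.
move=> big win0 breaker legB.
pose h j := play maker_strategy breaker j.*2.
suff: forall j, j <= k ->
    (exists2 i, i <= j & wins (maker_claimed (h i))) \/
    [/\ size (h j) = j.*2, uniq (h j), {subset h j <= X} &
      winning (k - j) (maker_claimed (h j)) (breaker_claimed (h j))].
  move=> H; case: (H k (leqnn k)) => // -[_ _ _].
  by rewrite subnn /= orbF => W; exists k.
elim=> [|j IH] jk.
  right; have -> : h 0 = [::] by [].
  have -> : maker_claimed (Nil U) = set0 by apply/setP=> x; rewrite !inE.
  have -> : breaker_claimed [::] = set0 by apply/setP=> x; rewrite !inE.
  by rewrite subn0; split.
case: (IH (ltnW jk)) => [[i ij W]|[sz un sub win]].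
  by left; exists i => //; apply: leqW.
have [W|nW] := boolP (wins (maker_claimed (h j))).
  by left; exists j.
right.
have Ekj : k - j = (k - j.+1).+1 by rewrite subnSK.
move: win; rewrite Ekj /= (negbTE nW) /= => /forallP H.
have hE : h j.+1 = next_position maker_strategy breaker
                     (next_position maker_strategy breaker (h j)).
  by rewrite /h /play doubleS !iterS.
have cardh : forall g : seq U, uniq g -> {subset g <= X} -> size g < #|X| ->
     exists2 x, x \in X & x \notin g.
  move=> g ug sg ltg.
  have : ~~ (X \subset g).
    by apply: contraL ltg => /subset_leq_card; rewrite (card_uniqP ug) -leqNgt.
  by case/subsetPn=> x; exists x.
have ltj : size (h j) < #|X|.
  by rewrite sz; apply: leq_trans big; rewrite doubleS ltnS ltnW // ltnS leq_double ltnW.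
have := legB (h j).
case Eb: (breaker (h j)) => [b|]; last first.
  by move=> sXh; have [x /sXh xh /negP] := cardh _ un sub ltj.
move=> [bX bh].
have E1 : next_position maker_strategy breaker (h j) = rcons (h j) b.
  by rewrite /next_position sz odd_double Eb.
have M1 : maker_claimed (rcons (h j) b) = maker_claimed (h j).
  by rewrite maker_rcons // sz odd_double.
have B1 : breaker_claimed (rcons (h j) b) = b |: breaker_claimed (h j).
  by rewrite breaker_rcons // sz odd_double.
have un1 : uniq (rcons (h j) b) by rewrite rcons_uniq bh.
have sub1 : {subset rcons (h j) b <= X}.
  by move=> x; rewrite mem_rcons inE => /predU1P[->//|]; apply: sub.
have sz1 : size (rcons (h j) b) = j.*2.+1 by rewrite size_rcons sz.
have lt1 : size (rcons (h j) b) < #|X|.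
  by rewrite sz1; apply: leq_trans big; rewrite doubleS !ltnS leq_double ltnW.
have /existsP[m /andP[]] : [exists m in X :\: (b |: breaker_claimed (h j)),
         winning (k - j.+1) (m |: maker_claimed (h j)) (b |: breaker_claimed (h j))].
  apply: implyP (H b) _; rewrite in_setD bX andbT claimedU //.
rewrite in_setD => /andP[mB mX] mW.
have exgood : exists m', good_reply (rcons (h j) b) m'.
  have half : (size (rcons (h j) b))./2 = j by rewrite sz1 /= uphalf_double.
  have [mM|mM] := boolP (m \in maker_claimed (h j)).
    have [x xX xh] := cardh _ un1 sub1 lt1.
    exists x; rewrite /good_reply xX xh half M1 B1 /=.
    apply: winning_mono mW; rewrite (setUidPr _) ?sub1set //.
    exact: subsetUr.
  exists m; rewrite /good_reply mX half M1 B1 mW andbT /=.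
  by rewrite -claimedU M1 B1 in_setU negb_or mM mB.
have [m' Em' gm'] : exists2 m', maker_strategy (rcons (h j) b) = Some m' &
    good_reply (rcons (h j) b) m'.
  rewrite /maker_strategy; case: pickP => [m' gm'|H']; first by exists m'.
  by case: exgood => m' ; rewrite H'.
case/and3P: gm' => m'X m'h m'W.
have E2 : h j.+1 = rcons (rcons (h j) b) m'.
  by rewrite hE E1 /next_position sz1 /= odd_double /= Em'.
rewrite E2; split.
- by rewrite size_rcons sz1 doubleS.
- by rewrite rcons_uniq m'h un1.
- by move=> x; rewrite mem_rcons inE => /predU1P[->//|]; apply: sub1.
- rewrite maker_rcons // breaker_rcons // sz1 /= odd_double /=.
  by move: m'W; rewrite sz1 /= uphalf_double.
Qed.

Lemma winning_maker_wins : k.+1.*2 <= #|X| -> winning k set0 set0 ->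
  maker_wins_within X F k.
Proof.
move=> big win0; exists maker_strategy; first exact: maker_strategy_legal.
move=> breaker legB.
have [j jk /existsP[W /andP[WF WM]]] := maker_strategy_wins big win0 legB.
by exists j => //; exists W.
Qed.

End Strategy.
End Game.

(** * Degrees and potentials *)

(** Only arithmetical hypotheses are passed on, so that neither large contexts
    nor section hypotheses enter the proof. *)
Ltac arith :=
  repeat match goal with
  | H : ?P |- _ =>
    lazymatch type of P with
    | Prop => lazymatch P with
              | is_true (leq _ _) => fail
              | @eq nat _ _ => fail
              | _ => clear H
              end
    end
  end; lia.

Lemma card_lower (W : finType) (A A' : {set W}) m : #|A'| + m <= #|A| -> m <= #|A :\: A'|.
Proof.
move=> le; rewrite cardsD; have := subset_leq_card (subsetIr A A').
by move: #|A :&: A'| #|A'| #|A| le; arith.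
Qed.

Lemma card_bigcup_bound (I W : finType) (A : {set I}) (G : I -> {set W}) m :
  (forall i, #|G i| <= m) -> #|\bigcup_(i in A) G i| <= #|A| * m.
Proof.
move=> le; rewrite -sum_nat_const.
elim/big_rec2: _ => [|i k U _ IH]; first by rewrite cards0.
by apply: leq_trans (leq_card_setU _ _) _; apply: leq_add.
Qed.

Section Potential.
Local Open Scope ring_scope.
Variables (V : finType) (q : rat).
Hypothesis q1 : 1 <= q.

(** With q slightly larger than 1 the potential behaves like a smooth maximum:
    a bound on it is a bound on all the degrees. *)
Definition potential (Act : {set V}) (d : V -> nat) : rat :=
  \sum_(x in Act) q ^+ d x.

Lemma potential_bound (Act : {set V}) d D :
  potential Act d < q ^+ D.+1 -> {in Act, forall x, (d x <= D)%N}.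
Proof.
move=> lt x xA; rewrite leqNgt; apply/negP=> dx.
have q0 : 0 <= q by apply: le_trans q1.
have : q ^+ D.+1 <= potential Act d.
  apply: (@le_trans _ _ (q ^+ d x)); first exact: ler_weXn2l.
  rewrite /potential (bigD1 x) //= lerDl sumr_ge0 // => y _; exact: exprn_ge0.
by rewrite leNgt lt.
Qed.

Lemma potential_grow (Act Act' : {set V}) d d' t : Act' \subset Act ->
  {in Act', forall x, (d' x <= d x + t)%N} ->
  potential Act' d' <= q ^+ t * potential Act d.
Proof.
move=> sA le; have q0 : 0 <= q by apply: le_trans q1.
rewrite /potential [X in _ <= _ * X](big_setID Act') /= (setIidPr sA) mulrDr.
apply: (@le_trans _ _ (q ^+ t * \sum_(i in Act') q ^+ d i)).
  rewrite mulr_sumr; apply: ler_sum => x xA.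
  by rewrite -exprD addnC; apply: ler_weXn2l => //; apply: le.
rewrite lerDl mulr_ge0 ?exprn_ge0 // sumr_ge0 // => x _; exact: exprn_ge0.
Qed.

Lemma potential_low (Act Act' : {set V}) d d' D t : Act' \subset Act ->
  {in Act, forall x, (d x <= D)%N} ->
  {in Act', forall x, (d' x <= d x + t)%N} ->
  potential Act' d' <= #|V|%:R * q ^+ (D + t).
Proof.
move=> sA leD le; have q0 : 0 <= q by apply: le_trans q1.
apply: (@le_trans _ _ (\sum_(x in Act') q ^+ (D + t))).
  apply: ler_sum => x xA; apply: ler_weXn2l => //.
  apply: leq_trans (le _ xA) _; rewrite leq_add2r; exact/leD/(subsetP sA).
rewrite sumr_const -[X in X <= _]mulr_natl ler_wpM2r ?exprn_ge0 //.
by rewrite ler_nat max_card.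
Qed.

Lemma expr_increment i s : (i <= s)%N -> q ^+ i <= 1 + i%:R * ((q - 1) * q ^+ s).
Proof.
have q0 : 0 <= q by apply: le_trans q1.
elim: i => [|i IH] lis; first by rewrite expr0 mul0r addr0.
have := IH (ltnW lis).
have : q ^+ i <= q ^+ s by apply: ler_weXn2l => //; apply: ltnW.
have q10 : 0 <= q - 1 by rewrite subr_ge0.
rewrite exprS -[in X in _ -> _ -> _ <= X]natr1 => le1 le2.
have : (q - 1) * q ^+ i <= (q - 1) * q ^+ s by apply: ler_wpM2l.
lra.
Qed.

Variable s : nat.
Hypothesis qs : (2 * s)%:R * ((q - 1) * q ^+ s) <= 1.

(** Removing z gains q^(d z), and z has the largest degree. The at most 2s
    units by which the other degrees grow cost at most q^(d z) (q - 1) q^s each. *)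
Lemma potential_kill (Act Act' : {set V}) (d d' i : V -> nat) z :
  z \in Act -> Act' \subset Act :\ z ->
  {in Act, forall x, (d x <= d z)%N} ->
  {in Act', forall x, (d' x <= d x + i x)%N} ->
  (forall x, (i x <= s)%N) -> (\sum_x i x <= 2 * s)%N ->
  potential Act' d' <= potential Act d.
Proof.
move=> zA sA dz d'd is_ si; have q0 : 0 <= q by apply: le_trans q1.
have q10 : 0 <= q - 1 by rewrite subr_ge0.
have qs' := qs; set c := (q - 1) * q ^+ s in qs'.
have c0 : 0 <= c by rewrite mulr_ge0 ?exprn_ge0.
rewrite [X in _ <= X]/potential (big_setD1 z) //=.
have E : potential Act' d' <= \sum_(x in Act :\ z) (q ^+ d x + (i x)%:R * c * q ^+ d z).
  apply: (@le_trans _ _ (\sum_(x in Act') (q ^+ d x + (i x)%:R * c * q ^+ d z))).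
    apply: ler_sum => x xA'.
    have xA : x \in Act by move: (subsetP sA _ xA'); rewrite inE => /andP[].
    apply: (@le_trans _ _ (q ^+ (d x + i x))); first exact/ler_weXn2l/d'd.
    rewrite exprD.
    apply: (@le_trans _ _ (q ^+ d x * (1 + (i x)%:R * c))).
      by rewrite ler_wpM2l ?exprn_ge0 // expr_increment.
    rewrite mulrDr mulr1 lerD2l mulrC; apply: ler_wpM2l; first by rewrite mulr_ge0.
    by apply: ler_weXn2l => //; apply: dz.
  rewrite [X in _ <= X](big_setID Act') /= (setIidPr sA) lerDl sumr_ge0 // => x _.
  by rewrite addr_ge0 ?mulr_ge0 ?exprn_ge0.
apply: (le_trans E); rewrite big_split /= addrC lerD2r.
rewrite -!mulr_suml -[X in _ <= X]mul1r ler_wpM2r ?exprn_ge0 //.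
apply: le_trans qs'; rewrite ler_wpM2r //.
rewrite -natr_sum ler_nat; apply: leq_trans si.
by rewrite [X in (_ <= X)%N](bigID (mem (Act :\ z))) /= leq_addr.
Qed.

End Potential.

Section Degrees.
Variable V : finType.
Implicit Types (B M : {set {set V}}) (x y z : V) (b : {set V}).

Definition pairs_of : {set {set V}} := [set e : {set V} | #|e| == 2].

Lemma pairs_ofE x y : ([set x; y] \in pairs_of) = (x != y).
Proof. by rewrite inE cards2; case: (x == y). Qed.

(** A graph on V is given by its set of edges. *)
Definition nbrs B x : {set V} := [set y | [set x; y] \in B].
Definition deg B x := #|nbrs B x|.

Lemma card_setU1_leq (W : finType) (w : W) (A : {set W}) : #|w |: A| <= #|A|.+1.
Proof. by rewrite cardsU1 -addn1 addnC leq_add2l leq_b1. Qed.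

Lemma deg_add B b x : b \in pairs_of -> deg (b |: B) x <= deg B x + (x \in b).
Proof.
rewrite inE => /eqP b2.
have -> : (x \in b : nat) = #|if x \in b then b :\ x else set0|.
  by have := cardsD1 x b; rewrite b2; case: (x \in b) => /=; rewrite ?cards0 //; lia.
apply: leq_trans (leq_card_setU _ _); apply/subset_leq_card/subsetP=> y.
rewrite !inE => /orP[/eqP bE|->//].
apply/orP; right.
have xb : x \in b by rewrite -bE !inE eqxx.
rewrite xb !inE -bE !inE eqxx orbT andbT.
by apply/eqP=> yx; move: b2; rewrite -bE yx setUid cards1.
Qed.

Lemma deg_add1 B b x : b \in pairs_of -> deg (b |: B) x <= (deg B x).+1.
Proof. by move/deg_add=> /(_ B x)/leq_trans; apply; rewrite -addn1 leq_add2l; case: (x \in b). Qed.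

Lemma deg_mono B B' x : B \subset B' -> deg B x <= deg B' x.
Proof. by move=> sB; apply/subset_leq_card/subsetP=> y; rewrite !inE; apply: (subsetP sB). Qed.

Lemma set_add_ind (P : {set {set V}} -> Prop) :
  P set0 -> (forall b B, b \in pairs_of -> b \notin B -> B \subset pairs_of ->
             P B -> P (b |: B)) ->
  forall B, B \subset pairs_of -> P B.
Proof.
move=> P0 PS B; move: {2}#|B| (leqnn #|B|) => m; elim: m B => [|m IH] B.
  by rewrite leqn0 cards_eq0 => /eqP->.
move=> lem sB; have [->//|[b bB]] := set_0Vmem B.
rewrite -(setD1K bB); apply: PS; first exact: (subsetP sB).
- by rewrite !inE eqxx.
- by apply: subset_trans sB; apply: subD1set.
- apply: IH; first by move: lem; rewrite (cardsD1 b B) bB.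
  by apply: subset_trans sB; apply: subD1set.
Qed.

Lemma deg_le_card B x : B \subset pairs_of -> deg B x <= #|B|.
Proof.
move: B; apply: set_add_ind => [|b B bX bB sB IH].
  by rewrite /deg (_ : nbrs _ _ = set0) ?cards0 //; apply/setP=> y; rewrite !inE.
by rewrite cardsU1 bB add1n; apply: leq_trans (deg_add1 _ _ bX) _.
Qed.

Lemma sum_deg B : B \subset pairs_of -> \sum_x deg B x <= 2 * #|B|.
Proof.
move: B; apply: set_add_ind => [|b B bX bB sB IH].
  rewrite big1 // => x _; rewrite /deg (_ : nbrs _ _ = set0) ?cards0 //.
  by apply/setP=> y; rewrite !inE.
apply: (@leq_trans (\sum_x (deg B x + (x \in b)))).
  by apply: leq_sum => x _; apply: deg_add.
rewrite big_split /= cardsU1 bB mulnDr muln1 addnC leq_add //.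
move: bX; rewrite inE => /eqP b2; rewrite -[X in _ <= X]b2.
by rewrite -sum1_card [X in _ <= X]big_mkcond; apply: leq_sum => x _; case: (x \in b).
Qed.

Lemma deg_split B B' x : B \subset B' -> deg B' x <= deg B x + deg (B' :\: B) x.
Proof.
move=> sB; apply: leq_trans (leq_card_setU _ _); apply/subset_leq_card/subsetP=> y.
by rewrite !inE => ->; rewrite andbT orbN.
Qed.

Lemma deg_grow B B' x t : B \subset B' -> B' \subset pairs_of ->
  #|B'| <= #|B| + t -> deg B' x <= deg B x + t.
Proof.
move=> sB sB' le; apply: leq_trans (deg_split x sB) _; rewrite leq_add2l.
have sD : B' :\: B \subset pairs_of by apply: subset_trans sB'; apply: subsetDl.
apply: leq_trans (deg_le_card x sD) _.
by rewrite cardsD (setIidPr sB) leq_subLR.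
Qed.

(** Handshaking: Breaker cannot give a large degree to many vertices. *)
Lemma card_high_deg B (Z : {set V}) t : B \subset pairs_of ->
  {in Z, forall x, t <= deg B x} -> #|Z| * t <= 2 * #|B|.
Proof.
move=> sB le; apply: leq_trans (sum_deg sB).
rewrite -sum_nat_const [X in _ <= X](bigID (mem Z)) /=.
by apply: leq_trans (leq_addr _ _); apply: leq_sum.
Qed.

Lemma few_neighbours (I : finType) (A : {set I}) (phi : I -> V) B x :
  {in A &, injective phi} -> #|[set y in A | [set x; phi y] \in B]| <= deg B x.
Proof.
move=> inj; rewrite -(card_in_imset (f := phi)).
  apply/subset_leq_card/subsetP=> z /imsetP[y]; rewrite inE => /andP[_ yB] ->.
  by rewrite inE.
by move=> u v; rewrite !inE => /andP[uA _] /andP[vA _]; apply: inj.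
Qed.

Lemma deg_unused_pick B b z a : b \in pairs_of -> a \notin b ->
  a \notin nbrs B z -> [set z; a] \notin b |: B.
Proof.
move=> bX ab; rewrite inE in_setU1 negb_or => ->; rewrite andbT.
by apply: contra ab => /eqP<-; rewrite !inE eqxx orbT.
Qed.

Lemma notin_nbrs B x y : (y \notin nbrs B x) = ([set x; y] \notin B).
Proof. by rewrite inE. Qed.

Lemma pick_partner B b (Z : {set V}) x : b \in pairs_of ->
  deg B x + 2 < #|Z| ->
  exists2 a, a \in Z & (a \notin b) && ([set x; a] \notin b |: B).
Proof.
move=> bX lt; have b2 : #|b| = 2 by move: bX; rewrite inE => /eqP.
have [|[a]] := set_0Vmem (Z :\: (nbrs B x :|: b)).
  move/eqP; rewrite setD_eq0 => /subset_leq_card.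
  rewrite leqNgt => /negP[]; apply: leq_ltn_trans (leq_card_setU _ _) _.
  by rewrite b2.
rewrite in_setD in_setU negb_or notin_nbrs => /andP[/andP[xaB ab] aZ].
exists a => //; rewrite ab in_setU1 negb_or xaB andbT.
by apply: contra ab => /eqP <-; rewrite !inE eqxx orbT.
Qed.

Variable F : {set {set {set V}}}.
Notation Win := (winning pairs_of F).

Lemma win_step k M B :
  (forall b, b \in pairs_of -> exists2 m, m \in pairs_of :\: (b |: B) &
     Win k (m |: M) (b |: B)) -> Win k.+1 M B.
Proof.
move=> H /=; apply/orP; right; apply/forallP=> b; apply/implyP.
rewrite !inE => /andP[_ b2]; have [|m mX mW] := H b; first by rewrite inE.
by apply/existsP; exists m; rewrite mX mW.
Qed.

(** The vertex a is chosen after Breaker's move b and off b, so that its degree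
    has not just been raised. *)
Lemma win_join k M B (Z : {set V}) x : x \notin Z ->
  deg B x + 2 < #|Z| ->
  (forall b a, b \in pairs_of -> a \in Z -> a \notin b -> [set x; a] \notin b |: B ->
     Win k ([set x; a] |: M) (b |: B)) ->
  Win k.+1 M B.
Proof.
move=> xZ lt H; apply: win_step => b bX.
have [a aZ /andP[ab xaB]] := pick_partner bX lt.
exists [set x; a]; last exact: H.
rewrite in_setD xaB pairs_ofE; apply: contraNneq xZ => -> //.
Qed.

End Degrees.

(** * Joining ports in pairs *)

(** A state s has a set of ports, which Maker has to join in pairs; al s tells
    which pairs of ports may be joined. A pair is in conflict if Breaker owns the
    edge between them. The two applications have different notions of state: in one
    of them the allowed pairs form a complete bipartite graph, in the other one all
    pairs except a perfect matching are allowed. Both are regular enough for the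
    average degree over the partners of a port to be close to the average over all
    ports, which is what the hypothesis average_partner says. *)
Section Port.
Variables (V : finType) (F : {set {set {set V}}}).
Notation Win := (winning (pairs_of V) F).
Variables (St : Type) (pts : St -> {set V}) (al : St -> rel V).
Variable ok : St -> {set {set V}} -> Prop.
Implicit Types (s t : St) (B M : {set {set V}}) (b : {set V}) (u w x y z : V).

Definition partners s u : {set V} := [set w in pts s | al s u w].
Definition conflict s B x y : bool := al s x y && ([set x; y] \in B).
Definition rdeg s B x : nat := \sum_(y in pts s) conflict s B x y.

Hypothesis al_sym : forall s, symmetric (al s).
Hypothesis al_irr : forall s, irreflexive (al s).
Hypothesis many_partners : forall s M u, ok s M -> 3 < #|pts s| -> u \in pts s ->
  #|pts s| <= 2 * #|partners s u|.
Hypothesis average_partner : forall s M B D u, ok s M -> 3 < #|pts s| ->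
  u \in pts s -> {in pts s, forall x, rdeg s B x <= D} ->
  #|partners s u| * (\sum_(x in pts s) rdeg s B x) <=
  #|pts s| * (\sum_(w in partners s u) rdeg s B w) + 2 * D * #|partners s u|.
Hypothesis join_ports : forall s M u w, ok s M -> 3 < #|pts s| ->
  u \in pts s -> w \in pts s -> al s u w ->
  exists t, [/\ ok t ([set u; w] |: M), pts t = pts s :\ u :\ w &
    {in pts t &, forall x y, al t x y -> al s x y}].

Lemma conflictC s B x y : conflict s B x y = conflict s B y x.
Proof. by rewrite /conflict al_sym setUC. Qed.

Lemma al_neq s x y : al s x y -> x != y.
Proof. by apply: contraTneq => ->; rewrite al_irr. Qed.

Lemma sum_conflict_edge (P : {set V}) b x : b \in pairs_of V ->
  \sum_(y in P) ([set x; y] == b : nat) <= (x \in b).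
Proof.
rewrite inE => /eqP b2.
have [xb|xb] := boolP (x \in b); last first.
  rewrite big1 // => y _; case: eqP => // E; case/negP: xb.
  by rewrite -E !inE eqxx.
have c1 : #|b :\ x| = 1 by have := cardsD1 x b; rewrite b2 xb; lia.
apply: leq_trans (_ : #|b :\ x| <= _); last by rewrite c1.
rewrite -sum1_card [X in X <= _]big_mkcond [X in _ <= X]big_mkcond /=.
apply: leq_sum => y _; case: (y \in P) => //; case: eqP => //= E.
rewrite !inE -E !inE eqxx orbT andbT.
have [yx|//] := eqVneq y x.
by move: b2; rewrite -E yx setUid cards1.
Qed.

Lemma conflict_add s t B b x y : {in pts t &, forall x y, al t x y -> al s x y} ->
  x \in pts t -> y \in pts t ->
  (conflict t (b |: B) x y : nat) <= conflict s B x y + ([set x; y] == b).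
Proof.
move=> H xt yt; rewrite /conflict in_setU1.
have := H _ _ xt yt; case: (al t x y) => //= -> //=.
by case: eqP => _; case: (_ \in B).
Qed.

Lemma rdeg_add s t B b x : b \in pairs_of V ->
  pts t \subset pts s -> {in pts t &, forall x y, al t x y -> al s x y} ->
  x \in pts t -> rdeg t (b |: B) x <= rdeg s B x + (x \in b).
Proof.
move=> bX sub H xt.
apply: leq_trans (_ : rdeg s B x + \sum_(y in pts t) ([set x; y] == b : nat) <= _).
  rewrite /rdeg [X in _ <= X + _](big_setID (pts t)) /= (setIidPr sub) addnAC.
  apply: leq_trans (leq_addr _ _); rewrite -big_split /=.
  by apply: leq_sum => y yt; apply: conflict_add.
by rewrite leq_add2l sum_conflict_edge.
Qed.

(** Both ports disappear with their conflicts; these are disjoint because the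
    pair u, w was free. Breaker's move adds at most one conflict, counted twice. *)
Lemma join_effect s t B b u w : b \in pairs_of V ->
  u \in pts s -> w \in pts s -> u != w -> [set u; w] \notin B ->
  pts t = pts s :\ u :\ w -> {in pts t &, forall x y, al t x y -> al s x y} ->
  \sum_(x in pts t) rdeg t (b |: B) x + 2 * rdeg s B u + 2 * rdeg s B w
    <= \sum_(x in pts s) rdeg s B x + 2.
Proof.
move=> bX us ws uw nB Et Ha.
have uw0 : conflict s B u w = false by rewrite /conflict (negbTE nB) andbF.
have wu0 : conflict s B w u = false by rewrite conflictC.
have xx0 x : conflict s B x x = false by rewrite /conflict al_irr.
have ws' : w \in pts s :\ u by rewrite in_setD1 eq_sym uw.
have split2 (f : V -> nat) : \sum_(x in pts s) f x = f u + (f w + \sum_(x in pts t) f x).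
  by rewrite (big_setD1 u) //= (big_setD1 w) //= Et.
have rdE x : rdeg s B x = conflict s B x u + (conflict s B x w +
     \sum_(y in pts t) conflict s B x y).
  by rewrite /rdeg split2.
have E1 : rdeg s B u = \sum_(y in pts t) conflict s B u y by rewrite rdE xx0 uw0.
have E2 : rdeg s B w = \sum_(y in pts t) conflict s B w y by rewrite rdE xx0 wu0.
have E3 : \sum_(x in pts t) rdeg s B x =
   rdeg s B u + rdeg s B w + \sum_(x in pts t) \sum_(y in pts t) conflict s B x y.
  rewrite E1 E2 -!big_split /=; apply: eq_bigr => x _.
  by rewrite rdE addnA (conflictC s B u) (conflictC s B w).
have E4 : \sum_(x in pts t) rdeg t (b |: B) x <=
   \sum_(x in pts t) \sum_(y in pts t) conflict s B x y + 2.
  apply: leq_trans (_ : \sum_(x in pts t) (\sum_(y in pts t) conflict s B x y + (x \in b)) <= _).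
    apply: leq_sum => x xt.
    apply: leq_trans (_ : \sum_(y in pts t) conflict s B x y +
        \sum_(y in pts t) ([set x; y] == b : nat) <= _).
      by rewrite -big_split; apply: leq_sum => y yt; apply: conflict_add.
    by rewrite leq_add2l sum_conflict_edge.
  rewrite big_split leq_add2l /=; move: bX; rewrite inE => /eqP b2.
  rewrite -[X in _ <= X]b2 -sum1_card [X in _ <= X]big_mkcond [X in X <= _]big_mkcond /=.
  by apply: leq_sum => x _; case: (x \in pts t); case: (x \in b).
rewrite (split2 (rdeg s B)) E3; lia.
Qed.

Lemma rdeg_partners s B u :
  rdeg s B u = #|[set w in partners s u | [set u; w] \in B]|.
Proof.
rewrite /rdeg -sum1_card big_mkcond [RHS]big_mkcond /=; apply: eq_bigr => w _.
by rewrite !inE /conflict; case: (w \in pts s) => //=; case: (al s u w).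
Qed.

Lemma partners_pts s u w : w \in partners s u -> w \in pts s.
Proof. by rewrite inE => /andP[]. Qed.

(** The partners of u that cannot be used (at most D + 1 of them) and the error
    in the average cost this much in the comparison of degrees below. *)
Definition slack D := 2 * D + 2 * (D * D.+1).

(** Otherwise all free partners would have a degree below the average, while
    the few partners that are not free are too few to make up for it. *)
Lemma good_partner s M B D b u : ok s M -> 3 < #|pts s| -> u \in pts s ->
  {in pts s, forall x, rdeg s B x <= D} -> b \in pairs_of V ->
  (rdeg s B u).+1 < #|partners s u| ->
  exists w, [/\ w \in partners s u, [set u; w] \notin b |: B &
     \sum_(x in pts s) rdeg s B x <= #|pts s| * rdeg s B w + slack D].
Proof.
move=> oks N4 us leD bX lt.
set C := partners s u in lt *; set N := #|pts s|; set e2 := \sum_(x in _) _.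
pose bad := [set w in C | [set u; w] \in b |: B].
have badC : bad \subset C by apply/subsetP=> w; rewrite inE => /andP[].
have cbad : #|bad| <= (rdeg s B u).+1.
  rewrite rdeg_partners -addn1.
  apply: leq_trans (_ : #|[set w in C | [set u; w] \in B] :|: [set w | [set u; w] == b]| <= _).
    apply/subset_leq_card/subsetP=> w.
    by rewrite !inE => /andP[-> /orP[->|->]]; rewrite ?orbT.
  apply: leq_trans (leq_card_setU _ _) _; rewrite leq_add2l.
  have le1 := leq_trans (sum_conflict_edge setT u bX) (leq_b1 _).
  apply: leq_trans le1.
  rewrite -sum1_card [X in X <= _]big_mkcond [X in _ <= X]big_mkcond /=.
  by apply: leq_sum => w _; rewrite !inE; case: (_ == b).
case: (pickP [pred w in C :\: bad | e2 <= N * rdeg s B w + slack D]) => [w|H].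
  case/andP; rewrite in_setD => /andP[nb wC] le; exists w; split=> //.
  by move: nb; rewrite inE wC.
exfalso.
have h1 w : w \in C :\: bad -> N * rdeg s B w + slack D + 1 <= e2.
  by move=> wC; have := H w; rewrite inE wC /= => /negbT; rewrite -ltnNge addn1.
have cD : 0 < #|C :\: bad|.
  by rewrite cardsD (setIidPr badC) subn_gt0; apply: leq_ltn_trans lt.
have avg := average_partner oks N4 us leD.
have N2C := many_partners oks N4 us.
rewrite -/C -/N -/e2 in avg N2C.
have S1 : N * \sum_(w in C :\: bad) rdeg s B w + (slack D + 1) * #|C :\: bad| <= e2 * #|C :\: bad|.
  rewrite big_distrr /= -![_ * #|_|]mulnC -!sum_nat_const -big_split /=.
  by apply: leq_sum => w wC; rewrite addnA; apply: h1.
have S2 : \sum_(w in bad) rdeg s B w <= #|bad| * D.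
  rewrite -sum_nat_const; apply: leq_sum => w wb; apply: leD.
  by apply: (@partners_pts _ u); apply: (subsetP badC).
have S3 : \sum_(w in C) rdeg s B w =
    \sum_(w in bad) rdeg s B w + \sum_(w in C :\: bad) rdeg s B w.
  by rewrite (big_setID bad) /= (setIidPr badC).
have cC : #|C| = #|bad| + #|C :\: bad|.
  by rewrite -{1}(setIidPr badC) cardsID.
have bD : #|bad| <= D.+1 by apply: leq_trans cbad _; rewrite ltnS leD.
move: avg S1; rewrite S3.
set a := \sum_(w in bad) _ in S2 *; set c := \sum_(w in C :\: bad) _.
set k1 := #|bad| in cC bD S2 *; set k2 := #|C :\: bad| in cD cC *.
move: N2C; rewrite cC /slack => N2C avg S1.
have S5 : N * a <= 2 * (k1 + k2) * (D.+1 * D).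
  apply: leq_trans (_ : N * (D.+1 * D) <= _); last by rewrite leq_mul2r N2C orbT.
  by rewrite leq_mul2l (leq_trans S2) ?orbT // leq_mul2r bD orbT.
have e2big : 2 * D + 2 * (D * D.+1) + 1 <= e2.
  have [w wC] : exists w, w \in C :\: bad by apply/set0Pn; rewrite -cards_eq0 -lt0n.
  by have := h1 w wC; rewrite /slack; lia.
have : k1 * (2 * D + 2 * (D * D.+1)) <= k1 * e2 by rewrite leq_mul2l; apply/orP; right; lia.
nia.
Qed.


Lemma partners_join s u w t : u != w -> pts t = pts s :\ u :\ w ->
  u \in pts s -> w \in pts s -> #|pts s| = #|pts t| + 2.
Proof.
move=> uw -> us ws; rewrite (cardsD1 u) us (cardsD1 w) in_setD1 eq_sym uw ws /=; lia.
Qed.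

Variables (B0 : {set {set V}}) (m0 : nat).

Hypothesis last_pair : forall s M B, ok s M -> #|pts s| = 2 ->
  B0 \subset B -> B \subset pairs_of V -> #|B| <= #|B0| + m0 -> Win 3 M B.

(** The last clause counts the moves: Breaker claims at most one edge for each
    pair that is joined. *)
Definition port_state s M B m :=
  [/\ ok s M, #|pts s| = 2 * m, B0 \subset B, B \subset pairs_of V &
     #|B| + m <= #|B0| + m0].

Lemma port_state_step s t M B b u w m : port_state s M B m.+1 ->
  b \in pairs_of V -> u \in pts s -> w \in pts s -> al s u w ->
  pts t = pts s :\ u :\ w -> ok t ([set u; w] |: M) ->
  port_state t ([set u; w] |: M) (b |: B) m.
Proof.
move=> [oks sz sB0 sB leB] bX us ws auw Et okt; split=> //.
- by have := partners_join (al_neq auw) Et us ws; rewrite sz; lia.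
- by apply: subset_trans sB0 _; apply: subsetUr.
- by rewrite subUset sub1set bX.
- by rewrite cardsU1; move: leB; case: (_ \notin _) => /=; lia.
Qed.

Lemma port_round k s M B m :
  port_state s M B m -> 3 < #|pts s| ->
  (forall b, b \in pairs_of V -> exists u w, [/\ u \in pts s, w \in pts s, al s u w,
     [set u; w] \notin b |: B &
     forall t, pts t = pts s :\ u :\ w -> ok t ([set u; w] |: M) ->
       {in pts t &, forall x y, al t x y -> al s x y} ->
       port_state t ([set u; w] |: M) (b |: B) m.-1 ->
       Win k ([set u; w] |: M) (b |: B)]) ->
  Win k.+1 M B.
Proof.
move=> st N4 H; apply: win_step => b bX.
have [u [w [us ws auw nB cont]]] := H b bX.
have [oks sz _ _ _] := st.
have [t [okt Et Ha]] := join_ports oks N4 us ws auw.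
exists [set u; w]; first by rewrite in_setD nB pairs_ofE (al_neq auw).
apply: (cont t) => //.
by apply: (@port_state_step s) => //; rewrite prednK //; lia.
Qed.

(** If the conflicts form a matching, then joining an end of Breaker's next edge
    to a free port leaves a matching again. The case of four ports is treated separately: there
    the eight allowed ordered pairs outnumber the conflicts. *)
Lemma port_matching m s M B : port_state s M B m -> 0 < m ->
  {in pts s, forall x, rdeg s B x <= 1} -> Win (m + 2) M B.
Proof.
elim: m s M B => [//|m IH] s M B st _ le1.
have [oks sz sB0 sB leB] := st.
case: m IH st sz leB => [|m] IH st sz leB.
  by rewrite addn2; apply: last_pair oks _ sB0 sB _; rewrite ?sz //; lia.
have N4 : 3 < #|pts s| by rewrite sz; lia.
rewrite addSn; apply: (port_round st N4) => b bX.
have sumle : \sum_(x in pts s) rdeg s B x <= #|pts s|.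
  by rewrite -sum1_card; apply: leq_sum => x xs; apply: le1.
case: m IH st sz leB => [|m] IH st sz leB.
  case: (pickP [pred p : V * V | [&& p.1 \in pts s, p.2 \in partners s p.1 &
      [set p.1; p.2] \notin b |: B]]) => [[u w] /and3P[/= us ws nB]|H].
    move: ws; rewrite inE => /andP[ws auw]; exists u, w; split=> // t Et okt Ha stt.
    have [_ szt sB0t sBt leBt] := stt.
    by apply: last_pair okt _ sB0t sBt _; rewrite ?szt //; lia.
  exfalso.
  have full : \sum_(x in pts s) #|partners s x| <= \sum_(x in pts s) rdeg s (b |: B) x.
    apply: leq_sum => u us; rewrite rdeg_partners; apply/subset_leq_card/subsetP=> w wp.
    by have := H (u, w); rewrite !inE /= us => /=; move: wp; rewrite inE => -> /= /negbFE.
  have big : 8 <= \sum_(x in pts s) #|partners s x|.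
    apply: leq_trans (_ : \sum_(x in pts s) 2 <= _); first by rewrite sum_nat_const sz.
    apply: leq_sum => u us; have := many_partners oks N4 us; rewrite sz; lia.
  have : \sum_(x in pts s) rdeg s (b |: B) x <= \sum_(x in pts s) rdeg s B x + 2.
    apply: leq_trans (_ : \sum_(x in pts s) (rdeg s B x + (x \in b)) <= _).
      by apply: leq_sum => x xs; apply: (rdeg_add B bX (subxx _)).
    rewrite big_split leq_add2l /=; move: bX; rewrite inE => /eqP b2.
    rewrite -[X in _ <= X]b2 -sum1_card [X in _ <= X]big_mkcond [X in X <= _]big_mkcond /=.
    by apply: leq_sum => x _; case: (x \in pts s); case: (x \in b).
  move: sumle; rewrite sz; lia.
have [u us ub] : exists2 u, u \in pts s & (u \in b) || [disjoint b & pts s].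
  have [D|] := boolP [disjoint b & pts s].
    have [u us] : exists u, u \in pts s by apply/set0Pn; rewrite -card_gt0; lia.
    by exists u => //; rewrite orbT.
  by rewrite -setI_eq0 => /set0Pn[u]; rewrite inE => /andP[ub us]; exists u; rewrite ?ub.
have lt : rdeg s (b |: B) u < #|partners s u|.
  have := many_partners oks N4 us; have := le1 u us.
  have := rdeg_add (s := s) (t := s) B bX (subxx _) (fun x y _ _ h => h) us.
  by rewrite sz; case: (u \in b); lia.
have [w wC nB] : exists2 w, w \in partners s u & [set u; w] \notin b |: B.
  case: (pickP [pred w in partners s u | [set u; w] \notin b |: B]) => [w /andP[]|H].
    by exists w.
  move: lt; rewrite ltnNge rdeg_partners => /negP[]; apply/subset_leq_card/subsetP=> w wC.
  by rewrite inE wC /=; have := H w; rewrite inE /= wC => /= /negbFE.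
move: wC; rewrite inE => /andP[ws auw].
exists u, w; split=> // t Et okt Ha stt.
apply: (IH t) => // x xt.
have xs : x \in pts s by move: xt; rewrite Et !inE => /and3P[].
apply: leq_trans (le1 x xs); rewrite /rdeg [X in _ <= X](big_setID (pts t)) /=.
have tsub : pts t \subset pts s by rewrite Et; apply: subset_trans (subsetDl _ _) (subsetDl _ _).
rewrite (setIidPr tsub); apply: leq_trans (leq_addr _ _); apply: leq_sum => y yt.
apply: leq_trans (conflict_add B b Ha xt yt) _.
case: eqP => [E|_]; last by rewrite addn0.
exfalso; case/orP: ub => [|/pred0P/(_ x)].
  by rewrite -E !inE; move: xt yt; rewrite Et !inE => /and3P[_ /negbTE xu _] /and3P[_ /negbTE yu _]; rewrite eq_sym xu eq_sym yu.
by rewrite /= -E !inE eqxx xs.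
Qed.

Lemma partners_card2 s M m u : ok s M -> #|pts s| = 2 * m -> 1 < m -> u \in pts s ->
  m <= #|partners s u|.
Proof.
move=> oks sz m1 us; have := many_partners oks _ us; rewrite sz leq_mul2l /=.
by apply; lia.
Qed.

(** A port with two conflicts can be joined, which lowers the number of
    conflicts by at least one; without such a port the conflicts form a matching. *)
Lemma port_few m s M B : port_state s M B m ->
  \sum_(x in pts s) rdeg s B x + 4 <= m -> Win (m + 2) M B.
Proof.
elim: m s M B => [|m IH] s M B st le; first by move: le; rewrite addn4.
have [oks sz sB0 sB leB] := st.
case: (pickP [pred u in pts s | 1 < rdeg s B u]) => [u /andP[us du]|H]; last first.
  apply: port_matching st _ _ => // x xs.
  by have := H x; rewrite inE /= xs /= ltnNge => /negbFE.
have du' : rdeg s B u <= m.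
  have : rdeg s B u <= \sum_(x in pts s) rdeg s B x by rewrite (bigD1 u) //= leq_addr.
  by lia.
have N4 : 3 < #|pts s| by rewrite sz; lia.
rewrite addSn; apply: (port_round st N4) => b bX.
have leD : {in pts s, forall x, rdeg s B x <= m.+1}.
  move=> x xs; have : rdeg s B x <= \sum_(x in pts s) rdeg s B x.
    by rewrite [X in _ <= X](bigD1 x) //= leq_addr.
  by lia.
have cp := partners_card2 oks sz _ us.
have lt : (rdeg s B u).+1 < #|partners s u|.
  have : rdeg s B u <= \sum_(x in pts s) rdeg s B x by rewrite (bigD1 u) //= leq_addr.
  have : m.+1 <= #|partners s u| by apply: cp; lia.
  by lia.
have [w [wC nB _]] := good_partner oks N4 us leD bX lt.
move: wC; rewrite inE => /andP[ws auw].
exists u, w; split=> // t Et okt Ha stt; apply: (IH t) => //.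
have nB' : [set u; w] \notin B by move: nB; rewrite in_setU1 negb_or => /andP[].
have := join_effect bX us ws (al_neq auw) nB' Et Ha; lia.
Qed.

Section Greedy.
Variables (q C : rat) (D : nat).
Hypothesis q1 : (1 <= q)%R.
Hypothesis qs : ((2 * 1)%:R * ((q - 1) * q ^+ 1) <= 1 :> rat)%R.
Hypothesis CD : (C < q ^+ D.+1)%R.

Definition port_potential s B := potential q (pts s) (rdeg s B).

(** The port u of largest degree is joined to a partner w of at least nearly
    average degree. The numbers d and e stand for their degrees. *)
Lemma port_greedy m s M B : port_state s M B m.+1 -> D.+1 < m ->
  (port_potential s B <= C)%R ->
  (forall t M' B' d e, port_state t M' B' m -> (port_potential t B' <= C)%R ->
    {in pts s, forall x, rdeg s B x <= d} ->
    \sum_(x in pts s) rdeg s B x <= 2 * m.+1 * d ->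
    \sum_(x in pts s) rdeg s B x <= 2 * m.+1 * e + slack D ->
    \sum_(x in pts t) rdeg t B' x + 2 * d + 2 * e <= \sum_(x in pts s) rdeg s B x + 2 ->
    Win (m + 2) M' B') ->
  Win (m.+1 + 2) M B.
Proof.
move=> st Dm pot cont; have [oks sz sB0 sB leB] := st.
have N4 : 3 < #|pts s| by rewrite sz; lia.
have leD : {in pts s, forall x, rdeg s B x <= D}.
  by apply: (potential_bound q1); apply: le_lt_trans pot CD.
have [u0 u0s] : exists u, u \in pts s by apply/set0Pn; rewrite -card_gt0; lia.
case: (arg_maxnP (rdeg s B) u0s) => u us umax.
rewrite addSn; apply: (port_round st N4) => b bX.
have lt : (rdeg s B u).+1 < #|partners s u|.
  have := partners_card2 oks sz _ us; have := leD u us; lia.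
have [w [wC nB le]] := good_partner oks N4 us leD bX lt.
move: wC; rewrite inE => /andP[ws auw].
exists u, w; split=> // t Et okt Ha stt.
have nB' : [set u; w] \notin B by move: nB; rewrite in_setU1 negb_or => /andP[].
have eff := join_effect bX us ws (al_neq auw) nB' Et Ha.
rewrite sz in le.
apply: (cont t _ _ (rdeg s B u) (rdeg s B w)) => //.
- apply: le_trans pot; apply: (potential_kill (i := fun x => x \in b : nat) q1 qs us).
  + by rewrite Et; apply: subsetDl.
  + exact: umax.
  + move=> x xt; apply: (rdeg_add B bX) => //.
    by rewrite Et; apply: subset_trans (subsetDl _ _) (subsetDl _ _).
  + by move=> x; case: (x \in b).
  + move: bX; rewrite inE => /eqP b2; rewrite -[X in _ <= _ * X]/1 muln1 -[X in _ <= X]b2 -sum1_card.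
    by rewrite [X in _ <= X]big_mkcond; apply: leq_sum => x _; case: (x \in b).
- by rewrite -sz -sum_nat_const; apply: leq_sum => x xs; apply: umax.
Qed.

(** There is a port of degree at least two and the average degree is positive,
    so the sum of the degrees decreases by four in each round. It thus keeps below
    4m - 4m3 until it is as small as the slack. *)
Lemma port_sparse m3 m s M B : slack D + 4 <= m3 -> D + 3 <= m3 ->
  port_state s M B m -> (port_potential s B <= C)%R ->
  \sum_(x in pts s) rdeg s B x + 4 * m3 <= 4 * m -> Win (m + 2) M B.
Proof.
move=> Sm3 Dm3; elim: m s M B => [|m IH] s M B st pot le; first by lia.
have [small|large] := leqP (\sum_(x in pts s) rdeg s B x) (slack D).
  by apply: (port_few st); lia.
case: (pickP [pred u in pts s | 1 < rdeg s B u]) => [u /andP[us du]|H]; last first.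
  apply: port_matching st _ _ => // x xs.
  by have := H x; rewrite inE /= xs /= ltnNge => /negbFE.
apply: (port_greedy st _ pot) => [|t M' B' d e stt pott dmax _ he eff]; first by lia.
apply: (IH t) => //; have := dmax u us => /= d2.
have e0 : 0 < e by rewrite lt0n; apply/eqP=> e0; move: he; rewrite e0 muln0; lia.
lia.
Qed.

(** The pair that is joined carries almost twice the average degree, so that
    the sum of the degrees, divided by m squared, decreases apart from Breaker's own
    additions, which sum up to a term linear in m. The constants leave room for the
    rounding errors. *)
Lemma port_dense m3 D0 m s M B : slack D + 4 <= m3 -> D + 3 <= m3 ->
  5 * slack D <= m3 -> 10 * D0 * m3 <= m0 -> 0 < m0 ->
  port_state s M B m -> (port_potential s B <= C)%R -> 4 * m3 <= m ->
  5 * m0 * (\sum_(x in pts s) rdeg s B x) <= 10 * D0 * m ^ 2 + 11 * m0 * m ->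
  Win (m + 2) M B.
Proof.
move=> Sm3 Dm3 S5 m0D m00; elim: m s M B => [|m IH] s M B st pot m3m le; first by lia.
have [small|large] := leqP (10 * D0 * m.+1) (4 * m0).
  apply: (port_sparse Sm3 Dm3 st pot).
  set e2 := \sum_(_ in _) _ in le *.
  have : 5 * m0 * e2 <= 5 * m0 * (3 * m.+1).
    apply: leq_trans le _.
    have : 10 * D0 * m.+1 * m.+1 <= 4 * m0 * m.+1 by rewrite leq_mul2r small orbT.
    lia.
  rewrite leq_mul2l; lia.
apply: (port_greedy st _ pot) => [|t M' B' d e stt pott _ hd he eff]; first by lia.
apply: (IH t) => //.
  have : 4 * m0 < 10 * D0 * m.+1 by [].
  have : 4 * (10 * D0 * m3) <= 4 * m0 by rewrite leq_mul2l.
  move=> h1 h2; have : 10 * D0 * (4 * m3) < 10 * D0 * m.+1.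
    by rewrite mulnCA; apply: leq_ltn_trans h1 h2.
  by rewrite ltn_mul2l ltnS => /andP[].
move: le hd he eff.
set x := \sum_(_ in pts s) _; set y := \sum_(_ in _) _ => le hd he eff.
have h1 : m.+1 * y <= (m.+1 - 2) * x + 2 * m.+1 + slack D.
  have : m.+1 * (y + 2 * d + 2 * e) <= m.+1 * (x + 2) by rewrite leq_mul2l eff.
  have m2 : 2 <= m.+1 by lia.
  rewrite mulnBl; have : 2 * x <= m.+1 * x by rewrite leq_mul2r m2 orbT.
  lia.
have h2 : 5 * m0 * (m.+1 * y) <= (m.+1 - 2) * (5 * m0 * x) + 11 * m0 * m.+1.
  have : 5 * m0 * (m.+1 * y) <= 5 * m0 * ((m.+1 - 2) * x + 2 * m.+1 + slack D) by rewrite leq_mul2l h1 orbT.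
  have : m0 * (5 * slack D) <= m0 * m.+1 by rewrite leq_mul2l; apply/orP; right; lia.
  lia.
have h3 : (m.+1 - 2) * (5 * m0 * x) <= (m.+1 - 2) * (10 * D0 * m.+1 ^ 2 + 11 * m0 * m.+1).
  by rewrite leq_mul2l le orbT.
rewrite -(leq_pmul2l (isT : 0 < m.+1)).
have -> : m.+1 * (5 * m0 * y) = 5 * m0 * (m.+1 * y) by lia.
apply: (leq_trans h2); apply: leq_trans (_ : (m.+1 - 2) * (10 * D0 * m.+1 ^ 2 + 11 * m0 * m.+1) + 11 * m0 * m.+1 <= _).
  by rewrite leq_add2r.
have : 0 < m by lia.
clear; case: m => [//|m] _.
rewrite !subSS subn0; nia.
Qed.


(** The phases follow one another: a dense graph becomes sparse, then it has
    only few edges, then it is a matching. The two extra moves are spent by the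
    hypothesis on the last pair. *)
Theorem port_game m3 D0 s M : slack D + 4 <= m3 -> D + 3 <= m3 ->
  5 * slack D <= m3 -> 10 * D0 * m3 <= m0 -> 4 * m3 <= m0 ->
  ok s M -> #|pts s| = 2 * m0 -> B0 \subset pairs_of V ->
  {in pts s, forall x, rdeg s B0 x <= D0} ->
  ((2 * m0)%:R * q ^+ D0 <= C)%R -> Win (m0 + 2) M B0.
Proof.
move=> Sm3 Dm3 S5 m0D m0m3 oks sz sB leD leC.
have m00 : 0 < m0 by lia.
apply: (port_dense Sm3 Dm3 S5 m0D m00 (s := s)) => //.
- apply: le_trans leC; rewrite /port_potential /potential.
  apply: (@le_trans _ _ (\sum_(x in pts s) q ^+ D0)%R).
    by apply: ler_sum => x xs; apply: ler_weXn2l => //; apply: leD.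
  by rewrite sumr_const sz mulr_natl.
- have : \sum_(x in pts s) rdeg s B0 x <= 2 * m0 * D0.
    by rewrite -sz -sum_nat_const; apply: leq_sum.
  move=> h; apply: leq_trans (_ : 5 * m0 * (2 * m0 * D0) <= _).
    by rewrite leq_mul2l h orbT.
  by apply: leq_trans (leq_addr _ _); lia.
Qed.
End Greedy.
End Port.

Lemma rdeg_le_deg (V : finType) (St : Type) (pts : St -> {set V}) (al : St -> rel V) s B x :
  rdeg pts al s B x <= deg B x.
Proof.
by rewrite rdeg_partners; apply/subset_leq_card/subsetP=> z; rewrite !inE => /andP[].
Qed.

(** * Growing a copy of a rooted forest *)

(** The tree is cut into a forest with parent function par and set of roots rho;
    depth bounds the number of steps to a root. *)
Section Growth.
Variables (V T : finType) (F : {set {set {set V}}}).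
Notation Win := (winning (pairs_of V) F).
Variables (par : T -> T) (depth : T -> nat) (rho : {set T}) (Delta : nat).
Hypothesis depth_par : forall x, x \notin rho -> depth (par x) < depth x.
Definition children v : {set T} := [set w | (w \notin rho) && (par w == v)].
Hypothesis few_children : forall v, #|children v| <= Delta.
Hypothesis cardVT : #|V| = #|T|.
Implicit Types (S K : {set T}) (f g : T -> V) (B M : {set {set V}}).
Implicit Types (b : {set V}) (x y z : V) (v w : T).

Definition partial_copy S f M :=
  [/\ rho \subset S, {in S &, injective f} &
    {in S, forall w, w \notin rho -> par w \in S /\ [set f (par w); f w] \in M}].

Definition unused S f : {set V} := ~: (f @: S).
(** Each vertex outside S needs the edge to its parent, the #|rho| parts of the
    forest lack #|rho| - 1 edges of the tree, and two moves may be wasted. *)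
Definition budget S := #|T| - #|S| + #|rho|.+1.
Definition extends S f S' f' := S \subset S' /\ {in S, f' =1 f}.
Definition update f w x : T -> V := fun u => if u == w then x else f u.

Lemma extends_refl S f : extends S f S f.
Proof. by split. Qed.

Lemma extends_trans S1 f1 S2 f2 S3 f3 :
  extends S1 f1 S2 f2 -> extends S2 f2 S3 f3 -> extends S1 f1 S3 f3.
Proof.
move=> [s12 e12] [s23 e23]; split; first exact: subset_trans s23.
by move=> w wS; rewrite e23 ?e12 // (subsetP s12).
Qed.

Lemma partial_copy_mono S f M M' : M \subset M' ->
  partial_copy S f M -> partial_copy S f M'.
Proof.
move=> sM [rS inj E]; split=> // w wS wr; have [pS eM] := E w wS wr.
by split=> //; apply: (subsetP sM).
Qed.

Lemma card_unused S f M : partial_copy S f M -> #|unused S f| = #|T| - #|S|.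
Proof.
move=> [_ inj _]; rewrite /unused; have := cardsC (f @: S).
by rewrite card_in_imset // cardVT; arith.
Qed.

Lemma unused_sub S f S' f' : extends S f S' f' -> unused S' f' \subset unused S f.
Proof.
move=> [sS E]; rewrite setCS; apply/subsetP=> x /imsetP[w wS ->].
by rewrite -E //; apply: imset_f; apply: (subsetP sS).
Qed.

Lemma updateE f w x u : u != w -> update f w x u = f u.
Proof. by rewrite /update => /negbTE->. Qed.

Lemma update_same f w x : update f w x w = x.
Proof. by rewrite /update eqxx. Qed.

Lemma extends_update S f w x : w \notin S -> extends S f (w |: S) (update f w x).
Proof.
move=> wS; split; first exact: subsetUr.
by move=> u uS; rewrite updateE //; apply: contraNneq wS => <-.
Qed.

Lemma partial_copy_add S f M w x : partial_copy S f M -> w \notin S -> w \notin rho ->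
  par w \in S -> x \in unused S f -> [set f (par w); x] \in M ->
  partial_copy (w |: S) (update f w x) M.
Proof.
move=> [rS inj E] wS wr pS xU eM; split.
- by apply: subset_trans rS _; apply: subsetUr.
- have nx u : u \in S -> f u != x.
    move=> uS; apply: contraTneq xU => <-; rewrite in_setC negbK; exact: imset_f.
  have nw u : u \in S -> u != w by move=> uS; apply: contraNneq wS => <-.
  move=> u1 u2; rewrite !in_setU1 => /predU1P[->|u1S] /predU1P[->|u2S] //.
  + by rewrite update_same updateE ?nw // => /eqP; rewrite eq_sym (negbTE (nx _ u2S)).
  + by rewrite update_same updateE ?nw // => /eqP; rewrite (negbTE (nx _ u1S)).
  + by rewrite !updateE ?nw //; apply: inj.
- move=> u; rewrite in_setU1 => /predU1P[->|uS] ur.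
    rewrite update_same updateE; last by apply: contraNneq wS => <-.
    by rewrite in_setU1 pS orbT.
  have [puS peM] := E u uS ur.
  rewrite !updateE ?in_setU1 ?puS ?orbT //.
    by apply: contraNneq wS => <-.
  by apply: contraNneq wS => <-.
Qed.

Lemma budget_add S w : w \notin S -> budget S = (budget (w |: S)).+1.
Proof.
move=> wS; have cU : #|w |: S| = #|S|.+1 by rewrite cardsU1 wS.
have : #|S| < #|T|.
  rewrite ltn_neqAle max_card andbT; apply: contra wS => /eqP E.
  have /eqP -> : S == [set: T] by rewrite eqEcard subsetT cardsT E leqnn.
  by rewrite inE.
rewrite /budget cU; arith.
Qed.

Lemma unused_update S f w a x : x \in unused S f -> w \notin S -> x != a ->
  x \in unused (w |: S) (update f w a).
Proof.
move=> xU wS xa; rewrite in_setC; apply/imsetP=> -[u].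
rewrite in_setU1 => /predU1P[->|uS E]; first by rewrite update_same; apply/eqP.
move: xU; rewrite in_setC => /negP[]; rewrite E updateE ?imset_f //.
by apply: contraNneq wS => <-.
Qed.

Lemma embed_step S f M B w (Z : {set V}) : partial_copy S f M ->
  w \notin S -> w \notin rho -> par w \in S -> Z \subset unused S f ->
  deg B (f (par w)) + 2 < #|Z| ->
  (forall b x M', b \in pairs_of V -> x \in Z -> x \notin b -> M \subset M' ->
     [set f (par w); x] \notin b |: B ->
     partial_copy (w |: S) (update f w x) M' ->
     Win (budget (w |: S)) M' (b |: B)) ->
  Win (budget S) M B.
Proof.
move=> pc wS wr pS sZ lt cont; rewrite (budget_add wS).
apply: (win_join (Z := Z) (x := f (par w))) => //.
  apply/negP=> /(subsetP sZ); rewrite in_setC => /negP[]; exact: imset_f.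
move=> b x bX xZ xb nB; apply: (cont b x) => //; first exact: subsetUr.
apply: partial_copy_add => //; last by rewrite setU11.
  by apply: partial_copy_mono pc; apply: subsetUr.
exact: (subsetP sZ).
Qed.

Lemma embed_children S f M B v (L : {set T}) : partial_copy S f M ->
  B \subset pairs_of V -> v \in S -> L \subset children v :\: S ->
  deg B (f v) + 2 * #|L| + 2 <= #|T| - #|S| ->
  (forall f' M' B', partial_copy (S :|: L) f' M' -> extends S f (S :|: L) f' ->
     B \subset B' -> B' \subset pairs_of V -> #|B'| <= #|B| + #|L| ->
     Win (budget (S :|: L)) M' B') ->
  Win (budget S) M B.
Proof.
move: {2}#|L| (erefl #|L|) => n; elim: n S f M B L => [|n IH] S f M B L cL pc sB vS sL lt cont.
  move/eqP: cL; rewrite cards_eq0 => /eqP L0.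
  by move: cont; rewrite L0 setU0 => cont; apply: cont (extends_refl _ _) _ _ _ => //; arith.
have [w wL] : exists w, w \in L by apply/set0Pn; rewrite -cards_eq0 cL.
have := subsetP sL _ wL; rewrite !inE => /and3P[wS wr /eqP pw].
have cL' : #|L :\ w| = n by move: cL; rewrite (cardsD1 w) wL => -[].
apply: (embed_step (Z := unused S f) (w := w) pc) => //; rewrite ?pw //.
  by rewrite (card_unused pc); arith.
move=> b x M' bX xU xb sM nB pc'.
have E : S :|: L = (w |: S) :|: (L :\ w) by rewrite -{1}(setD1K wL) setUCA setUA.
have fv : update f w x v = f v by rewrite updateE //; apply: contraNneq wS => <-.
have cB := card_setU1_leq b B.
apply: (IH (w |: S) (update f w x) M' (b |: B) (L :\ w)) => //.
- by rewrite subUset sub1set bX.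
- by rewrite in_setU1 vS orbT.
- apply/subsetP=> u; rewrite in_setD1 => /andP[uw uL].
  by have := subsetP sL _ uL; rewrite !inE (negbTE uw).
- have cU : #|w |: S| = #|S|.+1 by rewrite cardsU1 wS.
  by have := deg_add1 B (f v) bX; rewrite fv cL' cU; arith.
- rewrite -E => f' M'' B' pc'' ex sB' B'X leB; apply: cont pc'' _ _ B'X _.
  + by apply: extends_trans ex; apply: extends_update.
  + by apply: subset_trans sB'; apply: subsetUr.
  + by apply: leq_trans leB _; rewrite cL' cL addnS -addSn leq_add2r.
Qed.


Definition open_vertices K S : {set T} := [set v in S | [exists w in K :\: S, par w == v]].
(** The vertices at which a large degree in Breaker's graph is a threat: those
    that are to be used, and those whose tree vertex waits for a child in K. *)
Definition active K S f : {set V} := unused S f :|: f @: open_vertices K S.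

Lemma open_verticesP K S v :
  reflect (v \in S /\ exists w, [/\ w \in K, w \notin S & par w = v])
          (v \in open_vertices K S).
Proof.
rewrite inE; apply: (iffP andP) => [[vS /existsP[w]]|[vS [w [wK wS pw]]]].
  by rewrite inE => /andP[/andP[wS wK] /eqP pw]; split=> //; exists w.
by split=> //; apply/existsP; exists w; rewrite inE wK wS pw eqxx.
Qed.

Lemma open_vertices_sub K S : open_vertices K S \subset S.
Proof. by apply/subsetP=> v /open_verticesP[]. Qed.

Lemma active_drop K S f M v : partial_copy S f M -> v \in S ->
  v \notin open_vertices K S -> f v \notin active K S f.
Proof.
move=> [_ inj _] vS vo; rewrite !inE negb_or negbK imset_f //=.
apply: contra vo => /imsetP[u uo /inj E]; rewrite E //.
exact: (subsetP (open_vertices_sub K S)).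
Qed.

(** A vertex that becomes the image of a tree vertex was unused, hence active. *)
Lemma active_sub K S f M S' f' : partial_copy S f M -> extends S f S' f' ->
  {in S' &, injective f'} -> active K S' f' \subset active K S f.
Proof.
move=> pc ex inj'; have sU := unused_sub ex; have [sS E] := ex.
apply/subsetP=> x; rewrite [in X in X -> _]/active in_setU => /orP[/(subsetP sU) xU|].
  by rewrite /active in_setU xU.
case/imsetP=> v /open_verticesP[vS' [w [wK wS' pw]]] ->.
have [vS|vS] := boolP (v \in S).
  rewrite E // /active in_setU imset_f ?orbT //; apply/open_verticesP; split=> //.
  by exists w; split=> //; apply: contra wS'; apply: (subsetP sS).
rewrite /active in_setU /unused in_setC.
case: imsetP => // -[u uS fuv]; case/negP: vS.
have -> : v = u by apply: inj' => //; rewrite ?(subsetP sS) // fuv E.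
by [].
Qed.

(** Breaker may have separated the unused vertex z from the embedded part.
    Maker first joins z to some unused y and then extends the embedded part to a
    vertex a such that az and ay are both free. Breaker blocks at most one of them,
    and the path of three tree vertices is completed in either direction. *)
Lemma embed_deep S f M B w1 w2 w3 z D : partial_copy S f M -> B \subset pairs_of V ->
  w1 \notin S -> w2 \notin S -> w3 \notin S -> par w3 = w2 -> par w2 = w1 -> par w1 \in S ->
  z \in unused S f -> {in unused S f, forall x, deg B x <= D} ->
  deg B (f (par w1)) <= D -> 3 * D + 12 <= #|T| - #|S| ->
  let S' := w3 |: (w2 |: (w1 |: S)) in
  (forall f' M' B' v, partial_copy S' f' M' -> extends S f S' f' -> v \in S' -> f' v = z ->
     B \subset B' -> B' \subset pairs_of V -> #|B'| <= #|B| + 3 -> #|S'| = #|S| + 3 ->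
     Win (budget S') M' B') ->
  Win (budget S) M B.
Proof.
move=> pc sB w1S w2S w3S p3 p2 p1 zU dU dv big S' cont.
have [rS inj _] := pc.
have rn w : w \notin S -> w \notin rho by apply: contra; apply: (subsetP rS).
have n12 : w2 != w1 by apply/eqP=> E; have := depth_par (rn _ w2S); rewrite p2 E ltnn.
have n23 : w3 != w2 by apply/eqP=> E; have := depth_par (rn _ w3S); rewrite p3 E ltnn.
have n13 : w3 != w1.
  apply/eqP=> E; have := depth_par (rn _ w3S); have := depth_par (rn _ w2S).
  by rewrite p2 p3 -E => /ltn_trans h /h; rewrite ltnn.
have cU := card_unused pc.
have w2S1 : w2 \notin w1 |: S by rewrite in_setU1 negb_or n12.
have w3S2 : w3 \notin w2 |: (w1 |: S) by rewrite !in_setU1 !negb_or n23 n13.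
have cS' : #|S'| = #|S| + 3 by rewrite /S' !cardsU1 w1S w2S1 w3S2; arith.
have bS' : budget S = (budget S').+3 by rewrite /S' -!budget_add.
rewrite bS'.
apply: (win_join (Z := unused S f :\ z) (x := z)); first by rewrite !inE eqxx.
  have := cardsD1 z (unused S f); rewrite zU cU; have := dU z zU.
  by move: #|_ :\ z|; arith.
move=> b1 y b1X; rewrite in_setD1 => /andP[yz yU] yb1 zy.
set M1 := _ |: M; set B1 := b1 |: B.
have sB1 : B1 \subset pairs_of V by rewrite subUset sub1set b1X.
have d1 x : deg B1 x <= (deg B x).+1 by apply: deg_add1.
pose X := [set z; y] :|: (nbrs B1 z :|: nbrs B1 y).
have cX : #|X| <= 2 * D + 4.
  apply: leq_trans (leq_card_setU _ _) _; rewrite cards2 eq_sym yz.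
  have : #|nbrs B1 z :|: nbrs B1 y| <= #|nbrs B1 z| + #|nbrs B1 y| by apply: leq_card_setU.
  have := leq_trans (d1 z) (_ : _ <= D.+1); have := leq_trans (d1 y) (_ : _ <= D.+1).
  rewrite !ltnS /deg => /(_ (dU y yU)) h1 /(_ (dU z zU)) h2.
  by move: h1 h2; move: #|nbrs B1 y| #|nbrs B1 z| #|_ :|: _| => n1 n2 n3 /=; arith.
have lt2 : deg B1 (f (par w1)) + 2 < #|unused S f :\: X|.
  apply: leq_trans (_ : D + 4 <= _); first by have := d1 (f (par w1)); arith.
  by apply: card_lower; rewrite cU; arith.
apply: (win_join _ lt2).
  by rewrite in_setD in_setC imset_f // andbF.
move=> b2 a b2X; rewrite in_setD !in_setU !negb_or !in_set1.
case/andP=> /andP[/andP[az ay] /andP[aNz aNy]] aU ab2 va.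
set M2 := _ |: M1; set B2 := b2 |: B1.
have sB2 : B2 \subset pairs_of V by rewrite subUset sub1set b2X.
have za : [set z; a] \notin B2 by apply: deg_unused_pick aNz.
have ya : [set y; a] \notin B2 by apply: deg_unused_pick aNy.
apply: win_step => b3 b3X.
have pc1 : partial_copy (w1 |: S) (update f w1 a) M2.
  apply: (partial_copy_add _ w1S (rn _ w1S) p1 aU); last by rewrite setU11.
  by apply: partial_copy_mono pc; apply: subset_trans (subsetUr _ _) (subsetUr _ _).
have ex1 : extends S f (w1 |: S) (update f w1 a) by apply: extends_update.
have unusedU x : x \in unused S f -> x != a -> x \in unused (w1 |: S) (update f w1 a).
  by move=> xU; apply: unused_update.
(* t is the end of the edge zy that Breaker has left free *)
have [t [t' [tt' tU t'U ta tE]]] : exists t t', [/\ [set t; t'] = [set z; y],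
    t \in unused S f, t' \in unused S f, [set a; t] \notin b3 |: B2 & t != a /\ t' != a].
  rewrite eq_sym in az; rewrite eq_sym in ay.
  have [E|nE] := eqVneq b3 [set a; z].
    exists y, z; split=> //; first by rewrite setUC.
    rewrite in_setU1 negb_or [in X in _ && X]setUC ya andbT E.
    apply/eqP=> /setP/(_ y); rewrite !inE eqxx orbT (negbTE yz) orbF.
    by move/esym/eqP => h; rewrite h eqxx in ay.
  exists z, y; split=> //.
  by rewrite in_setU1 negb_or eq_sym nE setUC za.
case: tE => t_a t'_a.
exists [set a; t].
  by rewrite in_setD ta pairs_ofE eq_sym.
set M3 := _ |: M2; set B3 := b3 |: B2.
have pc1' : partial_copy (w1 |: S) (update f w1 a) M3.
  by apply: partial_copy_mono pc1; apply: subsetUr.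
set f1 := update f w1 a in pc1' ex1 unusedU *.
have pc2 : partial_copy (w2 |: (w1 |: S)) (update f1 w2 t) M3.
  apply: (partial_copy_add pc1' w2S1 (rn _ w2S)).
  - by rewrite p2 setU11.
  - exact: unusedU.
  - by rewrite p2 /f1 update_same setU11.
set f2 := update f1 w2 t in pc2 *.
have t't : t' != t.
  apply: contraTneq yz => E; rewrite negbK.
  have : #|[set z; y]| = 1 by rewrite -tt' E setUid cards1.
  by rewrite cards2 eq_sym; case: (y =P z).
have pc3 : partial_copy S' (update f2 w3 t') M3.
  apply: (partial_copy_add pc2 w3S2 (rn _ w3S)).
  - by rewrite p3 setU11.
  - by apply: unused_update => //; apply: unusedU.
  - rewrite p3 /f2 update_same tt' !in_setU1; apply/orP; right; apply/orP; right.
    by rewrite eqxx.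
have ex3 : extends S f S' (update f2 w3 t').
  apply: extends_trans ex1 _; apply: extends_trans (extends_update _ _ w2S1) _.
  exact: extends_update.
have sB3 : B3 \subset pairs_of V by rewrite subUset sub1set b3X.
have BB3 : B \subset B3.
  by do 2!apply: subset_trans (subsetUr _ _) (setUS _ _); apply: subsetUr.
have cB3 : #|B3| <= #|B| + 3.
  have h1 := card_setU1_leq b1 B; have h2 := card_setU1_leq b2 B1.
  apply: leq_trans (card_setU1_leq b3 B2) _; rewrite addn3 ltnS.
  by apply: leq_trans h2 _; rewrite ltnS.
have [zt|zt'] : z = t \/ z = t'.
  have : z \in [set t; t'] by rewrite tt' !inE eqxx.
  by rewrite !inE => /orP[]/eqP; [left|right].
- apply: (cont _ _ _ w2 pc3 ex3) => //; first by rewrite !inE eqxx orbT.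
  by rewrite updateE 1?eq_sym // /f2 update_same.
- apply: (cont _ _ _ w3 pc3 ex3) => //; first by rewrite !inE eqxx.
  by rewrite update_same.
Qed.


(** A vertex of K at distance three or more from S yields the path. If there is
    none, then each vertex of K outside S is a child or a grandchild of an open one. *)
Lemma deep_or_wide K S : {in K, forall w, w \notin rho -> par w \in K} -> rho \subset S ->
  (exists w1 w2 w3, [/\ [/\ w1 \in K, w2 \in K & w3 \in K],
     [/\ w1 \notin S, w2 \notin S & w3 \notin S] &
     [/\ par w3 = w2, par w2 = w1 & par w1 \in S]]) \/
  #|K :\: S| <= #|open_vertices K S| * (Delta + Delta * Delta).
Proof.
move=> Kpar rS.
have rn w : w \notin S -> w \notin rho by apply: contra; apply: (subsetP rS).
pose P w := [&& w \in K, w \notin S, par w \notin S & par (par w) \notin S].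
case: (pickP P) => [w0 Pw0|noP].
  left; case: (arg_minnP depth Pw0) => w /and4P[wK wS pS ppS] wmin.
  have pK : par w \in K by apply: Kpar => //; apply: rn.
  have ppK : par (par w) \in K by apply: Kpar => //; apply: rn.
  exists (par (par w)), (par w), w; split=> //; split=> //.
  apply: contraT => pppS; have := wmin (par w); rewrite /P pK pS ppS pppS /= => /(_ isT).
  by rewrite leqNgt depth_par ?rn.
right; pose A := open_vertices K S.
have oA w : w \in K -> w \notin S -> par w \in S -> par w \in A.
  by move=> wK wS pS; apply/open_verticesP; split=> //; exists w.
have sub : K :\: S \subset (\bigcup_(v in A) children v) :|:
    (\bigcup_(v in A) \bigcup_(u in children v) children u).
  apply/subsetP=> w; rewrite in_setD => /andP[wS wK].
  have wc u : u \notin S -> u \in children (par u) by move=> uS; rewrite inE rn /=.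
  have [pS|pS] := boolP (par w \in S).
    by rewrite in_setU; apply/orP; left; apply/bigcupP; exists (par w); [apply: oA|apply: wc].
  have pK : par w \in K by apply: Kpar => //; apply: rn.
  have ppS : par (par w) \in S by have := noP w; rewrite /P wK wS pS /= => /negbFE.
  rewrite in_setU; apply/orP; right; apply/bigcupP; exists (par (par w)); first exact: oA.
  by apply/bigcupP; exists (par w); apply: wc.
apply: leq_trans (subset_leq_card sub) _; apply: leq_trans (leq_card_setU _ _) _.
rewrite mulnDr; apply: leq_add; apply: card_bigcup_bound => // v.
apply: leq_trans (_ : #|children v| * Delta <= _); last by rewrite leq_mul2r few_children orbT.
exact: card_bigcup_bound.
Qed.

Lemma close_vertex K S f M0 B0 z S1 f1 M B v n : partial_copy S f M0 ->
  extends S f S1 f1 -> partial_copy S1 f1 M -> B0 \subset B -> B \subset pairs_of V ->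
  #|B| <= #|B0| + (#|S1| - #|S|) -> v \in S1 -> f1 v = z ->
  #|S1| <= #|S| + n -> deg B z + 2 * Delta + 2 <= #|T| - #|S1| ->
  (forall S' f' M' B', partial_copy S' f' M' -> extends S f S' f' -> S1 \subset S' ->
     B0 \subset B' -> B' \subset pairs_of V -> #|B'| <= #|B0| + (#|S'| - #|S|) ->
     #|S'| <= #|S| + (n + Delta) -> active K S' f' \subset active K S f :\ z ->
     {in S' :\: S1, forall w, [/\ w \in K, par w = v & f' (par w) = z]} ->
     (v \in open_vertices K S1 -> #|S1| < #|S'|) ->
     Win (budget S') M' B') ->
  Win (budget S1) M B.
Proof.
move=> pc ex pc1 sB0 sB cB vS1 fv cS1 big cont.
have [rS1 inj1 _] := pc1.
pose L := (children v :&: K) :\: S1.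
have sL : L \subset children v :\: S1.
  by apply/subsetP=> w; rewrite !inE => /and3P[-> /andP[-> ->]].
have cL : #|L| <= Delta.
  apply: leq_trans (few_children v); apply: subset_leq_card.
  by apply: subset_trans sL (subsetDl _ _).
apply: (embed_children (L := L) pc1 sB vS1 sL); first by rewrite fv; move: big cL; arith.
move=> f' M' B' pc' ex' sB' B'X cB'.
have LS1 : #|S1 :|: L| = #|S1| + #|L|.
  by rewrite cardsU (_ : S1 :&: L = set0) ?cards0 ?subn0 //; apply/setP=> w; rewrite !inE; case: (w \in S1).
have [sS1 E1] := ex'; have [sS E] := ex.
have cSS1 := subset_leq_card sS.
have exS := extends_trans ex ex'.
have [rS' inj' _] := pc'.
have fv' : f' v = z by rewrite E1.
have act : active K (S1 :|: L) f' \subset active K S f :\ z.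
  rewrite subsetD1 (active_sub K pc exS inj') -fv' (active_drop pc') //.
    by rewrite in_setU vS1.
  apply/open_verticesP=> -[_ [w [wK]]]; rewrite in_setU negb_or => /andP[wS1 wL] pw.
  case/negP: wL; rewrite !inE wS1 wK pw eqxx !andbT.
  by apply: contra wS1; apply: (subsetP rS1).
apply: (cont _ _ _ _ pc' exS) => //.
- exact: subset_trans sB0 sB'.
- apply: leq_trans cB' _; move: cB; rewrite LS1; move: #|B| #|B0|; move: cSS1; arith.
- by rewrite LS1; move: cS1 cL; arith.
- move=> w; rewrite in_setD in_setU => /andP[wS1]; rewrite (negbTE wS1) /= => wL.
  by move: wL; rewrite !inE => /and3P[_ /andP[_ /eqP pw] wK]; rewrite pw fv'.
- case/open_verticesP=> _ [w [wK wS1 pw]].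
  rewrite LS1 -addn1 leq_add2l card_gt0; apply/set0Pn; exists w.
  rewrite !inE wS1 wK pw eqxx !andbT.
  by apply: contra wS1; apply: (subsetP rS1).
Qed.

(** If z is the image of a tree vertex, its children are embedded. If z is
    unused, it is first made the image of a tree vertex: by the path of three vertices
    if there is one, otherwise directly, because then so many embedded vertices wait
    for a child that one of them can be joined to z. *)
Lemma process_vertex K K' S f M B z D : K \subset K' ->
  {in K, forall w, w \notin rho -> par w \in K} ->
  partial_copy S f M -> B \subset pairs_of V -> z \in active K' S f ->
  {in active K' S f, forall x, deg B x <= D} ->
  3 * D + 2 * Delta + 16 <= #|T| - #|S| ->
  (D + 3) * (Delta + Delta * Delta) < #|K :\: S| ->
  (forall S' f' M' B', partial_copy S' f' M' -> extends S f S' f' ->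
     B \subset B' -> B' \subset pairs_of V -> #|B'| <= #|B| + (#|S'| - #|S|) ->
     #|S| < #|S'| -> #|S'| <= #|S| + (3 + Delta) ->
     active K' S' f' \subset active K' S f :\ z ->
     {in S' :\: S, forall w, w \in K' /\ (w \notin K -> par w \in S' /\ f' (par w) = z)} ->
     Win (budget S') M' B') ->
  Win (budget S) M B.
Proof.
move=> sK Kpar pc sB zA leD big wide cont.
have [rS inj E] := pc.
have rn w : w \notin S -> w \notin rho by apply: contra; apply: (subsetP rS).
have finish S1 f1 M1 B1 v n : extends S f S1 f1 -> partial_copy S1 f1 M1 ->
    B \subset B1 -> B1 \subset pairs_of V -> #|B1| <= #|B| + n ->
    #|S1| = #|S| + n -> n <= 3 -> v \in S1 -> f1 v = z -> S1 :\: S \subset K ->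
    (v \in open_vertices K' S1) || (0 < n) -> Win (budget S1) M1 B1.
  move=> ex pc1 sB1 B1X cB1 cS1 n3 vS1 fv sS1K prog.
  have [sS1 _] := ex.
  apply: (close_vertex (K := K') (n := n) pc ex pc1 sB1 B1X _ vS1 fv).
  - by rewrite cS1 addKn.
  - by rewrite cS1.
  - have := deg_grow z sB1 B1X cB1; have := leD z zA; rewrite cS1; move: big n3; arith.
  move=> S' f' M' B' pc' ex' sS' sB' B'X cB' cS' act new op.
  have leS' := subset_leq_card sS'.
  apply: (cont _ _ _ _ pc' ex' sB' B'X cB') => //.
  - case/orP: prog => [/op|n0]; first by rewrite cS1; arith.
    by apply: leq_trans leS'; rewrite cS1; move: n0; arith.
  - by move: cS' n3; arith.
  - move=> w; rewrite in_setD => /andP[wS wS'].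
    have [wS1|wS1] := boolP (w \in S1).
      have wK : w \in K by apply: (subsetP sS1K); rewrite in_setD wS.
      by split; [exact: (subsetP sK)|rewrite wK].
    have [|wK pw fw] := new w; first by rewrite in_setD wS1.
    by split=> // _; split=> //; rewrite pw (subsetP sS').
have act_open v : v \in open_vertices K' S -> f v \in active K' S f.
  by move=> vo; rewrite /active in_setU imset_f ?orbT.
have act_unused x : x \in unused S f -> x \in active K' S f.
  by rewrite /active in_setU => ->.
have [zU|zU] := boolP (z \in unused S f); last first.
  have [v vo zE] : exists2 v, v \in open_vertices K' S & f v = z.
    move: zA; rewrite /active in_setU (negbTE zU) /= => /imsetP[v vo ->].
    by exists v.
  apply: (finish S f M B v 0 (extends_refl S f) pc) => //; rewrite ?addn0 ?vo //.
  - by move/open_verticesP: vo => [].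
  - by rewrite setDv sub0set.
have oKK' v : v \in open_vertices K S -> v \in open_vertices K' S.
  move=> /open_verticesP[vS [w [wK wS pw]]]; apply/open_verticesP; split=> //.
  by exists w; split=> //; apply: (subsetP sK).
have [[w1 [w2 [w3 [[K1 K2 K3] [S1 S2 S3] [p3 p2 p1]]]]]|wide2] := deep_or_wide Kpar rS.
  apply: (embed_deep pc sB S1 S2 S3 p3 p2 p1 zU (D := D)).
  - by move=> x xU; apply: leD; apply: act_unused.
  - by apply: leD; apply: act_open; apply: oKK'; apply/open_verticesP; split=> //; exists w1.
  - by move: big; arith.
  move=> f' M' B' v pc' ex' vS' fv sB' B'X cB' cS'.
  apply: (finish _ _ _ _ v 3 ex' pc' sB' B'X cB' cS') => //; last by rewrite orbT.
  apply/subsetP=> w; rewrite in_setD !in_setU1 => /andP[/negbTE->]; rewrite orbF.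
  by case/or3P=> /eqP->.
have lt : D + 3 < #|open_vertices K S|.
  rewrite -(ltn_pmul2r (m := Delta + Delta * Delta)); first exact: leq_trans wide2.
  rewrite lt0n; apply: contraTneq wide2 => ->; rewrite muln0 -ltnNge.
  by apply: leq_ltn_trans wide; rewrite leq0n.
have cZ : #|f @: open_vertices K S| = #|open_vertices K S|.
  apply: card_in_imset => u v /(subsetP (open_vertices_sub K S)) uS.
  by move/(subsetP (open_vertices_sub K S)) => vS; apply: inj.
have [w0 w0S] : exists w, w \notin S.
  apply/existsP; rewrite -negb_forall; apply/negP=> /forallP all.
  move: big; rewrite (_ : S = [set: T]) ?cardsT ?subnn; first by arith.
  by apply/setP=> w; rewrite all inE.
rewrite (budget_add w0S).
apply: (win_join (x := z) (Z := f @: open_vertices K S)).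
- apply/imsetP=> -[v /(subsetP (open_vertices_sub K S)) vS zE].
  by move: zU; rewrite zE in_setC imset_f.
- by rewrite cZ; have := leD z zA; move: lt; arith.
move=> b x bX /imsetP[v vo ->] vb nB.
have /open_verticesP[vS [w [wK wS pw]]] := vo.
have -> : budget (w0 |: S) = budget (w |: S).
  by apply/eqP; rewrite -eqSS -!budget_add.
have pc' : partial_copy (w |: S) (update f w z) ([set z; f v] |: M).
  apply: (partial_copy_add _ wS (rn _ wS)) => //; rewrite ?pw //.
    by apply: partial_copy_mono pc; apply: subsetUr.
  by rewrite setUC setU11.
apply: (finish _ _ _ _ w 1 (extends_update _ _ wS) pc').
- exact: subsetUr.
- by rewrite subUset sub1set bX.
- by rewrite addn1 card_setU1_leq.
- by rewrite cardsU1 wS addnC.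
- by [].
- by rewrite setU11.
- by rewrite update_same.
- by apply/subsetP=> u; rewrite in_setD in_setU1 => /andP[/negbTE->]; rewrite orbF => /eqP->.
- by rewrite orbT.
Qed.


Lemma frontier K S : {in K, forall w, w \notin rho -> par w \in K} -> rho \subset S ->
  0 < #|K :\: S| -> exists w, [/\ w \in K, w \notin S & par w \in S].
Proof.
move=> Kpar rS; rewrite card_gt0 => /set0Pn[w0].
pose P w := (w \notin S) && (w \in K); rewrite in_setD => w0P.
case: (arg_minnP (P := P) depth w0P) => w /andP[wS wK] wmin.
have wr : w \notin rho by apply: contra wS; apply: (subsetP rS).
exists w; split=> //; apply: contraT => pS.
have := wmin (par w); rewrite /P pS Kpar // => /(_ isT).
by rewrite leqNgt depth_par.
Qed.

(** Few moves are left, so that the degrees cannot grow beyond the number of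
    unused vertices. *)
Lemma embed_rest K S f M B d : {in K, forall w, w \notin rho -> par w \in K} ->
  partial_copy S f M -> B \subset pairs_of V -> {in active K S f, forall x, deg B x <= d} ->
  d + 2 * #|K :\: S| + 3 <= #|T| - #|S| ->
  (forall f' M' B', partial_copy (S :|: K) f' M' -> extends S f (S :|: K) f' ->
     B \subset B' -> B' \subset pairs_of V -> #|B'| <= #|B| + #|K :\: S| ->
     Win (budget (S :|: K)) M' B') ->
  Win (budget S) M B.
Proof.
move=> Kpar; move: {2}#|_ :\: _| (erefl #|K :\: S|) => m.
elim: m S f M B d => [|m IH] S f M B d cK pc sB leD big cont.
  have E : S :|: K = S.
    by apply/setUidPl; rewrite -setD_eq0 -cards_eq0 cK.
  have := cont f M B; rewrite E; apply=> //; exact: leq_addr.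
have [rS inj _] := pc.
have [w [wK wS pS]] : exists w, [/\ w \in K, w \notin S & par w \in S].
  by apply: frontier; rewrite ?cK.
have wr : w \notin rho by apply: contra wS; apply: (subsetP rS).
have dp : deg B (f (par w)) <= d.
  apply: leD; rewrite /active in_setU; apply/orP; right; apply: imset_f.
  by apply/open_verticesP; split=> //; exists w.
apply: (embed_step pc wS wr pS (subxx _)).
  by rewrite (card_unused pc); move: big dp; rewrite cK; arith.
move=> b x M' bX xU xb sM nB pc'.
have ex' : extends S f (w |: S) (update f w x) by apply: extends_update.
have cS' : #|w |: S| = #|S|.+1 by rewrite cardsU1 wS.
have [_ inj' _] := pc'.
have cK' : #|K :\: (w |: S)| = m.
  by apply/eqP; rewrite -eqSS -cK (cardsD1 w (K :\: S)) in_setD wS wK setDDl setUC.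
have ES : (w |: S) :|: K = S :|: K.
  by apply/setP=> u; rewrite !inE; case: eqP => // ->; rewrite wK !orbT.
apply: (IH _ _ _ _ d.+1 cK' pc') => //.
- by rewrite subUset sub1set bX.
- move=> y yA; apply: leq_trans (deg_add1 _ _ bX) _; rewrite ltnS; apply: leD.
  exact: (subsetP (active_sub K pc ex' inj')).
- by rewrite cK' cS'; move: big; rewrite cK; arith.
rewrite ES => f' M2 B2 pc2 ex2 sB2 B2X cB2; apply: cont pc2 _ _ B2X _.
- exact: extends_trans ex' ex2.
- by apply: subset_trans sB2; apply: subsetUr.
- by apply: leq_trans cB2 _; rewrite cK' cK addnS -addSn leq_add2r card_setU1_leq.
Qed.

Section Main.
Variables (q C : rat) (D Th : nat) (K K' : {set T}).
Hypothesis q1 : (1 <= q)%R.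
Hypothesis qs : ((2 * (3 + Delta))%:R * ((q - 1) * q ^+ (3 + Delta)) <= 1 :> rat)%R.
Hypothesis CD : (C < q ^+ D.+1)%R.
Hypothesis CTh : (#|V|%:R * q ^+ (Th + 1) <= C)%R.
Hypothesis sK : K \subset K'.
Hypothesis Kpar : {in K, forall w, w \notin rho -> par w \in K}.

(** The tree vertices in K are to be embedded; those in K' outside K are held
    back, and embedded only when their parent sits at a vertex of degree at least Th.
    This makes the number of held back vertices that are consumed small. *)
Definition growth_state S f M B :=
  [/\ partial_copy S f M, B \subset pairs_of V, #|B| <= #|S|, S \subset K' &
    {in S :\: K, forall w, par w \in S /\ Th <= deg B (f (par w))} /\
    (potential q (active K' S f) (deg B) <= C)%R].

Hypothesis room : forall S f M B, growth_state S f M B ->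
  3 * D + 2 * Delta + 16 <= #|T| - #|S|.

Lemma growth_state_deg S f M B : growth_state S f M B ->
  {in active K' S f, forall x, deg B x <= D}.
Proof.
by move=> [_ _ _ _ [_ pot]]; apply: (potential_bound q1); apply: le_lt_trans pot CD.
Qed.

(** As long as the largest degree is below Th any move keeps the potential
    below C; otherwise a vertex of largest degree is made inactive, which does not
    increase the potential. *)
Theorem main_growth stop S f M B : growth_state S f M B ->
  stop <= #|T| - #|S| + (3 + Delta) ->
  (forall S' f' M' B', growth_state S' f' M' B' -> extends S f S' f' ->
     B \subset B' -> #|B'| <= #|B| + (#|S'| - #|S|) ->
     #|K :\: S'| <= (D + 3) * (Delta + Delta * Delta) \/ #|T| - #|S'| <= stop ->
     stop <= #|T| - #|S'| + (3 + Delta) ->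
     Win (budget S') M' B') ->
  Win (budget S) M B.
Proof.
move: {2}(#|T| - #|S|) (leqnn (#|T| - #|S|)) => m.
elim: m S f M B => [|m IH] S f M B lem gs stopS cont.
  by have := room gs; move: lem; arith.
have [done|wide] := leqP #|K :\: S| ((D + 3) * (Delta + Delta * Delta)).
  by apply: cont gs (extends_refl _ _) (subxx _) _ _ _ => //; [arith|left].
have [done|notstop] := leqP (#|T| - #|S|) stop.
  by apply: cont gs (extends_refl _ _) (subxx _) _ _ _ => //; [arith|right].
have leD := growth_state_deg gs; have big := room gs.
have [pc sB cB SK' [hTh pot]] := gs.
have [rS inj E] := pc.
have step S' f' M' B' : growth_state S' f' M' B' -> extends S f S' f' ->
    B \subset B' -> #|B'| <= #|B| + (#|S'| - #|S|) -> #|S| < #|S'| ->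
    #|S'| <= #|S| + (3 + Delta) -> Win (budget S') M' B'.
  move=> gs' ex' sB' cB' ltS leS; apply: (IH S' f' M' B' _ gs') => //.
  - by have := max_card (mem S'); move: lem ltS big; arith.
  - by move: notstop leS; arith.
  move=> S2 f2 M2 B2 gs2 ex2 sB2 cB2 end2 stop2; apply: cont gs2 _ _ _ end2 stop2.
  - exact: extends_trans ex' ex2.
  - exact: subset_trans sB' sB2.
  - have := subset_leq_card ex2.1; move: ltS => h1 h2.
    by apply: leq_trans cB2 _; move: cB' h1 h2; move: #|B'| #|B|; arith.
have [z0 z0A] : exists z, z \in active K' S f.
  apply/set0Pn; rewrite -card_gt0; apply: leq_trans (subset_leq_card (subsetUl _ _)).
  by rewrite (card_unused pc); move: big; arith.
case: (arg_maxnP (deg B) z0A) => z zA zmax.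
have [zTh|zTh] := leqP Th (deg B z).
  apply: (process_vertex sK Kpar pc sB zA leD big wide).
  move=> S' f' M' B' pc' ex' sB' B'X cB' ltS leS act new.
  apply: (step _ _ _ _ _ ex') => //; split=> //.
  - by apply: leq_trans cB' _; move: cB ltS; move: #|B|; arith.
  - apply/subsetP=> w wS'; have [/(subsetP SK')//|wS] := boolP (w \in S).
    by have [] := new w; rewrite ?in_setD ?wS.
  split.
    move=> w; rewrite in_setD => /andP[wK wS'].
    have [wS|wS] := boolP (w \in S).
      have [|pS le] := hTh w; first by rewrite in_setD wK.
      split; first by apply: (subsetP ex'.1).
      by rewrite ex'.2 //; apply: leq_trans le _; apply: deg_mono.
    have [|_ h] := new w; first by rewrite in_setD wS.
    by have [pS ->] := h wK; split=> //; apply: leq_trans zTh _; apply: deg_mono.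
  apply: le_trans pot.
  apply: (potential_kill (i := deg (B' :\: B)) q1 qs zA act) => //.
  - by move=> x _; apply: deg_split.
  - move=> x; apply: leq_trans (deg_le_card _ _) _.
      by apply: subset_trans B'X; apply: subsetDl.
    rewrite cardsD (setIidPr sB'); move: cB' leS ltS; move: #|B'| #|B|; arith.
  - apply: leq_trans (sum_deg _) _; first by apply: subset_trans B'X; apply: subsetDl.
    rewrite leq_mul2l /= cardsD (setIidPr sB'); move: cB' leS ltS; move: #|B'| #|B|; arith.
have [w [wK wS pS]] := frontier Kpar rS (leq_ltn_trans (leq0n _) wide).
have wr : w \notin rho by apply: contra wS; apply: (subsetP rS).
apply: (embed_step pc wS wr pS (subxx _)).
  rewrite (card_unused pc); have := leD (f (par w)); move=> h.
  have : deg B (f (par w)) <= D.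
    apply: h; rewrite /active in_setU; apply/orP; right; apply: imset_f.
    by apply/open_verticesP; split=> //; exists w; split=> //; apply: (subsetP sK).
  by move: big; arith.
move=> b x M' bX xU xb sM nB pc'.
have ex' : extends S f (w |: S) (update f w x) by apply: extends_update.
have cS' : #|w |: S| = #|S|.+1 by rewrite cardsU1 wS.
have [_ inj' _] := pc'.
have sBb : B \subset b |: B by apply: subsetUr.
have cb : #|b |: B| <= #|B| + (#|w |: S| - #|S|).
  by apply: leq_trans (card_setU1_leq b B) _; rewrite cS' subSnn addn1.
apply: (step _ _ _ _ _ ex') => //; rewrite ?cS' //; last by arith.
split=> //.
- by rewrite subUset sub1set bX.
- by apply: leq_trans (card_setU1_leq b B) _; rewrite cS' ltnS.
- by rewrite subUset sub1set SK' (subsetP sK).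
split.
  move=> u; rewrite in_setD => /andP[uK]; rewrite in_setU1 => /predU1P[uw|uS].
    by rewrite uw wK in uK.
  have [|puS le] := hTh u; first by rewrite in_setD uK.
  split; first by rewrite in_setU1 puS orbT.
  by rewrite ex'.2 //; apply: leq_trans le _; apply: deg_mono.
apply: le_trans CTh; apply: (potential_low q1 (active_sub K' pc ex' inj')).
  by move=> u uA; apply: leq_trans (zmax u uA) (ltnW zTh).
by move=> u _; apply: leq_trans (deg_add1 _ _ bX) _; rewrite addn1.
Qed.

End Main.
End Growth.

(** * Trees with many leaves *)

Section Leaves.
Variables (V T : finType) (F : {set {set {set V}}}).
Notation Win := (winning (pairs_of V) F).
Variables (par : T -> T) (depth : T -> nat) (r : T) (Delta : nat).
Notation rho := [set r].
Notation partial_copy := (partial_copy par rho).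
Notation budget := (budget rho).
Hypothesis depth_par : forall x, x \notin rho -> depth (par x) < depth x.
Hypothesis few_children : forall v, #|children par rho v| <= Delta.
Hypothesis cardVT : #|V| = #|T|.
Hypothesis copy_wins : forall f M, partial_copy [set: T] f M -> wins F M.
Implicit Types (S K : {set T}) (f g : T -> V) (B M : {set {set V}}).
Implicit Types (b : {set V}) (x z : V) (v w : T).

(* Lr are the leaves that are embedded last, G further leaves for the final repair. *)
Variables Lr G : {set T}.
Hypothesis leafP : {in Lr :|: G, forall w, w != r /\ forall u, u != r -> par u != w}.
Hypothesis par_inj : {in Lr :|: G &, injective par}.
Hypothesis LrG : Lr :&: G = set0.

Lemma partial_copy_drop S f M (L : {set T}) : partial_copy S f M ->
  {in L, forall w, w != r /\ forall u, u != r -> par u != w} -> partial_copy (S :\: L) f M.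
Proof.
move=> [rS inj E] leafL; split.
- apply/subsetP=> w /[dup] wr /(subsetP rS) wS; rewrite in_setD wS andbT.
  by apply/negP=> /leafL[]; move: wr; rewrite inE => /eqP->; rewrite eqxx.
- by move=> u v; rewrite !in_setD => /andP[_ uS] /andP[_ vS]; apply: inj.
- move=> w; rewrite in_setD => /andP[wL wS] wr; have [pS eM] := E w wS wr.
  split=> //; rewrite in_setD pS andbT; apply/negP=> /leafL[_ /(_ w)].
  by move: wr; rewrite inE => wr /(_ wr); rewrite eqxx.
Qed.

Lemma unused_drop S f M (L : {set T}) w : partial_copy S f M -> w \in S -> w \in L ->
  f w \in unused (S :\: L) f.
Proof.
move=> [_ inj _] wS wL; rewrite in_setC; apply/imsetP=> -[u].
by rewrite in_setD => /andP[uL uS] /inj E; rewrite -E ?wL in uL.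
Qed.

(** The last vertex c belongs to the leaf l, whose parent sits at o, and Breaker
    may own oc. Maker gives c to the parent of another leaf y1, then takes the vertex
    of a third leaf y2 for l. Now y2 can be given either c or the vertex of y1: in the
    second case y1 moves to c. Breaker cannot prevent both. *)
Lemma last_leaf S f M B l c d h : S = ~: [set l] -> partial_copy S f M -> l \in Lr ->
  c \in unused S f -> B \subset pairs_of V -> deg B c <= d -> deg B (f (par l)) <= d ->
  2 * #|B| < h * (#|G| - d.+1) -> 2 * d + h + 8 <= #|G| -> Win 3 M B.
Proof.
move=> ES pc lLr cU sB dc do_ high big; have [rS inj E] := pc.
have lLam : l \in Lr :|: G by rewrite in_setU lLr.
have [lr lleaf] := leafP lLam.
have GS : G \subset S.
  rewrite ES subsetC sub1set in_setC; apply/negP=> lG.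
  have : l \in Lr :&: G by rewrite inE lLr.
  by rewrite LrG inE.
have Gleaf w : w \in G -> [/\ w \in S, w != r, w != l, par w \in S & forall u, u != r -> par u != w].
  move=> wG; have wS := subsetP GS w wG.
  have [|wr wleaf] := leafP (x := w); first by rewrite in_setU wG orbT.
  have [|pS _] := E w wS; first by rewrite inE.
  by split=> //; apply: contraTneq wS => ->; rewrite ES !inE eqxx.
have plS : par l \in S by rewrite ES !inE lleaf.
have injp : {in G &, injective (fun w => f (par w))}.
  move=> u v uG vG /= /inj pp; apply: par_inj; rewrite ?in_setU ?uG ?vG ?orbT //.
  by apply: pp; [have [] := Gleaf u uG|have [] := Gleaf v vG].
have injf : {in G &, injective f}.
  by move=> u v uG vG; apply: inj; apply: (subsetP GS).
set o := f (par l) in do_ *.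
have cfS w : w \in S -> f w != c.
  by move=> wS; apply: contraTneq cU => <-; rewrite in_setC negbK imset_f.
apply: win_step => b1 b1X; set B1 := b1 |: B.
have d1 x : deg B1 x <= (deg B x).+1 by apply: deg_add1.
pose bad1 := [set y in G | [set c; f (par y)] \in B1].
have cbad1 : #|bad1| <= d.+1.
  by apply: leq_trans (few_neighbours _ _ injp) _; apply: leq_trans (d1 c) _.
have [y1 y1G y1h] : exists2 y1, y1 \in G :\: bad1 & deg B (f y1) < h.
  apply/exists_inP; apply: contraLR high; rewrite negb_exists_in -leqNgt => /forall_inP all.
  apply: leq_trans (card_high_deg (Z := f @: (G :\: bad1)) (t := h) sB _).
    rewrite card_in_imset; last first.
      by move=> u v; rewrite !in_setD => /andP[_ uG] /andP[_ vG]; apply: injf.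
    by rewrite mulnC leq_mul2r; apply/orP; right; apply: card_lower; move: #|bad1| cbad1 #|G| big; arith.
  by move=> x /imsetP[y yG ->]; rewrite leqNgt; apply: all.
move: y1G; rewrite in_setD [_ \in bad1]inE => /andP[y1bad y1G].
rewrite y1G /= in y1bad.
have [y1S y1r y1l py1S y1leaf] := Gleaf y1 y1G.
exists [set c; f (par y1)].
  by rewrite in_setD y1bad pairs_ofE eq_sym cfS.
set M1 := _ |: M.
apply: win_step => b2 b2X; set B2 := b2 |: B1.
have d2 x : deg B2 x <= (deg B x).+2.
  by apply: leq_trans (deg_add1 _ _ b2X) _; rewrite ltnS.
pose bad2 := [set y in G | [set o; f y] \in B2] :|: ([set y in G | [set c; f (par y)] \in B2] :|:
   (y1 |: [set y in G | [set f y1; f (par y)] \in B2])).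
have cbad2 : #|bad2| < #|G|.
  have a1 : #|[set y in G | [set o; f y] \in B2]| <= d + 2.
    by apply: leq_trans (few_neighbours _ _ injf) (leq_trans (d2 o) _); rewrite addn2 !ltnS.
  have a2 : #|[set y in G | [set c; f (par y)] \in B2]| <= d + 2.
    by apply: leq_trans (few_neighbours _ _ injp) (leq_trans (d2 c) _); rewrite addn2 !ltnS.
  have a3 : #|[set y in G | [set f y1; f (par y)] \in B2]| <= h + 2.
    apply: leq_trans (few_neighbours _ _ injp) (leq_trans (d2 _) _).
    by rewrite addn2 !ltnS ltnW.
  apply: leq_ltn_trans (_ : (d + 2) + ((d + 2) + (h + 2).+1) < _); last by move: big; arith.
  apply: leq_trans (leq_card_setU _ _) _; apply: leq_add => //.
  apply: leq_trans (leq_card_setU _ _) _; apply: leq_add => //.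
  by apply: leq_trans (card_setU1_leq _ _) _; rewrite ltnS.
have [y2] : exists y2, y2 \in G :\: bad2.
  by apply/set0Pn; rewrite -card_gt0; apply: card_lower; rewrite addn1.
rewrite in_setD !in_setU in_set1 !negb_or => /andP[/and4P[h1 h2 y21 h3] y2G].
rewrite [_ \in _]inE y2G /= in h1; rewrite [_ \in _]inE y2G /= in h2; rewrite [_ \in _]inE y2G /= in h3.
have [y2S y2r y2l py2S y2leaf] := Gleaf y2 y2G.
exists [set o; f y2].
  rewrite in_setD h1 pairs_ofE.
  by apply: contraNneq (y2leaf l lr) => /inj->.
set M2 := _ |: M1.
apply: win_step => b3 b3X; set B3 := b3 |: B2.
have sMM (e : {set V}) : e \in M -> e \in M2 by move=> eM; rewrite !in_setU1 eM !orbT.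
have adds S' f' M' w x : partial_copy S' f' M' -> w \notin S' -> w != r -> par w \in S' ->
    x \in unused S' f' -> [set f' (par w); x] \in M' -> partial_copy (w |: S') (update f' w x) M'.
  by move=> pc' wS' wr'; apply: partial_copy_add => //; rewrite inE.
have [claimed|free] := boolP ([set c; f (par y2)] \in B3); last first.
  exists [set c; f (par y2)]; first by rewrite in_setD free pairs_ofE eq_sym cfS.
  apply: winning_wins; set M3 := _ |: M2.
  have pcS : partial_copy (S :\: [set y2]) f M3.
    apply: partial_copy_drop; last by move=> w; rewrite inE => /eqP->.
    by apply: partial_copy_mono pc; apply/subsetP=> e /sMM; rewrite /M3 in_setU1 => ->; rewrite orbT.
  have lS : l \notin S :\: [set y2] by rewrite ES !inE eqxx andbF.
  have plS' : par l \in S :\: [set y2] by rewrite in_setD plS inE y2leaf.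
  have pc1 := adds _ _ _ _ (f y2) pcS lS lr plS'.
  have y2S' : y2 \notin l |: (S :\: [set y2]) by rewrite !inE eqxx /= orbF.
  have py2 : par y2 \in l |: (S :\: [set y2]).
    by rewrite in_setU1 in_setD py2S inE y2leaf // orbT.
  have pc2 := adds _ _ _ _ c (pc1 _ _) y2S' y2r py2.
  apply: (@copy_wins (update (update f l (f y2)) y2 c)).
  have -> : [set: T] = y2 |: (l |: (S :\: [set y2])).
    by apply/setP=> w; rewrite ES !inE; case: eqP => //; case: eqP.
  apply: pc2.
  - by apply: (unused_drop pc) => //; rewrite inE.
  - by rewrite /M3 !in_setU1 eqxx orbT.
  - apply: unused_update => //; last by rewrite eq_sym cfS.
    by apply: (subsetP (unused_sub _)) cU; split=> //; apply: subsetDl.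
  - rewrite updateE; last by apply: lleaf.
    by rewrite /M3 !in_setU1 [in X in X || _]setUC eqxx.
have b3E : b3 = [set c; f (par y2)].
  by move: claimed; rewrite in_setU1 (negbTE h2) orbF => /eqP.
exists [set f y1; f (par y2)].
  rewrite in_setD in_setU1 (negbTE h3) orbF b3E pairs_ofE.
  apply/andP; split.
    apply/eqP=> /setP/(_ c); rewrite !inE eqxx /= ![c == _]eq_sym.
    by rewrite (negbTE (cfS _ y1S)) (negbTE (cfS _ py2S)).
  by apply: contraNneq (y1leaf y2 y2r) => /inj->.
apply: winning_wins; set M3 := _ |: M2.
have pcS : partial_copy (S :\: [set y1; y2]) f M3.
  apply: partial_copy_drop; last by move=> w; rewrite !inE => /orP[]/eqP->.
  by apply: partial_copy_mono pc; apply/subsetP=> e /sMM; rewrite /M3 in_setU1 => ->; rewrite orbT.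
set S0 := S :\: [set y1; y2] in pcS.
have parS0 w : par w \in S -> w != r -> par w \in S0.
  by move=> pS wr; rewrite !inE negb_or y1leaf // y2leaf.
have lS : l \notin S0 by rewrite /S0 ES !inE eqxx !andbF.
have pc1 := adds _ _ _ _ (f y2) pcS lS lr (parS0 _ plS lr).
have y2S' : y2 \notin l |: S0 by rewrite !inE eqxx orbT /= orbF.
have py2 : par y2 \in l |: S0 by rewrite in_setU1 parS0 ?orbT.
have pc2 := adds _ _ _ _ (f y1) (pc1 _ _) y2S' y2r py2.
have y1S' : y1 \notin y2 |: (l |: S0) by rewrite !inE eqxx /= orbF negb_or eq_sym y21.
have py1 : par y1 \in y2 |: (l |: S0) by rewrite !in_setU1 parS0 ?orbT.
have pc3 := adds _ _ _ _ c (pc2 _ _ _ _) y1S' y1r py1.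
have un w : w \in [set y1; y2] -> f w \in unused S0 f.
  by move=> wy; apply: (unused_drop pc) => //; move: wy; rewrite !inE => /orP[]/eqP->.
have cS0 : c \in unused S0 f.
  by apply: (subsetP (unused_sub _)) cU; split=> //; apply: subsetDl.
apply: (@copy_wins (update (update (update f l (f y2)) y2 (f y1)) y1 c)).
have -> : [set: T] = y1 |: (y2 |: (l |: S0)).
  by apply/setP=> w; rewrite /S0 ES !inE; do 3!case: eqP => //.
have f12 : f y1 != f y2.
  by apply: contraNneq y21 => /inj <-.
apply: pc3.
- by apply: un; rewrite !inE eqxx orbT.
- by rewrite /M3 !in_setU1 eqxx orbT.
- by apply: unused_update => //; apply: un; rewrite !inE eqxx.
- rewrite updateE; last by apply: lleaf.
  by rewrite /M3 !in_setU1 [in X in X || _]setUC eqxx.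
- apply: unused_update => //; last by rewrite eq_sym cfS.
  by apply: unused_update => //; rewrite eq_sym cfS.
- rewrite updateE; last by apply: y2leaf.
  rewrite updateE; last by apply: lleaf.
  by rewrite /M3 /M2 /M1 !in_setU1 ![[set f (par y1); c]]setUC eqxx !orbT.
Qed.


Section LeafPorts.
Variables (S0 : {set T}) (f0 : T -> V).

(* The ports are the unused vertices and the parents of the missing leaves. *)
Definition leaf_state := ({set T} * (T -> V))%type.
Implicit Type s : leaf_state.
Definition waiting s : {set V} := s.2 @: (par @: (~: s.1)).
Definition leaf_ports s : {set V} := unused s.1 s.2 :|: waiting s.
Definition leaf_allowed s : rel V :=
  fun x z => (x \in unused s.1 s.2) != (z \in unused s.1 s.2).
Definition leaf_ok s M :=
  [/\ partial_copy s.1 s.2 M, ~: s.1 \subset Lr & extends S0 f0 s.1 s.2].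

Lemma parent_embedded s M w : leaf_ok s M -> w \notin s.1 -> par w \in s.1.
Proof.
move=> [pc sL _] wS; have wL : w \in Lr by apply: (subsetP sL); rewrite in_setC.
have [|wr _] := leafP (x := w); first by rewrite in_setU wL.
apply: contraT => pS; have pL : par w \in Lr by apply: (subsetP sL); rewrite in_setC.
have [|_ /(_ w wr)] := leafP (x := par w); first by rewrite in_setU pL.
by rewrite eqxx.
Qed.

Lemma waiting_used s M x : leaf_ok s M -> x \in waiting s -> x \notin unused s.1 s.2.
Proof.
move=> oks /imsetP[v /imsetP[w]]; rewrite in_setC => wS -> ->.
by rewrite in_setC negbK imset_f // (parent_embedded oks).
Qed.

Lemma card_waiting s M : leaf_ok s M -> #|waiting s| = #|unused s.1 s.2|.
Proof.
move=> oks; have [[rS inj E] sL _] := oks.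
rewrite (card_unused cardVT (And3 rS inj E)) card_in_imset.
  rewrite card_in_imset; first by have := cardsC s.1; arith.
  by move=> u v /(subsetP sL) uL /(subsetP sL) vL; apply: par_inj; rewrite in_setU ?uL ?vL.
move=> u v /imsetP[u' u'S ->] /imsetP[v' v'S ->]; apply: inj.
  by apply: (parent_embedded oks); rewrite -in_setC.
by apply: (parent_embedded oks); rewrite -in_setC.
Qed.

Lemma waiting_disjoint s M : leaf_ok s M -> unused s.1 s.2 :&: waiting s = set0.
Proof.
move=> oks; apply/setP=> x; rewrite in_setI in_set0; apply/negP=> /andP[xU xw].
by have := waiting_used oks xw; rewrite xU.
Qed.

Lemma card_leaf_ports s M : leaf_ok s M -> #|leaf_ports s| = 2 * #|~: s.1|.
Proof.
move=> oks; rewrite cardsU (waiting_disjoint oks) cards0 (card_waiting oks).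
have [pc _ _] := oks; rewrite (card_unused cardVT pc).
by have := cardsC s.1; arith.
Qed.

Lemma leaf_partners s M x : leaf_ok s M -> x \in leaf_ports s ->
  partners leaf_ports leaf_allowed s x =
  if x \in unused s.1 s.2 then waiting s else unused s.1 s.2.
Proof.
move=> oks xs; apply/setP=> z; rewrite [LHS]inE /leaf_ports /leaf_allowed in_setU.
have := @waiting_used s M z oks.
case: (x \in _); case zU: (z \in unused _ _) => //= H; rewrite ?zU ?andbT ?andbF //.
by apply/esym/negP=> /H.
Qed.

Lemma leaf_allowed_sym s : symmetric (leaf_allowed s).
Proof. by move=> x z; rewrite /leaf_allowed eq_sym. Qed.

Lemma leaf_allowed_irr s : irreflexive (leaf_allowed s).
Proof. by move=> x; rewrite /leaf_allowed eqxx. Qed.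

Lemma leaf_many s M u : leaf_ok s M -> 3 < #|leaf_ports s| -> u \in leaf_ports s ->
  #|leaf_ports s| <= 2 * #|partners leaf_ports leaf_allowed s u|.
Proof.
move=> oks _ us; rewrite (leaf_partners oks us) cardsU (waiting_disjoint oks) cards0.
by case: ifP => _; rewrite (card_waiting oks); arith.
Qed.

(** The bipartite graph of conflicts has the same sum of degrees on both sides,
    and the sides have the same size. *)
Lemma leaf_average s M B D u : leaf_ok s M -> 3 < #|leaf_ports s| ->
  u \in leaf_ports s ->
  {in leaf_ports s, forall x, rdeg leaf_ports leaf_allowed s B x <= D} ->
  #|partners leaf_ports leaf_allowed s u| *
    (\sum_(x in leaf_ports s) rdeg leaf_ports leaf_allowed s B x) <=
  #|leaf_ports s| * (\sum_(w in partners leaf_ports leaf_allowed s u)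
       rdeg leaf_ports leaf_allowed s B w) +
  2 * D * #|partners leaf_ports leaf_allowed s u|.
Proof.
move=> oks _ us _; apply: leq_trans (leq_addr _ _).
set rd := rdeg _ _ s B.
have split (h : V -> nat) : \sum_(x in leaf_ports s) h x =
    \sum_(x in unused s.1 s.2) h x + \sum_(x in waiting s) h x.
  rewrite (big_setID (unused s.1 s.2)) /= setUK setDUl setDv set0U.
  by congr (_ + _); apply: eq_bigl => x; rewrite in_setD andb_idl //; apply: waiting_used oks.
have e1 : \sum_(x in unused s.1 s.2) rd x =
   \sum_(x in unused s.1 s.2) \sum_(y in waiting s) conflict leaf_allowed s B x y.
  apply: eq_bigr => x xU; rewrite /rd /rdeg split big1 // => y yU.
  by rewrite /conflict /leaf_allowed xU yU.
have e2 : \sum_(x in waiting s) rd x =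
   \sum_(x in waiting s) \sum_(y in unused s.1 s.2) conflict leaf_allowed s B x y.
  apply: eq_bigr => x xU; rewrite /rd /rdeg split [X in _ + X]big1 ?addn0 // => y yU.
  by rewrite /conflict /leaf_allowed (negbTE (waiting_used oks xU)) (negbTE (waiting_used oks yU)).
have e3 : \sum_(x in waiting s) rd x = \sum_(x in unused s.1 s.2) rd x.
  rewrite e1 e2 exchange_big; apply: eq_bigr => x _; apply: eq_bigr => y _.
  by rewrite (conflictC leaf_allowed_sym).
rewrite split e3 addnn -mul2n (leaf_partners oks us) cardsU (waiting_disjoint oks) cards0 subn0.
have e4 := card_waiting oks.
by case: ifP => _; rewrite ?e3 e4 addnn -mul2n mulnCA mulnA.
Qed.

Lemma leaf_join s M (u w : V) : leaf_ok s M -> 3 < #|leaf_ports s| ->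
  u \in leaf_ports s -> w \in leaf_ports s -> leaf_allowed s u w ->
  exists t, [/\ leaf_ok t ([set u; w] |: M), leaf_ports t = leaf_ports s :\ u :\ w &
    {in leaf_ports t &, forall x y, leaf_allowed t x y -> leaf_allowed s x y}].
Proof.
move=> oks _; wlog uU : u w / u \in unused s.1 s.2.
  move=> H us ws auw; have [uU|uU] := boolP (u \in unused s.1 s.2); first exact: H.
  have wU : w \in unused s.1 s.2 by move: auw; rewrite /leaf_allowed (negbTE uU); case: (_ \in _).
  have [|t [okt Et Ht]] := H w u wU ws us _; first by rewrite leaf_allowed_sym.
  exists t; split=> //; first by rewrite [[set u; w]]setUC.
  by rewrite Et; apply/setP=> x; rewrite !inE andbCA.
move=> us ws; rewrite {1}/leaf_allowed uU => nw.
have wU : w \notin unused s.1 s.2 by move: nw; case: (w \in _).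
have ww : w \in waiting s by move: ws; rewrite in_setU (negbTE wU).
have [pc sL ex] := oks; have [rS inj E] := pc.
case/imsetP: (ww) => v /imsetP[l]; rewrite in_setC => lS -> wE.
have plS := parent_embedded oks lS.
have lL : l \in Lr by apply: (subsetP sL); rewrite in_setC.
have [|lr lleaf] := leafP (x := l); first by rewrite in_setU lL.
have fu (v' : T) : v' \in s.1 -> s.2 v' != u.
  by move=> xS; apply: contraTneq uU => <-; rewrite in_setC negbK imset_f.
pose t : leaf_state := (l |: s.1, update s.2 l u).
have exst : extends s.1 s.2 t.1 t.2 by apply: extends_update.
have okt : leaf_ok t ([set u; w] |: M).
  split.
  - apply: partial_copy_add => //; rewrite ?inE //.
      by apply: partial_copy_mono pc; apply: subsetUr.
    by rewrite -wE setUC eqxx.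
  - by apply: subset_trans sL; rewrite setCS subsetUr.
  - exact: extends_trans ex exst.
have Eu : unused t.1 t.2 = unused s.1 s.2 :\ u.
  apply/eqP; rewrite eqEsubset; apply/andP; split.
    rewrite subsetD1 (unused_sub exst) /= in_setC negbK.
    by apply/imsetP; exists l; rewrite ?setU11 // update_same.
  apply/subsetP=> x; rewrite in_setD1 => /andP[xu xU].
  by apply: unused_update.
have Ew : waiting t = waiting s :\ w.
  apply/setP=> x; rewrite in_setD1; apply/imsetP/andP.
    case=> p /imsetP[l']; rewrite in_setC in_setU1 negb_or => /andP[l'l l'S] -> ->.
    have pl'S := parent_embedded oks l'S.
    have l'L : l' \in Lr by apply: (subsetP sL); rewrite in_setC.
    rewrite /= updateE; last first.
      apply: contraNneq lS => <- //.
    split; last by apply: imset_f; apply: imset_f; rewrite in_setC.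
    rewrite wE; apply: contraNneq l'l => /inj pp; apply/eqP; apply: par_inj.
    - by rewrite in_setU l'L.
    - by rewrite in_setU lL.
    - exact: pp.
  move=> [xw /imsetP[p /imsetP[l' l'S pE] xE]].
  exists p => //; last by rewrite /= updateE -?xE //; apply: contraNneq lS => <-; rewrite pE; apply: (parent_embedded oks); rewrite -in_setC.
  rewrite pE; apply: imset_f; rewrite in_setC in_setU1 negb_or -in_setC l'S andbT.
  by apply: contraNneq xw => l'l; rewrite xE pE l'l wE.
exists t; split=> //.
  rewrite /leaf_ports Eu Ew; apply/setP=> x; rewrite !in_setU !in_setD1 !in_setU.
  have := @waiting_used s M x oks.
  have [->|xw] := eqVneq x w; first by rewrite (negbTE wU) andbF.
  have [->|xu] := eqVneq x u; last by rewrite /=.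
  by rewrite uU /= => h; apply/negP=> /h.
move=> x y xt yt; rewrite /leaf_allowed Eu !in_setD1.
have neu z : z \in leaf_ports t -> z != u.
  rewrite /leaf_ports Eu Ew in_setU !in_setD1 => /orP[/andP[]//|/andP[_ zw]].
  by apply: contraTneq zw => ->; apply: contraL uU => /(waiting_used oks).
by rewrite !neu.
Qed.

End LeafPorts.

Section ManyLeaves.
Variables (q C q' C' : rat) (D Th D' m3 h : nat).
Hypothesis q1 : (1 <= q)%R.
Hypothesis qs : ((2 * (3 + Delta))%:R * ((q - 1) * q ^+ (3 + Delta)) <= 1 :> rat)%R.
Hypothesis CD : (C < q ^+ D.+1)%R.
Hypothesis CTh : (#|V|%:R * q ^+ (Th + 1) <= C)%R.
Hypothesis q1' : (1 <= q')%R.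
Hypothesis qs' : ((2 * 1)%:R * ((q' - 1) * q' ^+ 1) <= 1 :> rat)%R.
Hypothesis CD' : (C' < q' ^+ D'.+1)%R.
Let t := (D + 3) * (Delta + Delta * Delta).
Hypothesis C't : ((2 * #|Lr|)%:R * q' ^+ (D + t) <= C')%R.
Hypothesis few_consumed : 4 * #|T| <= Th * #|Lr|.
Hypothesis Th0 : 0 < Th.
Hypothesis room1 : 2 * (3 * D + 2 * Delta + 16) <= #|Lr|.
Hypothesis room2 : 2 * (D + 2 * t + 3) <= #|Lr|.
Hypothesis m3_1 : slack D' + 4 <= m3.
Hypothesis m3_2 : D' + 3 <= m3.
Hypothesis m3_3 : 5 * slack D' <= m3.
Hypothesis m3_4 : 20 * (D + t) * m3 <= #|Lr|.
Hypothesis m3_5 : 8 * m3 <= #|Lr|.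
Hypothesis G1 : 2 * #|T| < h * (#|G| - (D + t + #|Lr|).+1).
Hypothesis G2 : 2 * (D + t + #|Lr|) + h + 8 <= #|G|.

Let K := ~: Lr.

(** A leaf of Lr is consumed only if its parent sits at a vertex of degree at
    least Th, and the parents are distinct; so at most 2n/Th leaves are consumed. *)
Lemma leaves_left S f M B :
  growth_state par rho q C Th K [set: T] S f M B -> #|Lr| <= 2 * #|Lr :\: S|.
Proof.
move=> [pc sB cB _ [hTh _]]; have [_ inj _] := pc.
pose A := (f \o par) @: (S :&: Lr).
have cA : #|A| = #|S :&: Lr|.
  apply: card_in_imset => u v; rewrite !in_setI => /andP[uS uL] /andP[vS vL] /= E.
  have [|pu _] := hTh u; first by rewrite /K !inE uL uS.
  have [|pv _] := hTh v; first by rewrite /K !inE vL vS.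
  by apply: par_inj; rewrite ?in_setU ?uL ?vL //; apply: inj.
have le : #|S :&: Lr| * Th <= 2 * #|B|.
  rewrite -cA; apply: card_high_deg => // x /imsetP[u]; rewrite in_setI => /andP[uS uL] ->.
  by have [|_ ] := hTh u; first by rewrite /K !inE uL uS.
have cS : #|S| <= #|T| := max_card (mem S).
have cBT := leq_trans cB cS.
have le2 : Th * (2 * #|S :&: Lr|) <= Th * #|Lr|.
  apply: leq_trans few_consumed; rewrite mulnCA (mulnC Th).
  apply: leq_trans (_ : 2 * (2 * #|B|) <= _); first by rewrite leq_mul2l le.
  by rewrite mulnA leq_mul2l cBT.
rewrite leq_mul2l eqn0Ngt Th0 /= in le2.
by rewrite cardsD setIC; move: le2; arith.
Qed.

(** All vertices outside Lr are embedded with control of the degrees. Then the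
    unused vertices have to be matched with the vertices that wait for a leaf, which
    is a game with ports. *)
Theorem many_leaves_win : Win #|T|.+1 set0 set0.
Proof.
have [v0] : exists v : V, true.
  have := max_card (mem [set r]); rewrite cards1 -cardVT => /card_gt0P[v _].
  by exists v.
move=> _; pose f0 := fun _ : T => v0.
have pc0 : partial_copy [set r] f0 set0.
  split=> //; first by move=> u v; rewrite !inE => /eqP-> /eqP->.
  by move=> w ->.
have sB0 : (set0 : {set {set V}}) \subset pairs_of V by apply: sub0set.
have Kpar : {in K, forall w, w \notin rho -> par w \in K}.
  move=> w _ wr; rewrite in_setC; apply/negP=> pL.
  have [|_ /(_ w)] := leafP (x := par w); first by rewrite in_setU pL.
  by move: wr; rewrite inE => -> /(_ isT); rewrite eqxx.
have rK : rho \subset K.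
  rewrite sub1set in_setC; apply/negP=> rL.
  by have [|] := leafP (x := r); rewrite ?in_setU ?rL ?eqxx.
have gs0 : growth_state par rho q C Th K [set: T] [set r] f0 set0 set0.
  split=> //; first by rewrite cards0.
  split; first by move=> w; rewrite in_setD => /andP[wK wr]; rewrite (subsetP rK) in wK.
  apply: le_trans CTh.
  apply: (@potential_low _ _ q1 setT _ (fun _ => 0) _ Th 1 (subsetT _)) => // x _.
  apply: leq_trans (deg_le_card _ sB0) _; by rewrite cards0.
have -> : #|T|.+1 = budget [set r].
  by rewrite /budget !cards1; have := max_card (mem [set r]); rewrite cards1; arith.
have sLC S : Lr :\: S \subset ~: S by apply/subsetP=> w; rewrite !inE => /andP[].
have room S f M B : growth_state par rho q C Th K [set: T] S f M B ->
    3 * D + 2 * Delta + 16 <= #|T| - #|S|.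
  move=> gs; have := leaves_left gs; have := cardsC S; move: room1.
  by have := subset_leq_card (sLC S); arith.
apply: (main_growth depth_par few_children cardVT q1 qs CD CTh (subsetT K) Kpar room
  (stop := 0) gs0 (leq0n _)).
move=> S1 f1 M1 B1 gs1 _ _ _ end1 _.
have left1 := leaves_left gs1.
have left1' := subset_leq_card (sLC S1); have leD := growth_state_deg q1 CD gs1.
have [pc1 sB1 cB1 _ _] := gs1.
have cC1 := cardsC S1.
have rest1 : #|K :\: S1| <= t.
  by case: end1 => // end1; move: left1 left1' room1; move: end1 cC1; arith.
have sAK : active par K S1 f1 \subset active par [set: T] S1 f1.
  apply: setUS; apply: imsetS; apply/subsetP=> v /open_verticesP[vS [w [_ wS pw]]].
  by apply/open_verticesP; split=> //; exists w; rewrite inE.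
apply: (embed_rest depth_par cardVT (d := D) Kpar pc1 sB1).
- by move=> x xA; apply: leD; apply: (subsetP sAK).
- by move: rest1 left1 left1' room2 cC1; arith.
move=> f2 M2 B2 pc2 ex2 sB12 sB2 cB2.
set S2 := S1 :|: K in pc2 ex2 *.
have [_ inj2 _] := pc2.
have sL2 : ~: S2 \subset Lr by rewrite setCU setCK subsetIr.
have E2 : ~: S2 = ~: S1 :&: Lr by rewrite setCU setCK.
have big2 : #|Lr| <= 2 * #|~: S2|.
  by move: left1; rewrite E2 setDE setIC.
have cC2 := cardsC S2.
have card_S2 : #|S2| = #|S1| + #|K :\: S1|.
  have -> : S2 = S1 :|: (K :\: S1) by apply/setP=> w; rewrite !inE; case: (w \in S1).
  rewrite -cardsUI [X in _ + X](_ : _ = 0) ?addn0 //.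
  by apply/eqP; rewrite cards_eq0; apply/eqP/setP=> w; rewrite !inE; case: (w \in S1).
have small2 : #|~: S2| <= #|Lr| by apply: subset_leq_card.
have leD2 : {in active par [set: T] S1 f1, forall x, deg B2 x <= D + t}.
  move=> x xA; apply: leq_trans (deg_grow x sB12 sB2 cB2) _.
  by apply: leq_add => //; apply: leD.
have ok2 : leaf_ok S2 f2 (S2, f2) M2 by split=> //; apply: extends_refl.
have portsA : leaf_ports (S2, f2) \subset active par [set: T] S1 f1.
  apply: subset_trans (active_sub [set: T] pc1 ex2 inj2).
  apply: setUS; apply/subsetP=> x /imsetP[v /imsetP[w]]; rewrite in_setC => wS -> ->.
  apply: imset_f; apply/open_verticesP; split; first exact: (parent_embedded ok2).
  by exists w; split=> //; rewrite inE.
have -> : budget S2 = #|~: S2| + 2.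
  by rewrite /budget cards1; move: cC2; arith.
have last s M B : leaf_ok S2 f2 s M -> #|leaf_ports s| = 2 -> B2 \subset B ->
    B \subset pairs_of V -> #|B| <= #|B2| + #|~: S2| -> Win 3 M B.
  move=> oks sz sB2' sB' cB'; have [pc sL ex] := oks.
  have c1 : #|~: s.1| == 1 by move: sz; rewrite (card_leaf_ports oks); arith.
  case/cards1P: c1 => l El.
  have Es : s.1 = ~: [set l] by rewrite -El setCK.
  have lS : l \notin s.1 by rewrite Es !inE eqxx.
  have lL : l \in Lr by apply: (subsetP sL); rewrite in_setC.
  have cu : #|unused s.1 s.2| = 1.
    rewrite (card_unused cardVT pc); have := cardsC s.1.
    by rewrite El cards1; arith.
  have [c cU] : exists c, c \in unused s.1 s.2.
    by apply/set0Pn; rewrite -card_gt0 cu.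
  have degd x : x \in leaf_ports (S2, f2) -> deg B x <= D + t + #|Lr|.
    move=> xp; apply: leq_trans (deg_grow x sB2' sB' cB') _.
    apply: leq_add small2; apply: leD2; exact: (subsetP portsA).
  have cS2' := max_card (mem S2).
  have cBT : #|B| <= #|T|.
    apply: leq_trans cB' _; move: cB1 cB2 card_S2 cC2; arith.
  apply: (last_leaf Es pc lL cU sB' (d := D + t + #|Lr|) (h := h)) => //.
  - apply: degd; rewrite in_setU; apply/orP; left.
    exact: (subsetP (unused_sub ex)).
  - have [sS E] := ex.
    have lS2 : l \notin S2 by apply: contra lS; apply: (subsetP sS).
    have plS2 := parent_embedded ok2 lS2.
    rewrite E //; apply: degd; rewrite in_setU; apply/orP; right.
    by apply: imset_f; apply: imset_f; rewrite in_setC.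
  - by apply: leq_ltn_trans G1; rewrite leq_mul2l.
apply: (port_game (pts := leaf_ports) leaf_allowed_sym leaf_allowed_irr _ _ _ last q1' qs' CD'
   m3_1 m3_2 m3_3 (D0 := D + t) _ _ ok2) => //.
- by move=> s M u; apply: leaf_many.
- by move=> s M B D0 u; apply: leaf_average.
- by move=> s M u w; apply: leaf_join.
- by move: m3_4 big2; arith.
- by move: m3_5 big2; arith.
- by rewrite (card_leaf_ports ok2).
- move=> x xp; apply: leq_trans (rdeg_le_deg _ _ _ _ _) _.
  by apply: leD2; apply: (subsetP portsA).
- apply: le_trans C't; rewrite ler_wpM2r ?exprn_ge0 //; first by apply: le_trans q1'.
  by rewrite ler_nat leq_mul2l.
Qed.

End ManyLeaves.
End Leaves.

(** * Covering paths *)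

Lemma split_consecutive (T : Type) (x0 a : T) l i : i < size l ->
  a :: l = rcons (take i (a :: l)) (nth x0 (a :: l) i) ++ nth x0 l i :: drop i.+1 l.
Proof.
by move=> lt; rewrite -drop_nth // -take_nth ?ltnS 1?ltnW // -{1}(cat_take_drop i.+1 (a :: l)).
Qed.

Section Segments.
Variable V : finType.
Implicit Types (s t : seq V) (ss tt : seq (seq V)) (M B : {set {set V}}) (x y z u w : V).

Definition link M : rel V := fun x y => [set x; y] \in M.
(** The two ends are the first elements of s and of its reversal; in this form
    reversing a segment changes nothing. *)
Definition isend s x := (ohead s == Some x) || (ohead (rev s) == Some x).

Lemma linkC M : symmetric (link M).
Proof. by move=> x y; rewrite /link setUC. Qed.

Lemma sorted_rev M s : sorted (link M) (rev s) = sorted (link M) s.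
Proof.
rewrite rev_sorted; case: s => //= x s.
by apply: eq_path => y z; rewrite linkC.
Qed.

Lemma sorted_link_sub M M' s : M \subset M' -> sorted (link M) s -> sorted (link M') s.
Proof. by move=> sM; apply: sub_sorted => x y; apply: (subsetP sM). Qed.

Lemma isend_rev s : isend (rev s) =1 isend s.
Proof. by move=> x; rewrite /isend revK orbC. Qed.

Lemma isend_cons x s y : isend (x :: s) y = (y == x) || (y == last x s).
Proof.
rewrite /isend; have -> : ohead (rev (x :: s)) = Some (last x s) by rewrite lastI rev_rcons.
by rewrite /= ![y == _]eq_sym.
Qed.

Lemma isend_mem s x : isend s x -> x \in s.
Proof.
case: s => // y s; rewrite isend_cons => /orP[]/eqP->; first exact: mem_head.
exact: mem_last.
Qed.

Lemma orient s u : isend s u -> exists s1, u :: s1 = s \/ u :: s1 = rev s.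
Proof.
rewrite /isend; case/orP.
  by case: s => // x s /eqP[->]; exists s; left.
by case: (rev s) => // x s1 /eqP[->]; exists s1; right.
Qed.

Lemma orientE M s s' : s' = s \/ s' = rev s ->
  [/\ perm_eq s' s, sorted (link M) s' = sorted (link M) s & isend s' =1 isend s].
Proof.
case=> ->; first by split.
by split; [rewrite perm_rev| rewrite sorted_rev| apply: isend_rev].
Qed.

Lemma isend_join u s1 w t1 x :
  isend (rev s1 ++ [:: u, w & t1]) x = (x == last u s1) || (x == last w t1).
Proof.
rewrite -[[:: u, w & t1]]cat1s catA -[[:: u]]/(rev [:: u]) -rev_cat /=.
rewrite /isend rev_cat revK lastI rev_rcons /=.
have -> : rev (w :: t1) = rcons (rev t1) w by rewrite rev_cons.
rewrite cat_rcons; have -> : ohead (rev t1 ++ w :: rcons (belast u s1) (last u s1)) = Some (last w t1).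
  by rewrite -cat_rcons -rev_cons lastI rev_rcons.
by rewrite ![x == _]eq_sym.
Qed.

Variables (W Y : seq V) (e0 : {set V}).
Hypothesis uniqY : uniq Y.

Definition carries s := infix W s || infix W (rev s).

(** A partition of Y into paths of Maker's graph. One of the paths contains W
    as a piece, whose middle edge e0 need not belong to Maker: it closes the final
    path to a cycle, and counting it as an edge makes the ends of W ends of one path. *)
Definition segments ss M :=
  [/\ perm_eq (flatten ss) Y, all (fun s => 0 < size s) ss,
      all (sorted (link (e0 |: M))) ss & has carries ss].

Definition endset ss : {set V} := [set x | has (fun s => isend s x) ss].
Definition same_segment ss x y := has (fun s => (x \in s) && (y \in s)) ss.
Definition joinable ss : rel V := fun x y => (x != y) && ~~ same_segment ss x y.

Lemma carries_rev s : carries (rev s) = carries s.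
Proof. by rewrite /carries revK orbC. Qed.

Lemma carries_join u s1 w t1 : carries (u :: s1) || carries (w :: t1) ->
  carries (rev s1 ++ [:: u, w & t1]).
Proof.
have E : rev s1 ++ [:: u, w & t1] = rev (u :: s1) ++ (w :: t1).
  by rewrite rev_cons cat_rcons.
rewrite E -[carries (u :: s1)]carries_rev {E}.
by case/orP => /orP[] H; rewrite /carries rev_cat; apply/orP;
  [left; apply: infix_catr|right; apply: infix_catl|left; apply: infix_catl|right; apply: infix_catr].
Qed.

Lemma link_join M u s1 w t1 : sorted (link M) (u :: s1) -> sorted (link M) (w :: t1) ->
  sorted (link ([set u; w] |: M)) (rev s1 ++ [:: u, w & t1]).
Proof.
move=> H1 H2; have sub : subrel (link M) (link ([set u; w] |: M)).
  by move=> x y; rewrite /link in_setU1 => ->; rewrite orbT.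
rewrite sorted_cat_cons -rev_cons sorted_rev (sub_sorted sub H1) /=.
by rewrite /link setU11 (sub_path sub).
Qed.

Lemma joinable_sym ss : symmetric (joinable ss).
Proof.
move=> x y; rewrite /joinable eq_sym; congr (_ && ~~ _).
by apply: eq_has => s; rewrite andbC.
Qed.

Lemma joinable_irr ss : irreflexive (joinable ss).
Proof. by move=> x; rewrite /joinable eqxx. Qed.

Lemma endset_perm ss tt : perm_eq ss tt -> endset ss = endset tt.
Proof. by move=> p; apply/setP=> x; rewrite !inE (perm_has _ p). Qed.

Lemma split_segments ss u w : u \in endset ss -> w \in endset ss -> joinable ss u w ->
  exists s t rest, [/\ perm_eq ss [:: s, t & rest], isend s u & isend t w].
Proof.
rewrite !inE => /hasP[s sS us] /hasP[t tS wt] /andP[_ nsame].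
have nst : t != s.
  apply: contraNneq nsame => E; apply/hasP; exists s => //.
  by rewrite (isend_mem us) -E (isend_mem wt).
have p1 := perm_to_rem sS.
have tr : t \in rem s ss.
  by move: tS; rewrite (perm_mem p1) inE (negbTE nst).
exists s, t, (rem t (rem s ss)); split=> //.
by apply: perm_trans p1 _; rewrite perm_cons; apply: perm_to_rem.
Qed.

(** A vertex that forms a segment by itself remains an end when it is joined,
    any other end that is joined becomes an inner vertex. *)
Lemma join_segments ss M u w : segments ss M -> u \in endset ss -> w \in endset ss ->
  joinable ss u w ->
  exists tt, [/\ segments tt ([set u; w] |: M), size ss = (size tt).+1,
    forall x, (x \in endset tt) = (x \in endset ss) &&
      ((x \notin [set u; w]) || ([:: x] \in ss)),
    forall x, ([:: x] \in tt) = ([:: x] \in ss) && (x \notin [set u; w]) &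
    forall x y, joinable tt x y -> joinable ss x y].
Proof.
move=> [pY ne lk cr] us ws nsame.
have uw : u != w by case/andP: nsame.
have [s [t [rest [p su tw]]]] := split_segments us ws nsame.
have [s1 Es] := orient su; have [t1 Et] := orient tw.
have [ps ls es] := orientE (e0 |: M) Es; have [pt lt et] := orientE (e0 |: M) Et.
have un : uniq ((u :: s1) ++ (w :: t1) ++ flatten rest).
  have : uniq (flatten [:: s, t & rest]).
    by rewrite -(perm_uniq (perm_flatten p)) (perm_uniq pY).
  rewrite /= -(perm_uniq (_ : perm_eq ((u :: s1) ++ (w :: t1) ++ flatten rest) _)) //.
  by rewrite perm_cat // perm_cat.
exists ((rev s1 ++ [:: u, w & t1]) :: rest).
have [ne' lk'] : all (fun s => 0 < size s) [:: s, t & rest] /\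
    all (sorted (link (e0 |: M))) [:: s, t & rest].
  by rewrite -!(perm_all _ p).
have sub : subrel (link (e0 |: M)) (link (e0 |: ([set u; w] |: M))).
  by move=> x y; rewrite /link !in_setU1 => /orP[->//|->]; rewrite !orbT.
have notin_rest z : z \in flatten rest -> z \notin u :: s1 /\ z \notin w :: t1.
  move=> zr; have := un; rewrite cat_uniq => /and3P[_ /hasPn h1].
  rewrite cat_uniq => /and3P[_ /hasPn h2 _]; split; last exact: h2.
  by apply: h1; rewrite mem_cat zr orbT.
have notin_t z : z \in w :: t1 -> z \notin u :: s1.
  move=> zt; have := un; rewrite cat_uniq => /and3P[_ /hasPn h1 _].
  by apply: h1; rewrite mem_cat zt.
have [us1 wt1] : u \notin s1 /\ w \notin t1.
  by have := un; rewrite !cat_uniq => /and3P[/andP[-> _] _ /and3P[/andP[-> _] _ _]].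
have single z s' l : z :: l = s' \/ z :: l = rev s' -> forall x, ([:: x] == s') = (x == z) && nilp l.
  move=> H x; case: H => [<-|H].
    by rewrite eqseq_cons; case: l.
  rewrite -(inj_eq (can_inj (@revK V))) -H /= eqseq_cons; case: l {H} => //.
have rest_sub s' z : s' \in rest -> z \in s' -> z \in flatten rest.
  by move=> s'r zs; apply/flattenP; exists s'.
have last_nil z l : z \notin l -> (z == last z l) = nilp l.
  case: l => [|y l] zl; first by rewrite /= eqxx.
  by apply: contraNF zl => /eqP E; rewrite E /= mem_last.
have rest_end z : z \in u :: s1 \/ z \in w :: t1 ->
    has (fun s => isend s z) rest = false /\ ([:: z] \in rest) = false.
  move=> H; have nz : z \notin flatten rest.
    by apply/negP=> /notin_rest[h1 h2]; case: H; [rewrite (negbTE h1)|rewrite (negbTE h2)].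
  split; apply: contraNF nz; last by move/rest_sub; apply; rewrite inE.
  by case/hasP=> s' s'r /isend_mem; apply: rest_sub.
have uT : u \notin w :: t1 by apply/negP=> /notin_t; rewrite mem_head.
have wS : w \notin u :: s1 by apply: notin_t; rewrite mem_head.
split.
- split=> /=.
  + apply: perm_trans _ pY; rewrite perm_sym; apply: perm_trans (perm_flatten p) _ => /=.
    rewrite perm_sym catA perm_cat //.
    rewrite -[[:: u, w & t1]]cat1s catA; apply: perm_cat => //.
    by apply: perm_trans ps; rewrite cats1 perm_rcons perm_cons perm_rev.
  + by move: ne' => /= /and3P[_ _ ->]; rewrite size_cat addnS.
  + move: lk' => /= /and3P[l1 l2 /(sub_all _) ->]; last exact: (sub_sorted sub).
    by rewrite setUCA link_join ?ls ?lt.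
  + move: cr; rewrite (perm_has _ p) /= => /or3P[c|c|->]; rewrite ?orbT // carries_join //.
      by case: Es => ->; rewrite ?carries_rev c.
    by case: Et => ->; rewrite ?carries_rev c orbT.
- by rewrite (perm_size p).
- move=> x; rewrite (endset_perm p) in_set2 !in_set /= (perm_mem p) !in_cons.
  rewrite -es -et !isend_cons isend_join (single _ _ _ Es) (single _ _ _ Et).
  have [->|xu] := eqVneq x u.
    have [|-> ->] := rest_end u; first by left; rewrite mem_head.
    rewrite (negbTE uw) last_nil // (_ : u == last w t1 = false) ?orbF //.
    by apply: contraNF uT => /eqP ->; apply: mem_last.
  have [->|xw] := eqVneq x w; last by rewrite andbT !orbA.
  have [|-> ->] := rest_end w; first by right; rewrite mem_head.
  rewrite last_nil // (_ : w == last u s1 = false) ?orbF //=.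
  by apply: contraNF wS => /eqP ->; apply: mem_last.
- move=> x; rewrite (perm_mem p) !in_cons in_set2 (single _ _ _ Es) (single _ _ _ Et).
  rewrite (_ : ([:: x] == _) = false) /=; last first.
    by apply/negP=> /eqP/(congr1 size); rewrite size_cat !addnS.
  have [->|xu] := eqVneq x u.
    by have [|_ ->] := rest_end u; [left; rewrite mem_head|rewrite andbF].
  have [->|xw] := eqVneq x w; last by rewrite andbT.
  by have [|_ ->] := rest_end w; [right; rewrite mem_head|rewrite andbF].
- move=> x y /andP[xy ns]; rewrite /joinable xy; apply: contra ns.
  rewrite /same_segment (perm_has _ p) /= !mem_cat !mem_rev.
  rewrite -!(perm_mem ps) -!(perm_mem pt) !inE.
  case/or3P=> [/andP[/orP[->|->] /orP[->|->]]|/andP[/orP[->|->] /orP[->|->]]|->];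
   by rewrite ?orbT.
Qed.

Definition singles ss : {set V} := [set x | [:: x] \in ss].

Lemma singles_endset ss : singles ss \subset endset ss.
Proof.
apply/subsetP=> x; rewrite !inE => xs; apply/hasP; exists [:: x] => //.
by rewrite isend_cons eqxx.
Qed.

Lemma card_isend s : 0 < size s -> uniq s ->
  #|[set x | isend s x]| + (size s == 1) = 2.
Proof.
case: s => // x [|y s] _ un.
  by rewrite (_ : [set _ | _] = [set x]) ?cards1 //; apply/setP=> z; rewrite !inE isend_cons orbb.
rewrite (_ : [set _ | _] = [set x; last y s]).
  by rewrite cards2; move: un; rewrite cons_uniq; case: eqP => // ->; rewrite mem_last.
by apply/setP=> z; rewrite !inE isend_cons.
Qed.

(** A segment has two ends, except for a single vertex, which counts once as an
    end and once as a segment by itself. *)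
Lemma card_endset ss : all (fun s => 0 < size s) ss -> uniq (flatten ss) ->
  #|endset ss| + #|singles ss| = 2 * size ss.
Proof.
elim: ss => [_ _|s ss IH].
  have -> : endset [::] = set0 by apply/setP=> x; rewrite !inE.
  have -> : singles [::] = set0 by apply/setP=> x; rewrite !inE.
  by rewrite cards0.
rewrite /= cat_uniq => /andP[s0 ne] /and3P[us /hasPn dis un].
have E1 : endset (s :: ss) = [set x | isend s x] :|: endset ss.
  by apply/setP=> x; rewrite !inE.
have flat x s' : s' \in ss -> x \in s' -> x \in flatten ss.
  by move=> *; apply/flattenP; exists s'.
have c1 : #|endset (s :: ss)| = #|[set x | isend s x]| + #|endset ss|.
  rewrite E1 cardsU (_ : _ :&: _ = set0) ?cards0 ?subn0 //.
  apply/setP=> x; rewrite !inE; apply/negP=> /andP[/isend_mem xs /hasP[s' s's /isend_mem xs']].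
  by have := dis x (flat _ _ s's xs'); rewrite /= xs.
have c2 : #|singles (s :: ss)| = (size s == 1) + #|singles ss|.
  case: s s0 us dis {E1 c1} => // x [|y s] _ _ dis.
    rewrite (_ : singles _ = x |: singles ss); last first.
      by apply/setP=> y; rewrite !inE eqseq_cons andbT.
    rewrite cardsU1 inE; case: (boolP ([:: x] \in ss)) => // xs.
    by have := dis x (flat _ _ xs (mem_head _ _)); rewrite /= mem_head.
  rewrite (_ : singles _ = singles ss) //.
  by apply/setP=> z; rewrite !inE eqseq_cons andbF.
by have := card_isend s0 us; have := IH ne un; rewrite c1 c2; arith.
Qed.

Lemma segments_uniq ss M : segments ss M -> uniq (flatten ss).
Proof. by case=> p _ _ _; rewrite (perm_uniq p). Qed.

Lemma segments_card ss M : segments ss M -> #|endset ss| + #|singles ss| = 2 * size ss.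
Proof. by move=> /[dup] /segments_uniq un [_ ne _ _]; apply: card_endset. Qed.

Lemma segment_unique ss s t x : uniq (flatten ss) -> s \in ss -> t \in ss ->
  x \in s -> x \in t -> s = t.
Proof.
elim: ss => // r ss IH; rewrite /= cat_uniq => /and3P[_ /hasPn dis un].
have H s' : s' \in ss -> x \in s' -> x \notin r.
  by move=> s's xs'; apply: dis; apply/flattenP; exists s'.
rewrite !inE => /predU1P[->|sS] /predU1P[->|tS] // xs xt; last exact: IH.
  by rewrite (negbTE (H _ tS xt)) in xs.
by rewrite (negbTE (H _ sS xs)) in xt.
Qed.

(** Only the ends of the segment of u are excluded. *)
Lemma card_joinable ss M u : segments ss M -> u \in endset ss ->
  #|endset ss| <= #|[set w in endset ss | joinable ss u w]| + 2.
Proof.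
move=> sg; rewrite inE => /hasP[s sS us].
have un := segments_uniq sg; have [_ ne _ _] := sg.
have su : uniq s.
  case/splitPr: sS un => p1 p2; rewrite flatten_cat /= cat_uniq => /and3P[_ _].
  by rewrite cat_uniq => /andP[].
have le2 : #|[set x | isend s x]| <= 2.
  by have := card_isend (allP ne s sS) su; arith.
apply: leq_trans (_ : #|[set w in endset ss | joinable ss u w] :|: [set x | isend s x]| <= _).
  apply/subset_leq_card/subsetP=> w wE; rewrite in_setU inE wE /= inE /joinable.
  have [<-|uw] := eqVneq u w; first by rewrite us.
  rewrite /= -implybE; apply/implyP=> /hasP[t tS /andP[ut wt]].
  have ts := segment_unique un tS sS ut (isend_mem us); subst t.
  move: wE; rewrite inE => /hasP[t tS' wt'].
  by rewrite (segment_unique un sS tS' wt (isend_mem wt')).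
by apply: leq_trans (leq_card_setU _ _) _; rewrite leq_add2l.
Qed.

Lemma joinable_singles ss M u w : segments ss M -> u \in singles ss -> w \in singles ss ->
  u != w -> joinable ss u w.
Proof.
move=> sg; rewrite !inE => us ws uw; rewrite /joinable uw.
apply/hasPn=> s sS; apply/negP=> /andP[u_s w_s].
have := segment_unique (segments_uniq sg) us sS (mem_head _ _) u_s.
by move=> E; move: w_s; rewrite -E inE eq_sym (negbTE uw).
Qed.

End Segments.

Section Game.
Variables (V : finType) (F : {set {set {set V}}}).
Notation Win := (winning (pairs_of V) F).
Variables (W Y : seq V) (e0 : {set V}) (M0 B0 : {set {set V}}) (m0 : nat).
Hypothesis uniqY : uniq Y.
Implicit Types (ss tt : seq (seq V)) (M B : {set {set V}}) (x y z u w : V) (Z : {set V}).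
Notation segments := (segments W Y e0).

(** Each move of Maker lowers the number of segments by one. *)
Definition cover_state ss M B := [/\ segments ss M, M0 \subset M, B0 \subset B,
  B \subset pairs_of V & #|B| + size ss <= #|B0| + m0].

Lemma join_move ss M B u Z : cover_state ss M B -> u \in endset ss ->
  {in Z, forall w, w \in endset ss /\ joinable ss u w} -> deg B u + 2 < #|Z| ->
  (forall b w tt M', b \in pairs_of V -> w \in Z -> cover_state tt M' (b |: B) ->
    size ss = (size tt).+1 ->
    (forall x, (x \in endset tt) = (x \in endset ss) &&
      ((x \notin [set u; w]) || (x \in singles ss))) ->
    (forall x, (x \in singles tt) = (x \in singles ss) && (x \notin [set u; w])) ->
    Win (size tt + 2) M' (b |: B)) ->
  Win (size ss + 2) M B.
Proof.
move=> [sg sM sB BX cB] us HZ lt cont.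
have N0 : 0 < size ss.
  by move: us; rewrite inE; case: (ss).
rewrite -(prednK N0) addSn; apply: (win_join (Z := Z) (x := u)) => //.
  by apply/negP=> /HZ[_]; rewrite joinable_irr.
move=> b w bX wZ wb nB; have [ws auw] := HZ w wZ.
have [tt [sgt sz Et St _]] := join_segments uniqY sg us ws auw.
rewrite sz /=; apply: (cont b w tt) => //.
- split=> //.
  + by apply: subset_trans sM _; apply: subsetUr.
  + by apply: subset_trans sB _; apply: subsetUr.
  + by rewrite subUset sub1set bX.
  + by have := card_setU1_leq b B; move: cB; rewrite sz; move: #|b |: B| #|B|; arith.
- by move=> x; rewrite Et [_ \in singles ss]inE.
- by move=> x; rewrite ![_ \in singles _]inE St.
Qed.

(** A vertex stops being an end once it has been joined, twice if it was a
    segment by itself. *)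
Lemma kill_end ss M B z D : cover_state ss M B -> z \in endset ss ->
  deg B z <= D -> D + 7 < #|endset ss| ->
  (forall tt M' B', cover_state tt M' B' -> B \subset B' -> #|B'| <= #|B| + 2 ->
     endset tt \subset endset ss :\ z -> #|endset ss| <= #|endset tt| + 3 ->
     size tt < size ss -> Win (size tt + 2) M' B') ->
  Win (size ss + 2) M B.
Proof.
have step tt M' B' d : cover_state tt M' B' -> z \in endset tt -> deg B' z <= d ->
    d + 4 < #|endset tt| ->
    (forall b w rr M2, b \in pairs_of V -> cover_state rr M2 (b |: B') -> size tt = (size rr).+1 ->
      endset rr \subset endset tt -> #|endset tt| <= #|endset rr| + 1 + (z \notin singles tt) ->
      (z \in endset rr) = (z \in singles tt) -> z \notin singles rr ->
      w \in endset tt -> Win (size rr + 2) M2 (b |: B')) ->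
    Win (size tt + 2) M' B'.
  move=> bs zs dz big cont; have [sg _ _ _ _] := bs.
  apply: (join_move (Z := [set w in endset tt | joinable tt z w]) bs zs).
  - by move=> w; rewrite inE => /andP[].
  - by have := card_joinable uniqY sg zs; move: dz big; arith.
  move=> b w rr M2 bX; rewrite inE => /andP[ws zw] bs' sz Et St.
  apply: (cont b w) => //.
  - by apply/subsetP=> x; rewrite Et => /andP[].
  - apply: leq_trans (_ : #|endset rr :|: (w |: (if z \in singles tt then set0 else [set z]))| <= _).
      apply/subset_leq_card/subsetP=> x xs; rewrite in_setU Et xs in_set2 negb_or /=.
      rewrite in_setU1; case: (x =P w) => [->|_]; first by rewrite !orbT.
      case: (x =P z) => [->|_] //=.
      by case: (z \in singles tt) => //=; rewrite inE eqxx.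
    apply: leq_trans (leq_card_setU _ _) _; rewrite -addnA leq_add2l.
    apply: leq_trans (card_setU1_leq _ _) _.
    by case: (z \in singles tt); rewrite ?cards0 ?cards1.
  - by rewrite Et zs in_set2 eqxx.
  - by rewrite St in_set2 eqxx andbF.
move=> bs zs dz big cont.
apply: (step _ _ _ D bs zs dz); first by move: big; arith.
move=> b1 w1 rr M1 b1X bs1 sz1 sE1 cE1 zE1 zS1 _.
have c1 := card_setU1_leq b1 B.
have [zS|zS] := boolP (z \in singles ss); last first.
  apply: (cont _ _ _ bs1) => //.
  - exact: subsetUr.
  - by apply: leq_trans c1 _; rewrite addn2 ltnW.
  - by rewrite subsetD1 sE1 zE1.
  - by apply: leq_trans cE1 _; rewrite zS -addnA leq_add2l.
  - by rewrite sz1.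
rewrite zS addn0 in cE1.
apply: (step _ _ _ D.+1 bs1); first by rewrite zE1.
- by apply: leq_trans (deg_add1 _ _ b1X) _.
- by move: big cE1; arith.
move=> b2 w2 rr2 M2 b2X bs2 sz2 sE2 cE2 zE2 _ _.
rewrite zS1 in cE2.
apply: (cont _ _ _ bs2).
- by apply: subset_trans (subsetUr _ _) (subsetUr _ _).
- by apply: leq_trans (card_setU1_leq _ _) _; rewrite addn2 ltnS.
- by rewrite subsetD1 (subset_trans sE2 sE1) zE2 (negbTE zS1).
- by move: cE1 cE2; arith.
- by rewrite sz1 sz2.
Qed.

Section Pairing.
Variables (q C : rat) (D d0 X r0 : nat) (E0 : {set V}).
Hypothesis q1 : (1 <= q)%R.
Hypothesis qs : ((2 * 2)%:R * ((q - 1) * q ^+ 2) <= 1 :> rat)%R.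
Hypothesis CD : (C < q ^+ D.+1)%R.
Hypothesis CX : (#|V|%:R * q ^+ (d0 + X + 1) <= C)%R.
Hypothesis deg0 : {in E0, forall x, deg B0 x <= d0}.

(** Z collects the ends that were removed because of their large degree. As
    each of them received X edges from Breaker during this phase, there are few of them. *)
Definition pairing_state ss M B Z :=
  [/\ cover_state ss M B, endset ss \subset E0, (potential q (endset ss) (deg B) <= C)%R,
     [disjoint Z & endset ss] /\ {in Z, forall x, X <= deg (B :\: B0) x} &
     r0 <= #|endset ss| + 3 * #|Z|].

Lemma pairing_deg ss M B Z : pairing_state ss M B Z -> {in endset ss, forall x, deg B x <= D}.
Proof.
by move=> [_ _ pot _ _]; apply: (potential_bound q1); apply: le_lt_trans pot CD.
Qed.

(** Joining two single vertices does not change the set of ends. Only the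
    removal of an end of large degree does so, by at most three vertices, and this is
    balanced by the new element of Z. *)
Theorem pair_singles ss M B Z : pairing_state ss M B Z ->
  (forall tt M' B' Z', pairing_state tt M' B' Z' -> #|singles tt| <= D + 7 ->
     Win (size tt + 2) M' B') ->
  Win (size ss + 2) M B.
Proof.
move: {2}(size ss) (leqnn (size ss)) => k.
elim: k ss M B Z => [|k IH] ss M B Z lek st cont.
  apply: (cont _ _ _ _ st); have [[sg _ _ _ _] _ _ _ _] := st.
  by have := segments_card uniqY sg; move: lek; arith.
have [few|many] := leqP #|singles ss| (D + 7); first exact: cont st few.
have leD := pairing_deg st; have [bs sE pot [dZ hZ] cZ] := st.
have [sg sM sB BX cB] := bs.
have leE := subset_leq_card (singles_endset ss).
have [z0 z0E] : exists z, z \in endset ss.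
  by apply/set0Pn; rewrite -card_gt0; move: many leE; arith.
case: (arg_maxnP (deg B) z0E) => z zE zmax.
have zE' : z \in endset ss by [].
have [zX|zX] := leqP (d0 + X) (deg B z).
  apply: (kill_end bs zE (leD z zE)); first by move: many leE; arith.
  move=> tt M' B' bs' sBB cB' sE' cE' sz'.
  have [sg' sM' sB' B'X _] := bs'.
  have zZ : z \notin Z by apply/negP=> zZ; move/pred0P: dZ => /(_ z); rewrite /= zZ zE'.
  apply: (IH tt M' B' (z |: Z)) => //; first by move: lek sz'; arith.
  split=> //.
  - by apply: subset_trans sE' _; apply: subset_trans (subsetDl _ _) sE.
  - apply: le_trans pot.
    have sD : B' :\: B \subset pairs_of V by apply: subset_trans B'X; apply: subsetDl.
    have cD : #|B' :\: B| <= 2.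
      by rewrite cardsD (setIidPr sBB) leq_subLR.
    apply: (potential_kill (i := deg (B' :\: B)) q1 qs zE sE') => //.
    + by move=> x _; apply: deg_split.
    + by move=> x; apply: leq_trans (deg_le_card _ sD) cD.
    + by apply: leq_trans (sum_deg sD) _; rewrite leq_mul2l.
  - split.
      rewrite -setI_eq0 setIUl; apply/eqP/setP=> x; rewrite !in_setU !in_setI in_set1 in_set0.
      apply/negP=> /orP[/andP[/eqP-> ]|/andP[xZ]].
        by move/(subsetP sE'); rewrite !inE eqxx.
      move/(subsetP sE'); rewrite in_setD1 => /andP[_ xE].
      by move/pred0P: dZ => /(_ x); rewrite /= xZ xE.
    move=> x; rewrite in_setU1 => /predU1P[->|xZ].
      have := deg_split z sB'; have := deg0 (subsetP sE z zE').
      have := deg_mono z sBB; move: zX; arith.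
    by apply: leq_trans (hZ x xZ) _; apply/deg_mono/setSD.
  - by rewrite cardsU1 zZ; move: cZ cE'; arith.
have [u uS] : exists u, u \in singles ss.
  by apply/set0Pn; rewrite -card_gt0; move: many; arith.
have uE := subsetP (singles_endset ss) u uS.
apply: (join_move (Z := singles ss :\ u) bs uE).
- move=> w; rewrite in_setD1 => /andP[wu wS]; split.
    exact: (subsetP (singles_endset ss)).
  by apply: (joinable_singles uniqY sg) => //; rewrite eq_sym.
- by have := cardsD1 u (singles ss); have := leD u uE; rewrite uS; move: many; arith.
move=> b w tt M' bX; rewrite in_setD1 => /andP[wu wS] bs' sz Et St.
have EE : endset tt = endset ss.
  apply/setP=> x; rewrite Et in_set2.
  have [->|xu] := eqVneq x u; first by rewrite uS uE orbT.
  by have [->|xw] := eqVneq x w; rewrite ?wS ?andbT ?orbT ?andbT.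
apply: (IH tt M' _ Z) => //; first by move: lek; rewrite sz; arith.
split=> //; rewrite ?EE //.
- apply: le_trans CX; apply: (potential_low q1 (subxx (endset ss)) (D := d0 + X)).
    by move=> x xE; apply: leq_trans (zmax x xE) (ltnW zX).
  by move=> x _; rewrite addn1; apply: deg_add1.
- split=> // x xZ; apply: leq_trans (hZ x xZ) _; apply/deg_mono/setSD.
  exact: subsetUr.
Qed.

End Pairing.

Lemma attach_singles ss M B d : cover_state ss M B -> {in endset ss, forall x, deg B x <= d} ->
  d + 2 * #|singles ss| + 5 <= #|endset ss| ->
  (forall tt M' B', cover_state tt M' B' -> B \subset B' -> #|B'| <= #|B| + #|singles ss| ->
     endset tt \subset endset ss -> #|endset ss| <= #|endset tt| + #|singles ss| ->
     singles tt = set0 -> Win (size tt + 2) M' B') ->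
  Win (size ss + 2) M B.
Proof.
move: {2}#|singles ss| (leqnn #|singles ss|) => k.
elim: k ss M B d => [|k IH] ss M B d lek bs leD big cont.
  apply: (cont _ _ _ bs); rewrite ?leq_addr //.
  by apply/eqP; rewrite -cards_eq0 -leqn0.
have [S0|[u uS]] := set_0Vmem (singles ss).
  by apply: (cont _ _ _ bs); rewrite ?leq_addr.
have uE := subsetP (singles_endset ss) u uS; have [sg _ _ _ _] := bs.
have S1 : 0 < #|singles ss| by apply/card_gt0P; exists u.
apply: (join_move (Z := [set w in endset ss | joinable ss u w]) bs uE).
- by move=> w; rewrite inE => /andP[].
- by have := card_joinable uniqY sg uE; have := leD u uE; move: big S1; arith.
move=> b w tt M' bX; rewrite inE => /andP[wE uw] bs' sz Et St.
have sS : singles tt \subset singles ss :\ u.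
  by apply/subsetP=> x; rewrite St in_set2 in_setD1 negb_or andbC => /andP[/andP[-> _] ->].
have cS : #|singles tt| < #|singles ss|.
  by rewrite [X in _ < X](cardsD1 u) uS ltnS subset_leq_card.
have sE : endset tt \subset endset ss by apply/subsetP=> x; rewrite Et => /andP[].
have cE : #|endset ss| <= #|endset tt| + 1.
  apply: leq_trans (_ : #|w |: endset tt| <= _); last by rewrite addn1 card_setU1_leq.
  apply/subset_leq_card/subsetP=> x xE; rewrite in_setU1 Et xE in_set2 negb_or.
  have [//|xw] := eqVneq x w; have [->|] := eqVneq x u; by rewrite ?uS.
have cb := card_setU1_leq b B.
apply: (IH tt M' _ d.+1 _ bs').
- by move: lek cS; arith.
- move=> x xE; apply: leq_trans (deg_add1 _ _ bX) _; rewrite ltnS; apply: leD.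
  exact: (subsetP sE).
- by move: big cS cE; arith.
move=> rr M2 B2 bs2 sB2 cB2 sE2 cE2 S2; apply: (cont _ _ _ bs2) => //.
- by apply: subset_trans sB2; apply: subsetUr.
- by apply: leq_trans cB2 _; move: cb cS; move: #|b |: B| #|B|; arith.
- exact: subset_trans sE2 sE.
- by move: cE2 cE cS; arith.
Qed.

Section Closing.
Variables (pl0 pr0 : V) (PL PR : seq V) (Bs : {set {set V}}).
Hypothesis headPL : head pl0 PL = pl0.
Hypothesis lastPR : last pr0 PR = pr0.
Hypothesis PL0 : 0 < size PL.
Hypothesis PR0 : 0 < size PR.
Hypothesis ham_wins : forall Q M, M0 \subset M -> perm_eq Q Y -> sorted (link M) Q ->
  head pl0 Q = pl0 -> last pl0 Q = pr0 -> wins F M.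

Lemma sorted_cat_join (e : rel V) (x y : V) (s t : seq V) : sorted e s -> sorted e t ->
  0 < size s -> 0 < size t -> e (last x s) (head y t) -> sorted e (s ++ t).
Proof.
by case: s t => [//|a s] [//|c t] /= H1 H2 _ _ H3; rewrite cat_path H1 /= H3 H2.
Qed.

(** The edge between the outer ends of s2 and s1 replaces the edge between pr0
    and pl0 in the cycle. *)
Lemma close_wins s1 s2 M : M0 \subset M -> perm_eq (s1 ++ s2) Y ->
  sorted (link M) s1 -> sorted (link M) s2 -> 0 < size s1 -> 0 < size s2 ->
  last pr0 s1 = pr0 -> head pl0 s2 = pl0 -> link M (last pl0 s2) (head pr0 s1) ->
  wins F M.
Proof.
move=> sM p S1 S2 n1 n2 l1 h2 lk; apply: (ham_wins (Q := s2 ++ s1)) => //.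
- by rewrite perm_catC.
- exact: sorted_cat_join lk.
- by case: (s2) n2 h2.
- by rewrite last_cat; case: (s1) n1 l1.
Qed.

(** The ends u and w of the spanning path cannot be joined directly. Maker
    turns a final piece x' .. u of the path by joining u to x, then an initial piece
    w .. z' by joining w to z. Now joining z' to x' closes the path if both turns are
    used, and joining z' to u does so if only the second one is used. The vertex x'
    must have small degree, and most vertices of PL have. *)
Lemma rotate_twice s1 s2 M B u w d e h : M0 \subset M -> B \subset pairs_of V ->
  sorted (link M) (s1 ++ PR) -> sorted (link M) (PL ++ s2) ->
  perm_eq ((s1 ++ PR) ++ (PL ++ s2)) Y ->
  head pr0 (s1 ++ PR) = w -> last pl0 (PL ++ s2) = u ->
  deg B u <= d -> deg B w <= d -> Bs \subset B -> #|B :\: Bs| <= e ->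
  {in PL, forall x, deg Bs x <= h} ->
  10 * d + e + 50 <= 10 * size PL -> 2 * d + h + 30 <= size PR -> Win 3 M B.
Proof.
move=> sM sB S1 S2 p Ew Eu du dw sBs ce hPL big1 big2.
have un : uniq ((s1 ++ PR) ++ (PL ++ s2)) by rewrite (perm_uniq p).
have un1 : uniq (s1 ++ PR) by move: un; rewrite cat_uniq => /andP[].
have un2 : uniq (PL ++ s2) by move: un; rewrite cat_uniq => /and3P[].
have dis x y : x \in s1 ++ PR -> y \in PL ++ s2 -> x != y.
  move=> x1 y2; apply: contraTneq x1 => ->.
  by move: un; rewrite cat_uniq => /and3P[_ /hasPn dis _]; apply: dis.
have [L1 EL] : exists L1, PL = pl0 :: L1.
  by case: PL PL0 headPL => [//|x L1] _ /= ->; exists L1.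
have uPL : uniq PL by move: un2; rewrite cat_uniq => /andP[].
have uPR : uniq PR by move: un1; rewrite cat_uniq => /and3P[].
have uL1 : uniq L1 by move: uPL; rewrite EL cons_uniq => /andP[].
have szL : size PL = (size L1).+1 by rewrite EL.
apply: win_step => b1 b1X; set B1 := b1 |: B.
pose X (i : 'I_(size L1)) := nth pl0 PL i.
pose X' (i : 'I_(size L1)) := nth pl0 L1 i.
have injX : injective X.
  move=> i j /eqP; rewrite /X nth_uniq ?szL //; first by move/eqP/val_inj.
    by rewrite ltnS ltnW.
  by rewrite ltnS ltnW.
have injX' : injective X'.
  by move=> i j /eqP; rewrite /X' nth_uniq // => /eqP/val_inj.
have X'PL i : X' i \in PL by rewrite EL inE mem_nth ?orbT.
(* Bs bounds the degrees on PL, and few vertices of PL have received 20 edges since *)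
pose bad := [set i in [set: 'I_(size L1)] | [set u; X i] \in B1] :|:
  ([set i | X' i == u] :|: [set i | 20 <= deg (B :\: Bs) (X' i)]).
have cbad : #|bad| < #|'I_(size L1)|.
  have c1 : #|[set i in [set: 'I_(size L1)] | [set u; X i] \in B1]| <= d.+1.
    apply: leq_trans (few_neighbours _ _ (in2W injX)) _.
    by apply: leq_trans (deg_add1 _ _ b1X) _.
  have c2 : #|[set i | X' i == u]| <= 1.
    apply/card_le1_eqP => i j; rewrite !inE => /eqP Ei /eqP Ej.
    by apply: injX'; rewrite Ei Ej.
  have c3 : #|[set i | 20 <= deg (B :\: Bs) (X' i)]| * 20 <= 2 * e.
    apply: leq_trans (_ : 2 * #|B :\: Bs| <= _); last by rewrite leq_mul2l.
    rewrite -(card_imset _ injX'); apply: card_high_deg.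
      by apply: subset_trans sB; apply: subsetDl.
    by move=> x /imsetP[i]; rewrite inE => hi ->.
  rewrite card_ord; apply: leq_ltn_trans (leq_card_setU _ _) _.
  move: c1 c2 c3; set S1' := [set i in _ | _]; set S2' := [set i | _ == u]; set S3' := [set i | 20 <= _].
  have := (leq_card_setU S2' S3').1; move: big1; rewrite szL.
  by move: #|S1'| #|S2'| #|S3'| #|_ :|: _|; arith.
have [i] : exists i, i \notin bad.
  apply/existsP; rewrite -negb_forall; apply: contraL cbad => /forallP all.
  by rewrite -leqNgt; apply/subset_leq_card/subsetP=> i _; apply: all.
rewrite !in_setU !negb_or => /and3P[uX X'u X'h].
rewrite in_set in_setT /= in uX; rewrite in_set in X'u; rewrite in_set -ltnNge in X'h.
set x := X i in uX; set x' := X' i in X'u X'h.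
have Ei : PL = rcons (take i PL) x ++ x' :: drop i.+1 L1.
  rewrite /x /x' /X /X'.
  by rewrite EL; apply: split_consecutive.
have EPS : PL ++ s2 = rcons (take i PL) x ++ (x' :: drop i.+1 L1 ++ s2).
  by rewrite {1}Ei -catA.
have xPL : x \in PL by rewrite Ei mem_cat mem_rcons mem_head.
have xu : x != u.
  rewrite -Eu EPS last_cat; move: un2; rewrite EPS cat_uniq => /and3P[_ /hasPn h1 _].
  apply: contraTneq (h1 _ (mem_last x' (drop i.+1 L1 ++ s2))) => /= <-.
  by rewrite mem_rcons mem_head.
exists [set u; x]; first by rewrite in_setD uX pairs_ofE eq_sym.
set M1 := _ |: M.
pose t2 := rcons (take i PL) x ++ rev (x' :: drop i.+1 L1 ++ s2).
have sub1 : M \subset M1 by apply: subsetUr.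
have pt2 : perm_eq t2 (PL ++ s2).
  by rewrite /t2 EPS perm_cat2l perm_rev.
have Eu' : last x' (drop i.+1 L1 ++ s2) = u.
  by rewrite -Eu EPS [RHS]last_cat.
have St2 : sorted (link M1) t2.
  move: S2; rewrite EPS => /cat_sorted2[T1 T2].
  apply: (sorted_cat_join (x := x) (y := u)); rewrite ?size_rcons ?size_rev //.
  - exact: sorted_link_sub sub1 T1.
  - by rewrite sorted_rev; apply: sorted_link_sub sub1 T2.
  - rewrite last_rcons lastI rev_rcons /= Eu' linkC /link.
    exact: setU11.
have hS2 : head pl0 (PL ++ s2) = pl0 by rewrite EL.
have ht2 : head pl0 t2 = pl0.
  by move: hS2; rewrite EPS /t2; case: (take i PL).
have lt2 : last pl0 t2 = x'.
  by rewrite /t2 last_cat rev_cons last_rcons.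
have nt2 : 0 < size t2 by rewrite /t2 size_cat size_rcons.
apply: win_step => b2 b2X; set B2 := b2 |: B1.
have d2 y : deg B2 y <= (deg B y).+2.
  by apply: leq_trans (deg_add1 _ _ b2X) _; rewrite ltnS; apply: deg_add1.
have dx' : deg B2 x' <= h + 22.
  apply: leq_trans (d2 _) _; have := deg_split x' sBs; have := hPL x' (X'PL i).
  by move: X'h; arith.
have [R1 [pz ER]] : exists R1 pz, PR = pz :: R1 by case: PR PR0 => [//|pz R1] _; exists R1, pz.
have szR : size PR = (size R1).+1 by rewrite ER.
have uR1 : uniq R1 by move: uPR; rewrite ER cons_uniq => /andP[].
pose Z' (j : 'I_(size R1)) := nth pr0 PR j.
pose Z (j : 'I_(size R1)) := nth pr0 R1 j.
have injZ' : injective Z'.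
  move=> j k /eqP; rewrite /Z' nth_uniq ?szR //; first by move/eqP/val_inj.
    by rewrite ltnS ltnW.
  by rewrite ltnS ltnW.
have injZ : injective Z.
  by move=> j k /eqP; rewrite /Z nth_uniq // => /eqP/val_inj.
pose bad2 := [set j in [set: 'I_(size R1)] | [set w; Z j] \in B2] :|:
  ([set j in [set: 'I_(size R1)] | [set u; Z' j] \in B2] :|:
   [set j in [set: 'I_(size R1)] | [set x'; Z' j] \in B2]).
have cbad2 : #|bad2| < #|'I_(size R1)|.
  have c1 := leq_trans (few_neighbours (A := [set: 'I_(size R1)]) B2 w (in2W injZ)) (d2 w).
  have c2 := leq_trans (few_neighbours (A := [set: 'I_(size R1)]) B2 u (in2W injZ')) (d2 u).
  have c3 := leq_trans (few_neighbours (A := [set: 'I_(size R1)]) B2 x' (in2W injZ')) dx'.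
  rewrite card_ord; apply: leq_ltn_trans (leq_card_setU _ _) _.
  apply: leq_ltn_trans (_ : d.+2 + (d.+2 + (h + 22)) < _); last by move: big2; rewrite szR; arith.
  apply: leq_add; first by apply: leq_trans c1 _; rewrite !ltnS.
  apply: leq_trans (leq_card_setU _ _) _; apply: leq_add => //.
  by apply: leq_trans c2 _; rewrite !ltnS.
have [j] : exists j, j \notin bad2.
  apply/existsP; rewrite -negb_forall; apply: contraL cbad2 => /forallP all.
  by rewrite -leqNgt; apply/subset_leq_card/subsetP=> j _; apply: all.
rewrite !in_setU !negb_or => /and3P[wz uz' xz'].
rewrite in_set in_setT /= in wz; rewrite in_set in_setT /= in uz'; rewrite in_set in_setT /= in xz'.
set z := Z j in wz; set z' := Z' j in uz' xz'.
have Ej : PR = rcons (take j PR) z' ++ z :: drop j.+1 R1.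
  by rewrite /z /z' /Z /Z' ER; apply: split_consecutive.
have EPR : s1 ++ PR = (s1 ++ rcons (take j PR) z') ++ (z :: drop j.+1 R1).
  by rewrite {1}Ej catA.
have z'PR : z' \in s1 ++ PR by rewrite Ej !mem_cat mem_rcons mem_head orbT.
have nT : 0 < size (s1 ++ rcons (take j PR) z') by rewrite size_cat size_rcons addnS.
have Ew' : head pr0 (s1 ++ rcons (take j PR) z') = w.
  by rewrite -Ew EPR; case: (s1 ++ rcons _ _) nT.
have wT : w \in s1 ++ rcons (take j PR) z'.
  by rewrite -Ew'; case: (s1 ++ rcons _ _) nT => // y l _; apply: mem_head.
have wz_neq : w != z.
  move: un1; rewrite EPR cat_uniq => /and3P[_ /hasPn h1 _].
  by apply: contraTneq wT => ->; apply: h1; apply: mem_head.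
exists [set w; z]; first by rewrite in_setD wz pairs_ofE.
set M2 := _ |: M1.
have sub2 : M1 \subset M2 by apply: subsetUr.
pose t1 := rev (s1 ++ rcons (take j PR) z') ++ z :: drop j.+1 R1.
have pt1 : perm_eq t1 (s1 ++ PR).
  by rewrite /t1 EPR perm_cat2r perm_rev.
have St1 : sorted (link M2) t1.
  move: S1; rewrite EPR => /cat_sorted2[T1 T2].
  apply: (sorted_cat_join (x := w) (y := z)); rewrite ?size_rev ?size_cat ?size_rcons ?addnS //.
  - by rewrite sorted_rev; apply: sorted_link_sub sub2 (sorted_link_sub sub1 T1).
  - exact: sorted_link_sub sub2 (sorted_link_sub sub1 T2).
  - rewrite [last _ _](_ : _ = w) /=; first exact: setU11.
    by rewrite -Ew'; case: (s1 ++ _) nT => // y l _; rewrite rev_cons last_rcons.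
have ht1 : head pr0 t1 = z'.
  by rewrite /t1 -rcons_cat rev_rcons.
have lt1 : last pr0 t1 = pr0.
  rewrite -[RHS]lastPR Ej /t1 !last_cat /=; by [].
have nt1 : 0 < size t1 by rewrite /t1 size_cat addnS.
have sM2 : M0 \subset M2.
  by apply: subset_trans sM _; apply: subset_trans (subsetUr _ _) (subsetUr _ _).
have nS2 : 0 < size (PL ++ s2) by rewrite EL.
have x'2 : x' \in PL ++ s2 by rewrite mem_cat X'PL.
have u2 : u \in PL ++ s2 by rewrite -Eu EL /= mem_last.
apply: win_step => b3 b3X; set B3 := b3 |: B2.
have [claimed|free] := boolP ([set u; z'] \in B3); last first.
  exists [set u; z']; first by rewrite in_setD free pairs_ofE eq_sym dis.
  set M3 := _ |: M2.
  have sub3 : M2 \subset M3 by apply: subsetUr.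
  apply: winning_wins; apply: (close_wins (s1 := t1) (s2 := PL ++ s2)) => //.
  - by apply: subset_trans sM2 _; apply: subsetUr.
  - by apply: perm_trans p; rewrite perm_cat.
  - exact: sorted_link_sub sub3 St1.
  - exact: sorted_link_sub sub3 (sorted_link_sub sub2 (sorted_link_sub sub1 S2)).
  - by rewrite Eu ht1 /link setU11.
have b3E : b3 = [set u; z'].
  by move: claimed; rewrite in_setU1 (negbTE uz') orbF => /eqP.
exists [set x'; z'].
  rewrite in_setD in_setU1 (negbTE xz') orbF b3E pairs_ofE [x' == z']eq_sym dis // andbT.
  apply/eqP=> /setP/(_ x'); rewrite !inE eqxx (negbTE X'u) /= eq_sym.
  by rewrite (negbTE (dis _ _ z'PR x'2)).
set M3 := _ |: M2.
have sub3 : M2 \subset M3 by apply: subsetUr.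
apply: winning_wins; apply: (close_wins (s1 := t1) (s2 := t2)) => //.
- by apply: subset_trans sM2 _; apply: subsetUr.
- by apply: perm_trans p; rewrite perm_cat.
- exact: sorted_link_sub sub3 St1.
- exact: sorted_link_sub sub3 (sorted_link_sub sub2 St2).
- by rewrite lt2 ht1 /link setU11.
Qed.

End Closing.
End Game.

(** * Completing a path between two fixed ends *)

(** The paths PL and PR and the vertices of A have to be arranged into one path
    from pl0 to pr0. The simplest way is to insert A between PL and PR; the final
    repair also rearranges PL and PR. *)
Section Completion.
Variables (V : finType) (F : {set {set {set V}}}).
Notation Win := (winning (pairs_of V) F).
Implicit Types (ss tt : seq (seq V)) (M B : {set {set V}}) (x y z u w : V) (Q : seq V).
Variables (pl0 pr0 : V) (PL PR : seq V) (A : {set V}) (M0 Bs : {set {set V}}).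
Hypothesis headPL : head pl0 PL = pl0.
Hypothesis lastPR : last pr0 PR = pr0.
Hypothesis PL0 : 0 < size PL.
Hypothesis PR0 : 0 < size PR.
Let W := PR ++ PL.
Let Y := W ++ enum A.
Let e0 := [set pr0; pl0].
Hypothesis uniqY : uniq Y.
Hypothesis ham_wins : forall Q M, M0 \subset M -> perm_eq Q Y -> sorted (link M) Q ->
  head pl0 Q = pl0 -> last pl0 Q = pr0 -> wins F M.

Section Ports.
Variable E1 : {set V}.

Definition path_ok ss M := [/\ segments W Y e0 ss M, M0 \subset M,
  singles ss = set0 & endset ss \subset E1].

Lemma path_partners ss M u : path_ok ss M -> u \in endset ss ->
  #|endset ss| <= #|partners (@endset V) (@joinable V) ss u| + 2.
Proof. by move=> [sg _ _ _] us; apply: card_joinable sg us. Qed.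

Lemma path_many ss M u : path_ok ss M -> 3 < #|endset ss| -> u \in endset ss ->
  #|endset ss| <= 2 * #|partners (@endset V) (@joinable V) ss u|.
Proof. by move=> oks; have := @path_partners ss M u oks; move=> h N4 /h; arith. Qed.

(** All ports but two are partners of u. *)
Lemma path_average ss M B D u : path_ok ss M -> 3 < #|endset ss| -> u \in endset ss ->
  {in endset ss, forall x, rdeg (@endset V) (@joinable V) ss B x <= D} ->
  #|partners (@endset V) (@joinable V) ss u| *
    (\sum_(x in endset ss) rdeg (@endset V) (@joinable V) ss B x) <=
  #|endset ss| * (\sum_(w in partners (@endset V) (@joinable V) ss u)
       rdeg (@endset V) (@joinable V) ss B w) +
  2 * D * #|partners (@endset V) (@joinable V) ss u|.
Proof.
move=> oks _ us leD; have c2 := path_partners oks us.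
set P := partners _ _ ss u in c2 *; set rd := rdeg _ _ ss B in leD *.
have sP : P \subset endset ss by apply/subsetP=> w; rewrite inE => /andP[].
rewrite (big_setID P) /= (setIidPr sP) mulnDr; apply: leq_add.
  by rewrite leq_mul2r subset_leq_card ?orbT.
rewrite mulnC leq_mul2r; apply/orP; right.
apply: leq_trans (_ : #|endset ss :\: P| * D <= _).
  by rewrite -sum_nat_const; apply: leq_sum => x; rewrite in_setD => /andP[_ xs]; apply: leD.
by rewrite leq_mul2r cardsD (setIidPr sP) leq_subLR c2 orbT.
Qed.

Lemma path_join ss M u w : path_ok ss M -> 3 < #|endset ss| ->
  u \in endset ss -> w \in endset ss -> joinable ss u w ->
  exists t, [/\ path_ok t ([set u; w] |: M), endset t = endset ss :\ u :\ w &
    {in endset t &, forall x y, joinable t x y -> joinable ss x y}].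
Proof.
move=> [sg sM s0 sE] _ us ws auw.
have [tt [sgt sz Et St Jt]] := join_segments uniqY sg us ws auw.
have s0' x : ([:: x] \in ss) = false.
  by have := in_set0 x; rewrite -s0 inE.
have EE : endset tt = endset ss :\ u :\ w.
  apply/setP=> x; rewrite Et s0' orbF in_set2 negb_or !in_setD1.
  by case: (x \in endset ss); rewrite ?andbT ?andbF //= andbC.
exists tt; split=> // [|x y _ _]; last exact: Jt.
split=> //.
- by apply: subset_trans sM _; apply: subsetUr.
- by apply/setP=> x; rewrite [LHS]inE St s0' in_set0.
- by rewrite EE; apply: subset_trans sE; apply: subset_trans (subsetDl _ _) (subsetDl _ _).
Qed.

(** One segment is left. It contains the piece W, possibly reversed, and the
    edge e0 occurs in it only in the middle of W because vertices do not repeat. *)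
Lemma last_path ss M B d e h : path_ok ss M -> #|endset ss| = 2 ->
  B \subset pairs_of V -> {in E1, forall x, deg B x <= d} ->
  Bs \subset B -> #|B :\: Bs| <= e -> {in PL, forall x, deg Bs x <= h} ->
  10 * d + e + 50 <= 10 * size PL -> 2 * d + h + 30 <= size PR -> Win 3 M B.
Proof.
move=> [sg sM s0 sE] sz sB leD sBs ce hPL big1 big2.
have := segments_card uniqY sg; rewrite s0 cards0 addn0 sz.
case: ss sg s0 sE {sz} => [|s [|s' ss]] sg s0 sE // sz; last by move: sz => /=; arith.
have [pY ne lk cr] := sg.
rewrite /= cats0 in pY; rewrite /= andbT in lk; rewrite /= orbF in cr.
have [t [pt lt et iW]] : exists t, [/\ perm_eq t s,
    sorted (link (e0 |: M)) t = sorted (link (e0 |: M)) s, isend t =1 isend s & infix W t].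
  case/orP: cr => iW; [exists s|exists (rev s)]; split=> //.
  - by rewrite perm_rev.
  - by rewrite sorted_rev.
  - exact: isend_rev.
case/infixP: iW => s1 [s2 Et].
have pY' := perm_trans pt pY.
have Et' : t = (s1 ++ PR) ++ (PL ++ s2) by rewrite Et /W -!catA.
have un : uniq ((s1 ++ PR) ++ (PL ++ s2)) by rewrite -Et' (perm_uniq pY').
move: un; rewrite cat_uniq => /and3P[_ /hasPn dis _].
have pl0S : pl0 \in PL ++ s2 by case: PL PL0 headPL => // a l _ /= ->; apply: mem_head.
have pr0S : pr0 \in s1 ++ PR.
  by rewrite mem_cat; case: PR PR0 lastPR => // a l _ /= E; rewrite -{2}E mem_last orbT.
have [S1 S2] : sorted (link M) (s1 ++ PR) /\ sorted (link M) (PL ++ s2).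
  move: lk; rewrite -lt Et' => /cat_sorted2[T1 T2].
  have H (v : V) (l : seq V) : v \in e0 -> v \notin l -> sorted (link (e0 |: M)) l -> sorted (link M) l.
    move=> ve vl; apply: (sub_in_sorted (P := [pred x | x != v])).
      move=> x y; rewrite !inE => xv yv; rewrite /link in_setU1 => /orP[/eqP E|//].
      by move: ve; rewrite -E !inE ![v == _]eq_sym (negbTE xv) (negbTE yv).
    by apply/allP=> x xl; rewrite /=; apply: contraNneq vl => <-.
  split; [apply: (H pl0)|apply: (H pr0)] => //; rewrite ?inE ?eqxx ?orbT //.
    exact: dis.
  by apply/negP=> /dis; rewrite /= pr0S.
have endE x : isend t x -> deg B x <= d.
  by move=> tx; apply/leD/(subsetP sE); rewrite inE /= orbF -et.
have n1 : 0 < size (s1 ++ PR) by rewrite size_cat addn_gt0 PR0 orbT.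
have n2 : 0 < size (PL ++ s2) by rewrite size_cat addn_gt0 PL0.
apply: (rotate_twice (F := F) uniqY headPL lastPR PL0 PR0 ham_wins sM sB S1 S2 _ erefl erefl
  (Bs := Bs) (d := d) (e := e) (h := h)) => //.
- by rewrite -Et'.
- apply: endE; rewrite Et'; case: (s1 ++ PR) n1 => // a l _; case: (PL ++ s2) n2 => // c k _.
  by rewrite isend_cons last_cat eqxx orbT.
- apply: endE; rewrite Et'; case: (s1 ++ PR) n1 => // a l _.
  by rewrite isend_cons eqxx.
Qed.

End Ports.

Variables (q C q' C' : rat) (D d0 X D' m3 e h : nat).
Hypothesis q1 : (1 <= q)%R.
Hypothesis qs : ((2 * 2)%:R * ((q - 1) * q ^+ 2) <= 1 :> rat)%R.
Hypothesis CD : (C < q ^+ D.+1)%R.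
Hypothesis CX : (#|V|%:R * q ^+ (d0 + X + 1) <= C)%R.
Hypothesis q1' : (1 <= q')%R.
Hypothesis qs' : ((2 * 1)%:R * ((q' - 1) * q' ^+ 1) <= 1 :> rat)%R.
Hypothesis CD' : (C' < q' ^+ D'.+1)%R.
Hypothesis C'D : ((2 * #|A|.+1)%:R * q' ^+ (2 * D + 7) <= C')%R.
Hypothesis X24 : 24 <= X.
Hypothesis m3_1 : slack D' + 4 <= m3.
Hypothesis m3_2 : D' + 3 <= m3.
Hypothesis m3_3 : 5 * slack D' <= m3.
Hypothesis m3_4 : 40 * (2 * D + 7) * m3 <= #|A|.
Hypothesis m3_5 : 16 * m3 <= #|A|.
Hypothesis room : 16 * (D + 7) <= #|A|.

(** The unused vertices are joined to segments with two distinct ends each,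
    whose ends have small degree; at least a quarter of #|A| segments remain. These
    ends are the ports, and the two ends of one segment must not be joined. *)
Theorem path_completion M B : M0 \subset M -> sorted (link M) PL -> sorted (link M) PR ->
  B \subset pairs_of V -> {in A, forall x, deg B x <= d0} ->
  deg B (head pr0 PR) <= d0 -> deg B (last pl0 PL) <= d0 ->
  Bs \subset B -> #|B :\: Bs| + #|A|.+1 <= e -> {in PL, forall x, deg Bs x <= h} ->
  10 * (2 * D + #|A| + 8) + e + 50 <= 10 * size PL ->
  2 * (2 * D + #|A| + 8) + h + 30 <= size PR ->
  Win (#|A| + 3) M B.
Proof.
move=> sM S1 S2 sB degA degp degq sBs ce hPL big1 big2.
pose ss0 := W :: [seq [:: x] | x <- enum A].
have n1 : 1 < size W by rewrite size_cat; move: PL0 PR0; arith.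
have endW x : isend W x = (x == head pr0 PR) || (x == last pl0 PL).
  rewrite /W; case: PR PR0 => // a l _; case: PL PL0 => // c k _.
  by rewrite isend_cons last_cat.
have memA x : ([:: x] \in [seq [:: x] | x <- enum A]) = (x \in A).
  by rewrite mem_map ?mem_enum // => u v [].
have sing0 : singles ss0 = A.
  apply/setP=> x; rewrite inE in_cons memA.
  by case: eqP => // E; move: n1; rewrite -E.
have end0 x : x \in endset ss0 -> isend W x \/ x \in A.
  rewrite inE /= => /orP[|/hasP[s /mapP[y yA ->]]]; first by left.
  by rewrite isend_cons orbb => /eqP->; right; rewrite -mem_enum.
have sg0 : segments W Y e0 ss0 M.
  split.
  - by rewrite /= (flatten_map1 id) map_id.
  - by rewrite /= ltnW //=; apply/allP=> s /mapP[x _ ->].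
  - rewrite /= (_ : all _ _ = true) ?andbT; last by apply/allP=> s /mapP[x _ ->].
    have sMe : M \subset e0 |: M by apply: subsetUr.
    apply: (sorted_cat_join (x := pr0) (y := pl0)) => //; try exact: sorted_link_sub sMe _.
    by rewrite lastPR headPL; apply: setU11.
  - by rewrite /= /carries infix_refl.
have sz0 : size ss0 = #|A|.+1 by rewrite /= size_map -cardE.
have c0 : #|endset ss0| = #|A| + 2.
  by have := segments_card uniqY sg0; rewrite sing0 sz0; arith.
have deg0 : {in endset ss0, forall x, deg B x <= d0}.
  by move=> x /end0[|/degA//]; rewrite endW => /orP[]/eqP->.
have st0 : pairing_state W Y e0 M0 B #|A|.+1 q C X #|endset ss0| (endset ss0) ss0 M B set0.
  split=> //.
  - by split=> //; rewrite sz0.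
  - apply: le_trans CX; apply: (potential_low q1 (subxx (endset ss0)) (D := d0 + X)).
      by move=> x /deg0 h1; apply: leq_trans h1 (leq_addr _ _).
    by move=> x _; rewrite leq_addr.
  - split; last by move=> x; rewrite inE.
    by rewrite -setI_eq0 set0I.
  - by rewrite leq_addr.
have -> : #|A| + 3 = size ss0 + 2 by rewrite sz0; arith.
apply: (pair_singles uniqY q1 qs CD CX deg0 st0).
move=> s1 M1 B1 Z st1 few1.
have deg1 := pairing_deg q1 CD st1; have [bs1 sE1 _ [_ hZ] cZ] := st1.
have [_ _ sB1 B1X cB1] := bs1.
(* as X >= 24, the removed ends cost at most 3 #|Z| <= (#|A| + 1) / 4 ends *)
have leZ : 12 * #|Z| <= #|A|.+1.
  have : #|Z| * X <= 2 * #|B1 :\: B|.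
    apply: card_high_deg hZ; apply: subset_trans B1X; exact: subsetDl.
  have : #|B1 :\: B| <= #|A|.+1.
    rewrite cardsD (setIidPr sB1) leq_subLR; apply: leq_trans cB1; exact: leq_addr.
  have : #|Z| * 24 <= #|Z| * X by rewrite leq_mul2l X24 orbT.
  by move: #|B1 :\: B|; arith.
apply: (attach_singles uniqY bs1 deg1).
  by move: cZ leZ few1 room; rewrite c0; arith.
move=> s2 M2 B2 bs2 sB2 cB2 sE2 cE2 sing2.
have [sg2 sM2 sBB2 B2X le2] := bs2.
have szs2 : #|endset s2| = 2 * size s2.
  by have := segments_card uniqY sg2; rewrite sing2 cards0 addn0.
have deg2 : {in endset s2, forall x, deg B2 x <= 2 * D + 7}.
  move=> x xs; apply: leq_trans (deg_grow x sB2 B2X cB2) _.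
  by have := deg1 x (subsetP sE2 x xs); move: few1; arith.
have les2 : size s2 <= #|A|.+1.
  by have := subset_leq_card sBB2; move: le2; move: #|B2| #|B|; arith.
have les2' : #|A| <= 4 * size s2.
  by move: cE2 cZ leZ few1 room; rewrite szs2 c0; arith.
have ok2 : path_ok (endset s2) s2 M2 by split.
have lastp ss M' B' : path_ok (endset s2) ss M' -> #|endset ss| = 2 -> B2 \subset B' ->
    B' \subset pairs_of V -> #|B'| <= #|B2| + size s2 -> Win 3 M' B'.
  move=> oks sz sB' B'X cB'.
  have sBB' := subset_trans sBB2 sB'.
  apply: (last_path oks sz B'X (d := 2 * D + #|A| + 8) (e := e) (h := h)) => //.
  - move=> x xs; apply: leq_trans (deg_grow x sB' B'X cB') _.
    by have := deg2 x xs; move: les2; arith.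
  - exact: subset_trans sBs sBB'.
  - apply: leq_trans ce; rewrite !cardsD (setIidPr sBs) (setIidPr (subset_trans sBs sBB')).
    have := subset_leq_card sBs; move: cB' le2.
    by move: #|B'| #|B2| #|B| #|Bs|; arith.
apply: (port_game (pts := @endset V) (@joinable_sym V) (@joinable_irr V) _ _ _ lastp
   q1' qs' CD' m3_1 m3_2 m3_3 (D0 := 2 * D + 7) _ _ ok2) => //.
- by move=> ss M' u; apply: path_many.
- by move=> ss M' B' D0 u; apply: path_average.
- by move=> ss M' u w; apply: path_join.
- by move: m3_4 les2'; arith.
- by move: m3_5 les2'; arith.
- move=> x xs; apply: leq_trans (rdeg_le_deg _ _ _ _ _) _; exact: deg2.
- apply: le_trans C'D; rewrite ler_wpM2r ?exprn_ge0 //; first by apply: le_trans q1'.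
  by rewrite ler_nat leq_mul2l les2.
Qed.

End Completion.

(** * Trees with a long bare path *)

Section Chain.
Variables (V T : finType) (F : {set {set {set V}}}).
Notation Win := (winning (pairs_of V) F).
Variables (par : T -> T) (depth : T -> nat) (rho : {set T}) (Delta : nat).
Notation partial_copy := (partial_copy par rho).
Notation budget := (budget rho).
Hypothesis depth_par : forall x, x \notin rho -> depth (par x) < depth x.
Hypothesis few_children : forall v, #|children par rho v| <= Delta.
Hypothesis cardVT : #|V| = #|T|.
Implicit Types (S K : {set T}) (f g : T -> V) (M B : {set {set V}}).
Implicit Types (b : {set V}) (x y z : V) (v w : T) (s : bool) (i j : nat).

(* ch true 0, .., ch true N, ch false N, .., ch false 0 is a path of the tree
   without branches; its middle edge is not an edge of the forest. *)
Variables (ch : bool -> nat -> T) (N : nat).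
Hypothesis ch_inj : forall s s' i j, i <= N -> j <= N -> ch s i = ch s' j -> s = s' /\ i = j.
Hypothesis ch_par : forall s i, i < N -> par (ch s i.+1) = ch s i.
Hypothesis ch_root : forall s i, i <= N -> (ch s i \in rho) = (i == 0).
Hypothesis ch_closed : forall s i w, 0 < i <= N -> w \notin rho -> par w = ch s i ->
  i < N /\ w = ch s i.+1.
Hypothesis ch0 : forall s, ch s 0 \in rho.

Definition cut i : {set T} :=
  [set w | ~~ [exists s : bool, exists j : 'I_N.+1, (i < j) && (w == ch s j)]].

Lemma cutP i w : reflect (exists s j, [/\ i < j, j <= N & w = ch s j]) (w \notin cut i).
Proof.
rewrite inE negbK; apply: (iffP existsP) => [[s /existsP[j /andP[ij /eqP->]]]|[s [j [ij jN ->]]]].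
  by exists s, j; split=> //; rewrite -ltnS.
by exists s; apply/existsP; exists (Ordinal (jN : j < N.+1)); rewrite /= ij eqxx.
Qed.

Lemma ch_cut s i j : j <= N -> (ch s j \in cut i) = (j <= i).
Proof.
move=> jN; apply/idP/idP => [|ji].
  by apply: contraTT; rewrite -ltnNge => ij; apply/cutP; exists s, j.
apply/negPn/negP => /cutP[s' [j' [ij' j'N /ch_inj[]//]]].
by move=> _ E; move: ji; rewrite E leqNgt ij'.
Qed.

Lemma cut_closed i : {in cut i, forall w, w \notin rho -> par w \in cut i}.
Proof.
move=> w wK wr; apply/negPn/negP => /cutP[s [j [ij jN pw]]].
have [|jN' wE] := @ch_closed s j w _ wr pw.
  by rewrite jN (leq_ltn_trans _ ij).
by move: wK; rewrite wE ch_cut // leqNgt ltnS ltnW.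
Qed.

Lemma rho_cut i : rho \subset cut i.
Proof.
apply/subsetP=> w wr; apply/negPn/negP => /cutP[s [j [ij jN E]]].
by move: wr; rewrite E ch_root // => /eqP j0; rewrite j0 in ij.
Qed.

Lemma cutS i : i < N -> cut i.+1 = ch true i.+1 |: (ch false i.+1 |: cut i).
Proof.
move=> iN; apply/setP=> w; rewrite !in_setU1.
have [wK|/cutP[s [j [ij jN ->]]]] := boolP (w \in cut i).
  rewrite !orbT; apply/negPn/negP => /cutP[s [j [ij jN E]]].
  by move: wK; rewrite E ch_cut // leqNgt ltnW.
rewrite ch_cut // orbF.
apply/idP/orP => [ji|].
  have -> : j = i.+1 by apply/eqP; rewrite eqn_leq ji ij.
  by case: s; rewrite eqxx; [left|right].
by case=> /eqP/ch_inj[] // _ ->.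
Qed.

Lemma cut_notin s i : i < N -> ch s i.+1 \notin cut i.
Proof. by move=> iN; rewrite ch_cut // ltnn. Qed.

Lemma card_cut i : i <= N -> #|cut i| + 2 * (N - i) = #|T|.
Proof.
move=> iN; rewrite -{1}(subKn iN); move: (N - i) (leq_subr i N) => m.
elim: m => [|m IH] mN.
  rewrite subn0 muln0 addn0 (_ : cut N = [set: T]) ?cardsT //.
  apply/setP=> w; rewrite [RHS]inE; apply/negPn/negP=> /cutP[s [j [Nj jN _]]].
  by move: (leq_trans Nj jN); rewrite ltnn.
rewrite -(IH (ltnW mN)).
have E : N - m = (N - m.+1).+1 by rewrite subnSK.
have lt : N - m.+1 < N by rewrite ltn_subrL (leq_ltn_trans _ mN).
rewrite E cutS // !cardsU1 !in_setU1 !(negbTE (cut_notin _ lt)).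
have -> : ch true (N - m.+1).+1 == ch false (N - m.+1).+1 = false.
  by apply/negP=> /eqP/ch_inj[].
by rewrite /=; move: #|cut _|; arith.
Qed.

Lemma room_cut S i : i <= N -> S \subset cut i -> 2 * (N - i) <= #|T| - #|S|.
Proof.
by move=> iN sS; have := card_cut iN; have := subset_leq_card sS; move: #|cut i|; arith.
Qed.

Section FirstRun.
Variables (q C0 : rat) (D J : nat).
Hypothesis q1 : (1 <= q)%R.
Hypothesis qs : ((2 * (3 + Delta))%:R * ((q - 1) * q ^+ (3 + Delta)) <= 1 :> rat)%R.
Hypothesis CD : (C0 * q ^+ (2 * J.+1) < q ^+ D.+1)%R.
Hypothesis CT : (#|V|%:R * q ^+ 1 <= C0)%R.
Hypothesis JN : J.+1 < N.
Let kk := 2 * (N - J.+1).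
Hypothesis kk_big : 3 * D + 8 * Delta + 50 <= kk.
Let t := (D + 3) * (Delta + Delta * Delta).
Hypothesis kk_big2 : D + 2 * t + 3 <= kk.

Notation gstate i := (growth_state par rho q (C0 * q ^+ (2 * i)) 0 (cut i) (cut i)).

Lemma C_mono i : i <= J.+1 -> (C0 * q ^+ (2 * i) < q ^+ D.+1)%R.
Proof.
have q0 : (0 <= q)%R by apply: le_trans q1.
move=> iJ; apply: le_lt_trans CD; apply: ler_wpM2l.
  by apply: le_trans CT; rewrite mulr_ge0 ?exprn_ge0.
by apply: ler_weXn2l => //; rewrite leq_mul2l.
Qed.

Lemma C_low i : (#|V|%:R * q ^+ (0 + 1) <= C0 * q ^+ (2 * i))%R.
Proof.
apply: le_trans CT _; rewrite -[X in (X <= _)%R]mulr1; apply: ler_wpM2l.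
  by apply: le_trans CT; rewrite mulr_ge0 ?exprn_ge0 //; apply: le_trans q1.
exact: exprn_ege1.
Qed.

Definition fronts i S := forall s, ch s i \in S.

Lemma gstate_room i S f M B : i <= J.+1 -> gstate i S f M B -> kk <= #|T| - #|S|.
Proof.
move=> iJ [_ _ _ sS _]; apply: leq_trans (room_cut _ sS); last by move: JN; arith.
by rewrite /kk; arith.
Qed.

(** The ends of the two embedded parts of the chain are not active, so Breaker
    may raise their degrees. They are renewed while they can still be joined to unused
    vertices, and the new ends have small degree. *)
Lemma extend_fronts i S f M B : i <= J -> gstate i S f M B -> fronts i S ->
  (forall s, deg B (f (ch s i)) + 4 < #|T| - #|S|) ->
  (forall S' f' M' B', gstate i.+1 S' f' M' B' -> fronts i.+1 S' ->
     (forall s, deg B' (f' (ch s i.+1)) <= D + 2) -> #|S'| = #|S| + 2 ->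
     cut i.+1 :\: S' = cut i :\: S -> Win (budget S') M' B') ->
  Win (budget S) M B.
Proof.
move=> iJ gs fr room cont; have [pc sB cB sS [_ pot]] := gs.
have iN : i < N by move: JN; arith.
have notr s : ch s i.+1 \notin rho by rewrite ch_root.
have notS s : ch s i.+1 \notin S by apply: contra (cut_notin s iN); apply: (subsetP sS).
have leD : {in active par (cut i) S f, forall x, deg B x <= D}.
  by apply: (potential_bound q1); apply: le_lt_trans pot (C_mono _); arith.
have leU : {in unused S f, forall x, deg B x <= D}.
  by move=> x xU; apply: leD; rewrite /active in_setU xU.
apply: (embed_step cardVT (w := ch false i.+1) (Z := unused S f) pc) => //.
- by rewrite ch_par.
- by rewrite ch_par // (card_unused cardVT pc); have := room false; arith.
move=> b1 x1 M1 b1X x1U x1b sM1 nB1 pc1.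
set S1 := _ |: S in pc1 *; set f1 := update f _ x1 in pc1 *.
have n12 : ch true i.+1 != ch false i.+1 by apply/eqP=> /ch_inj[].
have notS1 : ch true i.+1 \notin S1 by rewrite in_setU1 negb_or n12 notS.
have ex1 : extends S f S1 f1 by apply: extends_update.
have cS1 : #|S1| = #|S|.+1 by rewrite cardsU1 notS.
have n1 s : ch s i != ch false i.+1.
  by apply/eqP=> /ch_inj[]; try exact: ltnW; move=> // _ /eqP; rewrite eqn_leq ltnn andbF.
apply: (embed_step cardVT (w := ch true i.+1) (Z := unused S1 f1) pc1) => //.
- by rewrite ch_par // in_setU1 fr orbT.
- rewrite ch_par // (card_unused cardVT pc1) cS1 /f1 updateE //.
  by have := room true; have := deg_add1 B (f (ch true i)) b1X; arith.
move=> b2 x2 M2 b2X x2U x2b sM2 nB2 pc2.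
set S2 := _ |: S1 in pc2 *; set f2 := update f1 _ x2 in pc2 *.
set B2 := b2 |: (b1 |: B).
have ex2 : extends S f S2 f2.
  by apply: extends_trans ex1 _; apply: extends_update.
have cS2 : #|S2| = #|S| + 2 by rewrite cardsU1 notS1 cS1; arith.
have dB2 x : deg B2 x <= deg B x + 2.
  by apply: leq_trans (deg_add1 _ _ b2X) _; rewrite addn2 ltnS deg_add1.
have nK s w : w \in cut i -> w != ch s i.+1.
  by move=> wK; apply: contraNneq (cut_notin s iN) => <-.
have E3 : cut i :\: S2 = cut i :\: S.
  apply/setP=> w; rewrite !in_setD /S2 /S1 !in_setU1.
  by case wK: (w \in cut i); rewrite ?andbF // !(negbTE (nK _ _ wK)).
have E2 : cut i.+1 :\: S2 = cut i :\: S.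
  rewrite -E3; apply/setP=> w; rewrite !in_setD cutS // /S2 /S1 !in_setU1.
  by case: (w == _) => //=; case: (w == _).
have [_ inj2 _] := pc2.
have sB2 : B2 \subset pairs_of V by rewrite !subUset !sub1set b2X b1X.
apply: (cont S2 f2 M2 B2) => //.
- split=> //.
  + rewrite cS2; apply: leq_trans (card_setU1_leq _ _) _.
    by have := card_setU1_leq b1 B; move: cB; move: #|_ |: B| #|B|; arith.
  + by rewrite cutS // /S2 /S1; do 2!apply: setUS.
  split.
    move=> w; rewrite in_setD => /andP[wK] wS; case/negP: wK; move: wS.
    by rewrite cutS // /S2 /S1 !in_setU1 => /or3P[->|->|/(subsetP sS)->]; rewrite ?orbT.
  have -> : (C0 * q ^+ (2 * i.+1) = q ^+ 2 * (C0 * q ^+ (2 * i)))%R.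
    by rewrite mulnS exprD mulrCA.
  apply: le_trans (_ : (q ^+ 2 * potential q (active par (cut i) S f) (deg B) <= _)%R); last first.
    by apply: ler_wpM2l pot; rewrite exprn_ge0 //; apply: le_trans q1.
  apply: potential_grow => //.
  have E : active par (cut i.+1) S2 f2 = active par (cut i) S2 f2.
    by rewrite /active /open_vertices E2 E3.
  by rewrite E; apply: active_sub pc ex2 inj2.
- by case; rewrite /S2 /S1 !in_setU1 ?eqxx ?orbT.
- case; apply: leq_trans (dB2 _) _; rewrite leq_add2r; apply: leU.
    by rewrite /f2 update_same; apply: (subsetP (unused_sub ex1)).
  by rewrite /f2 updateE 1?eq_sym // /f1 update_same.
Qed.

(** In a block the number of unused vertices shrinks by about a quarter.
    Breaker cannot raise the degree of a front to the number of unused vertices within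
    one block, and a logarithmic number of blocks suffices. Renewing the fronts
    multiplies the potential by q squared, which is affordable so often. *)
Lemma first_blocks j i S f M B : i + j = J -> gstate i S f M B -> fronts i S ->
  (forall s, deg B (f (ch s i)) <= D + 2) -> (#|T| - #|S|) * 4 ^ j < 5 ^ j * kk ->
  (forall i' S' f' M' B', i' <= J -> gstate i' S' f' M' B' -> fronts i' S' ->
     (forall s, deg B' (f' (ch s i')) + 4 < #|T| - #|S'|) ->
     #|cut i' :\: S'| <= t -> Win (budget S') M' B') ->
  Win (budget S) M B.
Proof.
move=> + + + + + cont; elim: j i S f M B => [|j IH] i S f M B ij gs fr degf lt.
  have := gstate_room (_ : i <= J.+1) gs; move: lt ij; rewrite !expn0 muln1 mul1n addn0.
  by move=> lt -> /(_ (leqnSn J)); rewrite leqNgt lt.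
have iJ : i <= J by rewrite -ij leq_addr.
have iJ1 : i <= J.+1 by apply: leqW.
have big := gstate_room iJ1 gs; have [_ _ _ _ [_ _]] := gs.
set NA := #|T| - #|S| in lt big *.
have room S' f' M' B' : gstate i S' f' M' B' -> 3 * D + 2 * Delta + 16 <= #|T| - #|S'|.
  by move=> gs'; have := gstate_room iJ1 gs'; move: kk_big; arith.
apply: (main_growth depth_par few_children cardVT q1 qs (C_mono iJ1) (C_low i)
  (subxx _) (@cut_closed i) room (stop := NA - NA %/ 4) gs).
  by move: (NA %/ 4); rewrite /NA; arith.
move=> S' f' M' B' gs' ex' sB' cB' end' stop'.
have [_ B'X _ _ _] := gs'; have [sS E] := ex'.
have fr' : fronts i S' by move=> s; apply: (subsetP sS).
have n4 := leq_trunc_div NA 4.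
have n4' : NA < (NA %/ 4).+1 * 4 by apply: ltn_ceil.
have degf' s : deg B' (f' (ch s i)) + 4 < #|T| - #|S'|.
  rewrite E //; have := deg_grow (f (ch s i)) sB' B'X cB'; have := degf s.
  have := max_card (mem S'); have := subset_leq_card sS.
  by move: kk_big big stop' n4 n4'; move: (NA %/ 4); rewrite /NA; arith.
have [few|many] := leqP #|cut i :\: S'| t; first exact: cont gs' fr' degf' few.
have {end'} end' : #|T| - #|S'| <= NA - NA %/ 4.
  by case: end' => // few; move: many; rewrite ltnNge few.
apply: (extend_fronts iJ gs' fr' degf') => S2 f2 M2 B2 gs2 fr2 deg2 c2 _.
apply: (IH i.+1 S2 f2 M2 B2 _ gs2 fr2 deg2); first by rewrite addSn -addnS.
(* the difference between 3 / 4 and 4 / 5 absorbs the rounding *)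
have h : 5 * (#|T| - #|S2|) <= 4 * NA.
  by move: end' n4'; rewrite c2; move: kk_big big; move: (NA %/ 4); arith.
rewrite !expnS in lt.
have : 5 * (#|T| - #|S2|) * 4 ^ j < 5 * (5 ^ j * kk).
  apply: leq_ltn_trans (_ : 4 * NA * 4 ^ j < _); first by rewrite leq_mul2r h orbT.
  by rewrite [4 * NA]mulnC -[_ * 4 * _]mulnA [5 * _]mulnA.
by rewrite -mulnA ltn_mul2l.
Qed.

Theorem first_run f : partial_copy rho f set0 -> rho = [set ch true 0; ch false 0] ->
  #|T| * 4 ^ J < 5 ^ J * kk ->
  (forall i f' M' B', i <= J.+1 -> partial_copy (cut i) f' M' -> B' \subset pairs_of V ->
     {in unused (cut i) f', forall x, deg B' x <= D + 2 + t} ->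
     (forall s, deg B' (f' (ch s i)) <= D + 2 + t) -> Win (budget (cut i)) M' B') ->
  Win #|T|.+1 set0 set0.
Proof.
move=> pc rhoE fuel cont.
have cr : #|rho| = 2.
  rewrite rhoE cards2; case: eqP => // /ch_inj[] //.
have -> : #|T|.+1 = budget rho.
  by rewrite /budget; have := max_card (mem rho); rewrite cr; arith.
have deg00 x : deg (set0 : {set {set V}}) x = 0.
  by apply/eqP; rewrite -leqn0; apply: leq_trans (deg_le_card _ (sub0set _)) _; rewrite cards0.
have gs0 : gstate 0 rho f set0 set0.
  split=> //.
  - exact: sub0set.
  - by rewrite cards0.
  - exact: rho_cut.
  split; first by move=> w; rewrite in_setD => /andP[wK wr]; rewrite (subsetP (rho_cut 0)) in wK.
  apply: le_trans (C_low 0).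
  apply: (@potential_low _ _ q1 setT _ (fun _ => 0) _ 0 1 (subsetT _)) => // x _.
  by rewrite deg00.
apply: (first_blocks (j := J) _ gs0) => //.
- by move=> s; rewrite deg00.
- apply: leq_ltn_trans fuel; rewrite leq_mul2r; apply/orP; right; exact: leq_subr.
move=> i S f1 M B iJ gs fr degf few.
apply: (extend_fronts iJ gs fr degf) => S2 f2 M2 B2 gs2 fr2 deg2 _ E2.
have i1J : i.+1 <= J.+1 by [].
have leD := growth_state_deg q1 (C_mono i1J) gs2; have [pc2 sB2 _ sS2 _] := gs2.
have few' : #|cut i.+1 :\: S2| <= t.
  rewrite E2; exact: few.
have rm := gstate_room i1J gs2.
apply: (embed_rest depth_par cardVT (d := D) (@cut_closed i.+1) pc2 sB2 leD).
  by move: few' kk_big2 rm; arith.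
rewrite (setUidPr sS2) => f3 M3 B3 pc3 ex3 sB3 B3X cB3.
have cB3' := leq_trans cB3 (_ : _ <= #|B2| + t); rewrite leq_add2l in cB3'.
have {}cB3 := cB3' few'.
apply: (cont i.+1 f3 M3 B3 i1J pc3 B3X).
- move=> x xU; apply: leq_trans (deg_grow x sB3 B3X cB3) _; rewrite leq_add2r.
  apply: leq_trans (leq_addr _ _); apply: leD; rewrite /active in_setU.
  by rewrite (subsetP (unused_sub ex3)).
- move=> s; have [_ E] := ex3; rewrite E //.
  by apply: leq_trans (deg_grow _ sB3 B3X cB3) _; rewrite leq_add2r.
Qed.

End FirstRun.

Section SecondRun.
Variables (q C : rat) (D : nat).
Hypothesis q1 : (1 <= q)%R.
Hypothesis qs : ((2 * 3)%:R * ((q - 1) * q ^+ 3) <= 1 :> rat)%R.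
Hypothesis CD : (C < q ^+ D.+1)%R.

(** Three vertices of the chain are used to absorb an unused vertex of largest
    degree, so that the potential of the unused vertices does not increase. *)
Lemma deep_side s i S f M B : i.+3 <= N -> partial_copy S f M -> B \subset pairs_of V ->
  ch s i \in S -> (forall j, i < j -> j <= N -> ch s j \notin S) ->
  (potential q (unused S f) (deg B) <= C)%R -> deg B (f (ch s i)) <= D + 6 ->
  3 * (D + 6) + 12 <= #|T| - #|S| ->
  let S' := ch s i.+3 |: (ch s i.+2 |: (ch s i.+1 |: S)) in
  (forall f' M' B', partial_copy S' f' M' -> extends S f S' f' ->
     B \subset B' -> B' \subset pairs_of V -> #|B'| <= #|B| + 3 -> #|S'| = #|S| + 3 ->
     (potential q (unused S' f') (deg B') <= C)%R ->
     deg B' (f' (ch s i.+3)) <= D + 3 -> Win (budget S') M' B') ->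
  Win (budget S) M B.
Proof.
move=> iN pc sB iS nS pot di big S' cont.
have leD : {in unused S f, forall x, deg B x <= D}.
  by apply: (potential_bound q1); apply: le_lt_trans pot CD.
have [z0 z0U] : exists z, z \in unused S f.
  by apply/set0Pn; rewrite -card_gt0 (card_unused cardVT pc); move: big; arith.
case: (arg_maxnP (deg B) z0U) => z zU zmax.
have [n1 n2 n3] : [/\ ch s i.+1 \notin S, ch s i.+2 \notin S & ch s i.+3 \notin S].
  by split; apply: nS => //; apply: ltnW => //; apply: ltnW.
apply: (embed_deep depth_par cardVT (w1 := ch s i.+1) (w2 := ch s i.+2) (w3 := ch s i.+3)
   (z := z) (D := D + 6) pc sB) => //; rewrite ?ch_par ?(ltnW iN) ?(ltnW (ltnW iN)) //.
  by move=> x xU; apply: leq_trans (leD x xU) (leq_addr _ _).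
move=> f' M' B' v pc' ex' vS' fv sB' B'X cB' cS'.
have [_ inj' _] := pc'; have sU := unused_sub ex'.
have cD : #|B' :\: B| <= 3 by rewrite cardsD (setIidPr sB') leq_subLR.
have sD : B' :\: B \subset pairs_of V by apply: subset_trans B'X; apply: subsetDl.
apply: (cont f' M' B') => //.
- apply: le_trans pot.
  apply: (potential_kill (i := deg (B' :\: B)) q1 qs zU) => //.
  + rewrite subsetD1 sU /= in_setC negbK -fv; exact: imset_f.
  + by move=> x _; apply: deg_split.
  + by move=> x; apply: leq_trans (deg_le_card _ sD) cD.
  + by apply: leq_trans (sum_deg sD) _; rewrite leq_mul2l.
- apply: leq_trans (deg_grow _ sB' B'X cB') _; rewrite leq_add2r; apply: leD.
  rewrite in_setC; apply/imsetP=> -[u uS E]; case/negP: n3.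
  have [sS ef] := ex'; rewrite (_ : ch s i.+3 = u) //; apply: inj' => //.
  + by rewrite setU11.
  + exact: (subsetP sS).
  + by rewrite E ef.
Qed.

(** The two sides take turns, so that neither front is exposed for more than
    three moves: the degree of the front that has just been renewed is at most D + 3. *)
Lemma deep_run n i f M B : i + 3 * n <= N -> partial_copy (cut i) f M -> B \subset pairs_of V ->
  (potential q (unused (cut i) f) (deg B) <= C)%R ->
  (forall s, deg B (f (ch s i)) <= D + (if s then 6 else 3)) ->
  3 * (D + 6) + 12 <= 2 * (N - (i + 3 * n)) ->
  (forall f' M' B', partial_copy (cut (i + 3 * n)) f' M' ->
     extends (cut i) f (cut (i + 3 * n)) f' ->
     B \subset B' -> B' \subset pairs_of V -> #|B'| <= #|B| + 6 * n ->
     (potential q (unused (cut (i + 3 * n)) f') (deg B') <= C)%R ->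
     (forall s, deg B' (f' (ch s (i + 3 * n))) <= D + (if s then 6 else 3)) ->
     Win (budget (cut (i + 3 * n))) M' B') ->
  Win (budget (cut i)) M B.
Proof.
elim: n i f M B => [|n IH] i f M B iN pc sB pot degf big cont.
  rewrite muln0 addn0 in cont; by apply: (cont f M B pc); rewrite ?muln0 ?addn0.
have iN3 : i.+3 <= N by move: iN; arith.
have iN0 : i <= N by move: iN3; arith.
have nS s j : i < j -> j <= N -> ch s j \notin cut i.
  by move=> ij jN; rewrite ch_cut // -ltnNge.
have cC := card_cut iN0.
apply: (deep_side (s := true) iN3 pc sB _ (nS true) pot (degf true)).
- by rewrite ch_cut.
- by move: cC big iN; arith.
set S1 := _ |: _ => f1 M1 B1 pc1 ex1 sB1 B1X cB1 cS1 pot1 deg1.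
apply: (deep_side (s := false) (i := i) iN3 pc1 B1X _ _ pot1).
- by apply: (subsetP ex1.1); rewrite ch_cut.
- move=> j ij jN; rewrite !in_setU1 !negb_or (nS _ _ ij jN) andbT.
  by apply/and3P; split; apply/eqP=> /ch_inj[] //; apply: ltnW => //; apply: ltnW.
- have [_ E] := ex1; rewrite E ?ch_cut //.
  by apply: leq_trans (deg_grow _ sB1 B1X cB1) _; have := degf false; arith.
- by move: cC big iN cS1; move: #|S1|; arith.
set S2 := _ |: _ => f2 M2 B2 pc2 ex2 sB2 B2X cB2 cS2 pot2 deg2.
have ES2 : S2 = cut (i + 3).
  rewrite addn3 !cutS // 1?ltnW // 1?ltnW //.
  apply/setP=> w; rewrite /S2 /S1 !in_setU1.
  by do 6!case: (w == _) => //.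
rewrite ES2 in pc2 ex2 pot2 *.
have E3 : i + 3 * n.+1 = i + 3 + 3 * n by rewrite mulnS addnA.
rewrite E3 in cont iN big.
apply: (IH (i + 3) f2 M2 B2 iN pc2 B2X pot2 _ big).
  case; rewrite addn3.
    have [_ E] := ex2; rewrite E ?setU11 //.
    by apply: leq_trans (deg_grow _ sB2 B2X cB2) _; move: deg1; arith.
  exact: deg2.
move=> f3 M3 B3 pc3 ex3 sB3 B3X cB3; apply: (cont f3 M3 B3 pc3) => //.
- exact: extends_trans ex1 (extends_trans ex2 ex3).
- exact: subset_trans sB1 (subset_trans sB2 sB3).
- by apply: leq_trans cB3 _; move: cB1 cB2; move: #|B2| #|B1| #|B|; arith.
Qed.

End SecondRun.

Section Assembly.
Hypothesis copy_wins : forall f M, injective f ->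
  (forall w, w \notin rho -> [set f (par w); f w] \in M) ->
  [set f (ch true N); f (ch false N)] \in M -> wins F M.
Variables (i k : nat) (f : T -> V) (M0 : {set {set V}}).
Hypothesis ik : i < k.
Hypothesis kN : k <= N.
Hypothesis pc : partial_copy (cut k) f M0.

Definition side s : seq V := [seq f (ch s j) | j <- iota i.+1 (k - i)].
Definition loose : {set V} := unused (cut k) f.
Definition chain_vertices : seq T :=
  [seq ch true j | j <- iota i.+1 (N - i)] ++ rev [seq ch false j | j <- iota i.+1 (N - i)].

Lemma side_cut s j : j \in iota i.+1 (k - i) -> i < j /\ ch s j \in cut k.
Proof.
rewrite mem_iota addSn subnKC; last exact: ltnW.
by rewrite ltnS => /andP[ij jk]; rewrite ch_cut ?jk //; apply: leq_trans jk kN.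
Qed.

Lemma size_side s : size (side s) = k - i.
Proof. by rewrite size_map size_iota. Qed.

Lemma side_mem s x : x \in side s -> exists j, [/\ i < j, j <= k & x = f (ch s j)].
Proof.
case/mapP=> j; rewrite mem_iota addSn subnKC; last exact: ltnW.
by rewrite ltnS => /andP[ij jk] ->; exists j.
Qed.

Lemma uniq_side s : uniq (side s).
Proof.
have [_ inj _] := pc; rewrite map_inj_in_uniq ?iota_uniq // => j j' jI j'I E.
have [_ jc] := side_cut s jI; have [_ jc'] := side_cut s j'I.
have [] // := ch_inj _ _ (inj _ _ jc jc' E).
  by move: jI; rewrite mem_iota; move: ik kN; arith.
by move: j'I; rewrite mem_iota; move: ik kN; arith.
Qed.

Lemma uniq_board : uniq ((rev (side false) ++ side true) ++ enum loose).
Proof.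
have [_ inj _] := pc.
have jN j : j <= k -> j <= N by move=> jk; apply: leq_trans jk kN.
rewrite !cat_uniq rev_uniq !uniq_side enum_uniq /= !andbT; apply/andP; split.
  apply/hasPn=> x /side_mem[j [ij jk ->]]; rewrite mem_rev; apply/negP.
  case/side_mem=> j' [ij' jk' /inj E].
  have [] // := ch_inj (jN _ jk) (jN _ jk') (E _ _); by rewrite ch_cut ?jN.
apply/hasPn=> x; rewrite mem_enum in_setC; apply: contra.
rewrite mem_cat mem_rev => /orP[] /side_mem[j [_ jk ->]]; apply: imset_f; by rewrite ch_cut ?jN.
Qed.

Lemma chain_split w : w \notin cut i -> exists s m, m < N - i /\ w = ch s (i.+1 + m).
Proof.
case/cutP=> s [j [ij jN ->]]; exists s, (j - i.+1); split; last by rewrite subnKC.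
by move: ij jN; arith.
Qed.

Lemma chain_nth w0 (s : bool) m : m < N - i ->
  nth w0 chain_vertices (if s then m else (2 * (N - i)).-1 - m) = ch s (i.+1 + m).
Proof.
move=> lt; rewrite nth_cat size_map size_iota; case: s.
  by rewrite lt (nth_map 0) ?size_iota // nth_iota.
rewrite ltnNge (_ : N - i <= _) /=; last by move: lt; arith.
rewrite nth_rev size_map size_iota; last by move: lt; arith.
rewrite (nth_map 0) ?size_iota; last by move: lt; arith.
by rewrite nth_iota; [congr ch|]; move: lt; arith.
Qed.

Lemma size_chain : size chain_vertices = 2 * (N - i).
Proof. by rewrite size_cat size_rev !size_map !size_iota addnn -mul2n. Qed.

Lemma uniq_chain : uniq chain_vertices.
Proof.
have bnd j : j \in iota i.+1 (N - i) -> j <= N.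
  by rewrite mem_iota; arith.
have u s : uniq [seq ch s j | j <- iota i.+1 (N - i)].
  by rewrite map_inj_in_uniq ?iota_uniq // => j j' /bnd jN /bnd jN' /ch_inj[].
rewrite cat_uniq rev_uniq !u andbT; apply/hasPn=> w; rewrite mem_rev => /mapP[j /bnd jN ->].
by apply/negP=> /mapP[j' /bnd jN' /ch_inj[]].
Qed.

(** The spanning path Q is read along the chain; outside the chain the old copy
    is kept. *)
Lemma ham_wins Q M : M0 \subset M ->
  perm_eq Q ((rev (side false) ++ side true) ++ enum loose) -> sorted (link M) Q ->
  head (f (ch true i.+1)) Q = f (ch true i.+1) ->
  last (f (ch true i.+1)) Q = f (ch false i.+1) -> wins F M.
Proof.
move=> sM pQ sQ hQ lQ; have [rS inj E] := pc.
set p0 := f (ch true i.+1) in hQ lQ.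
pose L := N - i; have L0 : 0 < L by rewrite /L; move: ik kN; arith.
have iN : i <= N by move: ik kN; arith.
have szQ : size Q = 2 * L.
  rewrite (perm_size pQ) !size_cat size_rev !size_side -cardE (card_unused cardVT pc).
  by rewrite /L; have := card_cut kN; move: ik kN; arith.
have uQ : uniq Q by rewrite (perm_uniq pQ) uniq_board.
pose g w := if w \in cut i then f w else nth p0 Q (index w chain_vertices).
have sub_cut : {subset cut i <= cut k}.
  move=> w wi; apply/negPn/negP=> /cutP[s [j [kj jN wE]]].
  by move: wi; rewrite wE ch_cut // leqNgt (leq_trans ik (ltnW kj)).
pose pos (s : bool) m := if s then m else (2 * L).-1 - m.
have pos_lt s m : m < L -> pos s m < 2 * L.
  by rewrite /pos; case: s => lt; move: lt L0; arith.
have gch s m : m < L -> g (ch s (i.+1 + m)) = nth p0 Q (pos s m).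
  move=> lt; rewrite /g ch_cut; last by move: lt; rewrite /L; arith.
  rewrite [_ <= i]leqNgt (_ : i < _) /=; last by rewrite addSn ltnS leq_addr.
  rewrite -(chain_nth (ch true 0) s lt) -/L -/(pos s m) index_uniq ?uniq_chain //.
  by rewrite size_chain pos_lt.
have gin w : w \in cut i -> g w = f w by rewrite /g => ->.
have gout w : w \notin cut i -> g w \in Q.
  move=> /[dup] wC /chain_split[s [m [lt ->]]]; rewrite gch // mem_nth //.
  by rewrite szQ pos_lt.
have mixed u v : u \in cut i -> v \notin cut i -> g u != g v.
  move=> uC /gout; rewrite (gin u uC) => gvQ; apply: contraTneq gvQ => <-.
  rewrite (perm_mem pQ) !mem_cat mem_rev mem_enum in_setC imset_f ?sub_cut //= orbF.
  have H s : f u \notin side s.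
    apply/negP=> /side_mem[j [ij jk fE]]; have jN := leq_trans jk kN.
    have uE : u = ch s j by apply: inj => //; [apply: sub_cut|rewrite ch_cut].
    by move: uC; rewrite uE ch_cut // leqNgt ij.
  by rewrite !(negbTE (H _)).
have injg : injective g.
  move=> u v; have [uC|uC] := boolP (u \in cut i); have [vC|vC] := boolP (v \in cut i).
  - by rewrite !gin // => /inj; apply; apply: sub_cut.
  - by move/eqP; rewrite (negbTE (mixed _ _ uC vC)).
  - by move/eqP; rewrite eq_sym (negbTE (mixed _ _ vC uC)).
  have [s [m [lt ->]]] := chain_split uC; have [s' [m' [lt' ->]]] := chain_split vC.
  rewrite !gch // => /eqP; rewrite nth_uniq ?szQ ?pos_lt // => /eqP Ep.
  have [ss mm] : s = s' /\ m = m'.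
    move: Ep; rewrite /pos; case: (s); case: (s') => Ep; split=> //;
    by move: lt lt' Ep; rewrite -/L; arith.
  by rewrite ss mm.
have next n : n.+1 < 2 * L -> [set nth p0 Q n; nth p0 Q n.+1] \in M.
  by move=> lt; move/(sortedP p0): sQ => /(_ n); rewrite szQ => /(_ lt).
have Q0 : nth p0 Q 0 = f (ch true i.+1) by rewrite nth0.
have Qlast : nth p0 Q (2 * L).-1 = f (ch false i.+1) by rewrite -szQ nth_last.
have edge w : w \notin rho -> [set g (par w); g w] \in M.
  move=> wr; have [wC|wC] := boolP (w \in cut i).
    rewrite !gin //; last exact: cut_closed.
    by apply: (subsetP sM); have [] := E w (sub_cut _ wC) wr.
  have [s [m [lt Ew]]] := chain_split wC.
  case: m lt Ew => [|m] lt Ew.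
    have iN' : i < N by move: ik kN; arith.
    have gw : g w = f (ch s i.+1).
      by rewrite Ew gch //; case: (s); rewrite /pos ?subn0.
    rewrite gw {1}Ew addn0 ch_par // gin ?ch_cut //.
    have ck : ch s i.+1 \in cut k by rewrite ch_cut.
    have [|_] := E _ ck; first by rewrite ch_root.
    by rewrite ch_par //; apply: (subsetP sM).
  have mN : i.+1 + m < N by move: lt; arith.
  rewrite Ew addnS ch_par // -addnS !gch // 1?ltnW //.
  have lt' : m.+1 < L by [].
  rewrite /pos; case: (s); first by apply: next; move: lt'; arith.
  rewrite setUC (_ : (2 * L).-1 - m = ((2 * L).-1 - m.+1).+1).
    by apply: next; move: lt'; arith.
  by move: lt'; arith.
apply: (copy_wins injg edge).
have EN : N = i.+1 + L.-1 by rewrite /L; move: ik kN; arith.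
have LL : L.-1 < L by rewrite prednK.
rewrite EN !gch // /pos (_ : (2 * L).-1 - L.-1 = L.-1.+1); last by move: L0; arith.
by apply: next; move: L0; arith.
Qed.

End Assembly.

Section LongChain.
Hypothesis copy_wins : forall f M, injective f ->
  (forall w, w \notin rho -> [set f (par w); f w] \in M) ->
  [set f (ch true N); f (ch false N)] \in M -> wins F M.
Hypothesis rhoE : rho = [set ch true 0; ch false 0].
Variables (q C1 C2 C3 q' C' : rat) (D1 D2 D3 D' J m3 : nat).
Hypothesis q1 : (1 <= q)%R.
Hypothesis qs : ((2 * (3 + Delta))%:R * ((q - 1) * q ^+ (3 + Delta)) <= 1 :> rat)%R.
Hypothesis qs3 : ((2 * 3)%:R * ((q - 1) * q ^+ 3) <= 1 :> rat)%R.
Hypothesis qs2 : ((2 * 2)%:R * ((q - 1) * q ^+ 2) <= 1 :> rat)%R.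
Hypothesis CD1 : (C1 * q ^+ (2 * J.+1) < q ^+ D1.+1)%R.
Hypothesis CV1 : (#|V|%:R * q ^+ 1 <= C1)%R.
Hypothesis JN : J.+1 < N.
Let x0 := N - J.+1.
Let t := (D1 + 3) * (Delta + Delta * Delta).
Hypothesis fuel : #|T| * 4 ^ J < 5 ^ J * (2 * x0).
Hypothesis room1 : 3 * D1 + 8 * Delta + 50 <= 2 * x0.
Hypothesis room2 : D1 + 2 * t + 3 <= 2 * x0.
Let d1 := D1 + 2 + t.
Hypothesis CV2 : (#|V|%:R * q ^+ d1 <= C2)%R.
Hypothesis CD2 : (C2 < q ^+ D2.+1)%R.
Hypothesis dD2 : d1 <= D2.
Hypothesis CV3 : (#|V|%:R * q ^+ (D2 + 6 + 24 + 1) <= C3)%R.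
Hypothesis CD3 : (C3 < q ^+ D3.+1)%R.
Hypothesis dD3 : D2 <= D3.
Hypothesis q1' : (1 <= q')%R.
Hypothesis qs' : ((2 * 1)%:R * ((q' - 1) * q' ^+ 1) <= 1 :> rat)%R.
Hypothesis CD' : (C' < q' ^+ D'.+1)%R.
Hypothesis CV' : ((2 * #|T|.+1)%:R * q' ^+ (2 * D3 + 7) <= C')%R.
Hypothesis m3_1 : slack D' + 4 <= m3.
Hypothesis m3_2 : D' + 3 <= m3.
Hypothesis m3_3 : 5 * slack D' <= m3.
Hypothesis m3_4 : 5 * (40 * (2 * D3 + 7) * m3) <= x0.
Hypothesis m3_5 : 80 * m3 <= x0.
Hypothesis room3 : 80 * (D3 + 7) <= x0.

(** The first run embeds everything except the middle of the chain. The second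
    one embeds two long pieces PL and PR of it, whose vertices all have small degree,
    as the final repair requires; the rest is a path through the unused vertices. The
    fraction 3/10 makes each of the pieces longer than four times the rest. *)
Theorem long_chain_win : Win #|T|.+1 set0 set0.
Proof.
have cr : #|rho| = 2.
  by rewrite rhoE cards2; case: eqP => // /ch_inj[].
have [f0 pc0] : exists f, partial_copy rho f set0.
  have lt : #|T| <= #|V| by rewrite cardVT.
  exists (fun w => enum_val (cast_ord (esym cardVT) (enum_rank w))).
  split=> //; last by move=> w ->.
  by move=> u v _ _ /enum_val_inj/cast_ord_inj/enum_rank_inj.
apply: (first_run q1 qs CD1 CV1 JN _ _ pc0 rhoE fuel) => //.
move=> i f M B iJ pc sB degU degf.
pose x := N - i; have x0x : x0 <= x by rewrite /x /x0; move: iJ; arith.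
have iN : i <= N by move: iJ JN; arith.
pose n := (3 * x) %/ 10.
have n10 : n * 10 <= 3 * x by apply: leq_trunc_div.
have n10' : 3 * x < n.+1 * 10 by apply: ltn_ceil.
have kN : i + 3 * n <= N by move: n10 iN; rewrite /x; arith.
have EA : N - (i + 3 * n) = x - 3 * n by rewrite /x; arith.
apply: (deep_run (n := n) q1 qs3 CD2 kN pc sB).
- apply: le_trans CV2; rewrite -[d1]addn0.
  by apply: (potential_low q1 (subxx _) degU) => y _; rewrite leq_addr.
- move=> s; apply: leq_trans (degf s) _; apply: leq_trans dD2 _; exact: leq_addr.
- by rewrite EA; move: room3 dD3 x0x n10; arith.
set k := i + 3 * n => f' M' B' pc' ex' sB' B'X cB' pot' deg'.
have ik : i < k.
  by rewrite /k; move: n10' x0x room3; arith.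
have [rS' inj' E'] := pc'.
have degU' : {in unused (cut k) f', forall y, deg B' y <= D2}.
  by apply: (potential_bound q1); apply: le_lt_trans pot' CD2.
have cA : #|loose k f'| = 2 * (x - 3 * n).
  by rewrite (card_unused cardVT pc') -EA -/k; have := card_cut kN; rewrite -/k; move: #|cut k|; arith.
have size_n : k - i = 3 * n by rewrite /k addKn.
have sorted_side s : sorted (link M') (side i k f' s).
  apply/(sortedP (f' (ch s 0))) => m; rewrite size_side => lt.
  rewrite /side !(nth_map 0) ?size_iota ?nth_iota // 1?ltnW //.
  have jN : i.+1 + m.+1 <= k by move: lt; arith.
  have [||_] := E' (ch s (i.+1 + m.+1)).
  - by rewrite ch_cut // (leq_trans jN kN).
  - by rewrite ch_root ?(leq_trans jN kN).
  - by rewrite addnS ch_par //; apply: leq_trans kN; move: jN; arith.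
have -> : budget (cut k) = #|loose k f'| + 3.
  by rewrite /budget cr -(card_unused cardVT pc') addnS.
have kin s : f' (ch s k) = last (f' (ch s i.+1)) (side i k f' s).
  have [m Em] : exists m, 3 * n = m.+1 by exists (3 * n).-1; move: ik; rewrite /k; arith.
  by rewrite /side size_n Em -[m.+1]addn1 iotaD map_cat last_cat /= /k Em addSnnS.
have hside s : side i k f' s = f' (ch s i.+1) :: behead (side i k f' s).
  rewrite /side size_n; have [m ->] : exists m, 3 * n = m.+1.
    by exists (3 * n).-1; move: ik; rewrite /k; arith.
  by [].
apply: (path_completion (pl0 := f' (ch true i.+1)) (pr0 := f' (ch false i.+1))
  (PL := side i k f' true) (PR := rev (side i k f' false)) (A := loose k f') (M0 := M') (Bs := B)
  _ _ _ _ _ _ q1 qs2 CD3 CV3 q1' qs' CD' _ (isT : 24 <= 24) m3_1 m3_2 m3_3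
  (e := 6 * n + #|loose k f'|.+1) (h := d1)) => //.
- by rewrite hside.
- by rewrite hside rev_cons last_rcons.
- by rewrite size_side size_n; move: ik; rewrite /k; arith.
- by rewrite size_rev size_side size_n; move: ik; rewrite /k; arith.
- exact: (uniq_board ik kN pc').
- by move=> Q M2 sM2 pQ sQ hQ lQ; apply: (ham_wins copy_wins ik kN pc' sM2 pQ sQ).
- apply: le_trans CV'; rewrite ler_wpM2r ?exprn_ge0 //; first by apply: le_trans q1'.
  rewrite ler_nat leq_mul2l /= ltnS (card_unused cardVT pc'); exact: leq_subr.
- by rewrite cA; move: m3_4 x0x n10; arith.
- by rewrite cA; move: m3_5 x0x n10; arith.
- by rewrite cA; move: room3 x0x n10; arith.
- by rewrite sorted_rev.
- move=> y yA; apply: leq_trans (degU' y yA) _; exact: leq_addr.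
- have -> : head (f' (ch false i.+1)) (rev (side i k f' false)) = f' (ch false k).
    by rewrite kin; case/lastP: (side _ _ _ _) => // l y; rewrite rev_rcons last_rcons.
  by apply: leq_trans (deg' false) _; rewrite leq_add2l.
- by rewrite -kin; apply: deg' true.
- by rewrite leq_add2r cardsD (setIidPr sB') leq_subLR.
- move=> y /mapP[j jI ->]; apply: degU; rewrite in_setC; apply/imsetP=> -[u uC].
  have [ij jk] := side_cut ik kN true jI.
  have [sS Ef] := ex'; rewrite -Ef // => /inj' h.
  have ju : ch true j = u by apply: h => //; apply: (subsetP sS).
  move: uC; rewrite -ju ch_cut ?[j <= i]leqNgt ?ij //.
  by move: jI; rewrite mem_iota; move: kN ik; arith.
- by rewrite cA size_side size_n; move: n10 n10' room3 x0x; arith.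
- rewrite cA size_rev size_side size_n; have : d1 <= D3 by apply: leq_trans dD3.
  by move: n10 n10' room3 x0x; arith.
Qed.

End LongChain.
End Chain.

(** * The structure of trees *)

Section Tree.
Variable G : sgraph.
Hypothesis tree : is_tree G.
Implicit Types (x y z w r : G) (p : seq G).

Definition rooted r (par : G -> G) (depth : G -> nat) :=
  (forall x, x != r -> adj x (par x) /\ depth (par x) < depth x) /\
  (forall x y, adj x y -> (x != r /\ par x = y) \/ (y != r /\ par y = x)).

(** The parent of x is a neighbour closer to r. An edge between x and y that is
    not of this form would close a cycle, together with a path of such edges. *)
Lemma tree_rooted r : exists par depth, rooted r par depth.
Proof.
have [[_ conn] acyc] := tree.
pose reach x n := [exists p : n.-tuple G, path (@adj G) x p && (last x p == r)].
have ex x : exists n, reach x n.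
  have /connectP[p xp lp] := conn x r.
  by exists (size p); apply/existsP; exists (in_tuple p); rewrite /= xp -lp eqxx.
pose depth x := ex_minn (ex x).
have step x : x != r -> exists y, adj x y && (depth y < depth x).
  move=> xr; rewrite {2}/depth; case: ex_minnP => n /existsP[p /andP[]].
  case: p => [[|y p] /= sz]; first by move=> _ /eqP E; rewrite E eqxx in xr.
  move=> /andP[xy yp] ly _; exists y; rewrite xy /=.
  rewrite /depth; case: ex_minnP => m _ min.
  rewrite -(eqP sz) ltnS; apply: min; apply/existsP; exists (in_tuple p).
  by rewrite /= yp ly.
pose par x := odflt x [pick y | adj x y && (depth y < depth x)].
have parP x : x != r -> adj x (par x) /\ depth (par x) < depth x.
  move=> /step[y xy]; rewrite /par; case: pickP => [z /andP[]//|/(_ y)].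
  by rewrite xy.
exists par, depth; split=> // x y xy.
pose g u v := ((u != r) && (par u == v)) || ((v != r) && (par v == u)).
have gC : symmetric g by move=> u v; rewrite /g orbC.
have g_adj : subrel g (@adj G).
  move=> u v /orP[]/andP[nr /eqP<-]; first by have [] := parP u nr.
  by rewrite adj_sym; have [] := parP v nr.
have g_root u : connect g u r.
  move: {2}(depth u) (leqnn (depth u)) => n; elim: n u => [|n IH] u le;
  have [->|ur] := eqVneq u r; rewrite ?connect0 //; have [_ lt] := parP u ur.
    by move: (leq_trans lt le).
  apply: connect_trans (IH (par u) (leq_trans lt le)).
  by apply: connect1; rewrite /g ur eqxx.
have : g x y || ~~ g x y by case: (g x y).
case/orP=> [/orP[]/andP[nr /eqP E]|ng]; [by left|by right|].
have /connectP[p0 xp0 lp0] : connect g x y.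
  by apply: connect_trans (g_root x) _; rewrite (sym_connect_sym gC).
rewrite lp0 in xy ng *.
case/shortenP: xp0 xy ng => p xp up _ xy ng.
case: p xp up xy ng => [|u [|v p]] xp up xy ng.
- by rewrite /= adj_irrefl in xy.
- by move: xp ng; rewrite /= andbT => ->.
case: (@acyc [:: x, u, v & p] isT); rewrite /ucycle up andbT /=.
rewrite rcons_path; move: (sub_path g_adj xp) => /= /and3P[-> -> ->] /=.
by rewrite adj_sym.
Qed.

Lemma children_nbrs (rho : {set G}) (par' : G -> G) (Delta : nat) v : max_degree G <= Delta ->
  (forall w, w \notin rho -> adj w (par' w)) -> #|children par' rho v| <= Delta.
Proof.
move=> deg_bound H; apply: leq_trans deg_bound; apply: leq_trans (leq_bigmax v).
apply/subset_leq_card/subsetP=> w; rewrite !inE => /andP[wr /eqP<-].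
by rewrite adj_sym H.
Qed.

Section Rooted.
Variables (r : G) (par : G -> G) (depth : G -> nat).
Hypothesis root : rooted r par depth.
Notation children := (children par [set r]).

Definition childless : {set G} := [set v | #|children v| == 0].
Definition branching : {set G} := [set v | 1 < #|children v|].
Definition bare : {set G} := [set v | #|children v| == 1].

(** The numbers of children sum up to #|G| - 1. *)
Lemma branching_childless : #|branching| < #|childless|.
Proof.
have count (P : pred G) : #|[set v | P v]| = \sum_v P v.
  by rewrite -sum1dep_card big_mkcond; apply: eq_bigr => v _; case: (P v).
have cT : #|childless| + (#|bare| + #|branching|) = #|G|.
  rewrite !count -!big_split -sum1_card /=; apply: eq_bigr => v _.
  by case: #|children v| => [|[|m]].
have sumc : \sum_v #|children v| = #|G|.-1.
  have -> : #|G|.-1 = \sum_(w | w != r) 1.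
    by rewrite sum1dep_card -(cardC1 r); apply: eq_card => w; rewrite !inE.
  rewrite [RHS](partition_big par xpredT) //=.
  apply: eq_bigr => v _; rewrite -sum1_card; apply: eq_bigl => w.
  by rewrite !inE.
have : #|bare| + 2 * #|branching| <= \sum_v #|children v|.
  rewrite !count big_distrr -big_split /=; apply: leq_sum => v _.
  by case: #|children v| => [|[|m]].
have : 0 < #|G| by apply/card_gt0P; exists r.
by rewrite sumc; move: cT; arith.
Qed.

Definition child x := odflt x [pick w in children x].

Lemma childP x : x \in bare -> child x != r /\ par (child x) = x.
Proof.
rewrite inE => /eqP c1; rewrite /child; case: pickP => [w|H].
  by rewrite !inE => /andP[wr /eqP].
by have := eq_card0 H; rewrite c1.
Qed.

Lemma bare_child x w : x \in bare -> w != r -> par w = x -> w = child x.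
Proof.
move=> xb wr pw; have [cr pc] := childP xb; move: xb; rewrite inE => /cards1P[u Eu].
have h v : v != r -> par v = x -> v = u.
  by move=> vr pv; apply/set1P; rewrite -Eu !inE vr pv eqxx.
by rewrite (h w) // -(h (child x)).
Qed.

(** From each vertex, going down as long as there is exactly one child leads to
    a vertex of another kind. If this always happens within k steps, then a vertex is
    determined by the place where the descent stops and by its length. *)
Lemma bare_chain k : 2 * #|childless| * k < #|G| ->
  exists x, forall j, j < k -> iter j child x \in bare.
Proof.
move=> lt; pose Z := ~: bare.
have cZ : #|Z| <= 2 * #|childless|.
  have sZ : Z \subset childless :|: branching.
    by apply/subsetP=> v; rewrite !inE; case: #|children v| => [|[|m]].
  apply: leq_trans (subset_leq_card sZ) _; apply: leq_trans (leq_card_setU _ _).1 _.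
  by rewrite mul2n -addnn leq_add2l; apply: ltnW branching_childless.
have [/existsP[x /forallP H]|] := boolP [exists x, forall j : 'I_k, iter j child x \in bare].
  by exists x => j jk; apply: (H (Ordinal jk)).
rewrite negb_exists => /forallP none; exfalso; move: lt; apply/negP; rewrite -leqNgt.
apply: leq_trans (_ : #|Z| * k <= _); last by rewrite leq_mul2r cZ orbT.
have : [set: G] \subset [set iter (p : G * 'I_k).2 par p.1 | p in setX Z [set: 'I_k]].
  apply/subsetP=> x _; have := none x; rewrite negb_forall => /existsP[j0 j0P].
  pose Q j := iter j child x \notin bare.
  case: (arg_minnP (P := fun j : 'I_k => Q j) val j0P) => j jQ jmin.
  apply/imsetP; exists (iter j child x, j); first by rewrite in_setX in_setT andbT in_setC.
  have : forall m, m <= j -> iter m par (iter m child x) = x.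
    elim=> [//|m IH] mj; rewrite iterSr /= (childP _).2; first by apply: IH; apply: ltnW.
    apply: contraT => nb; have mk : m < k by apply: leq_trans (ltn_ord j); apply: leqW.
    by have := jmin (Ordinal mk) nb; rewrite /= leqNgt mj.
  by move=> ->.
move/subset_leq_card; rewrite cardsT => h; apply: leq_trans h _.
by apply: leq_trans (leq_imset_card _ _) _; rewrite cardsX cardsT card_ord.
Qed.

Lemma bare_path k x : (forall j, j < k.+2 -> iter j child x \in bare) ->
  let c j := iter j child x in
  [/\ forall i j, i < k.+2 -> j < k.+2 -> c i = c j -> i = j,
      forall i, i < k.+2 -> adj (c i) (c i.+1) &
      forall i w, 0 < i < k.+2 -> adj (c i) w -> w = c i.-1 \/ w = c i.+1].
Proof.
move=> H c.
have cP j : j < k.+2 -> c j.+1 != r /\ par (c j.+1) = c j by move/H/childP.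
have lt j : j < k.+2 -> depth (c j) < depth (c j.+1).
  by move=> jk; have [cr {1}<-] := cP j jk; have [] := root.1 _ cr.
have mono i j : i < j -> j < k.+2 -> depth (c i) < depth (c j).
  elim: j => // j IH; rewrite ltnS leq_eqVlt => /predU1P[->|ij] jk.
    by apply: lt; apply: ltnW.
  by apply: ltn_trans (IH ij (ltnW jk)) (lt _ (ltnW jk)).
split.
- move=> i j ik jk E; case: (ltngtP i j) => // h.
    by have := mono _ _ h jk; rewrite E ltnn.
  by have := mono _ _ h ik; rewrite E ltnn.
- by move=> i /cP[cr E]; rewrite adj_sym -E; have [] := root.1 _ cr.
- move=> [//|i] w /= ik /root.2[[cr <-]|[wr pw]].
    by left; apply: (cP i (ltnW ik)).2.
  by right; apply: (bare_child (H i.+1 ik) wr pw).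
Qed.

Variable Delta : nat.
Hypothesis deg_bound : max_degree G <= Delta.

Lemma rooted_children v : #|children v| <= Delta.
Proof. by apply: children_nbrs deg_bound _ => w; rewrite inE => wr; have [] := root.1 w wr. Qed.

(** One leaf is chosen for each parent of leaves. *)
Lemma leaves_apart : exists L : {set G},
  [/\ {in L, forall w, w != r /\ forall u, u != r -> par u != w}, {in L &, injective par} &
      #|childless| <= (#|L| * Delta).+1].
Proof.
pose P := childless :\ r.
pose first w := [pick w' in P | par w' == par w].
pose L := [set w in P | first w == Some w].
have Lpar : par @: L = par @: P.
  apply/eqP; rewrite eqEsubset imsetS; last by apply/subsetP=> w; rewrite inE => /andP[].
  apply/subsetP=> v /imsetP[w wP ->]; case E: (first w) => [w'|]; last first.
    by move: E; rewrite /first; case: pickP => // /(_ w); rewrite wP eqxx.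
  have [w'P pw] : w' \in P /\ par w' = par w.
    by move: E; rewrite /first; case: pickP => // z /andP[zP /eqP pz] [<-].
  by apply/imsetP; exists w' => //; rewrite inE w'P /first pw -/(first w) E eqxx.
have injL : {in L &, injective par}.
  move=> u v; rewrite !inE => /andP[_ /eqP Eu] /andP[_ /eqP Ev] E.
  by apply: Some_inj; rewrite -Eu -Ev /first E.
exists L; split=> //.
  move=> w; rewrite !inE => /andP[/andP[wr w0] _]; split=> // u ur.
  by apply: contraTneq w0 => <-; rewrite -lt0n; apply/card_gt0P; exists u; rewrite !inE ur /=.
have : #|P| <= #|L| * Delta.
  rewrite -(card_in_imset injL) Lpar -sum_nat_const -sum1_card.
  rewrite (partition_big_imset par) /=; apply: leq_sum => v _.
  apply: leq_trans (rooted_children v); rewrite -sum1_card.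
  rewrite [X in X <= _]big_mkcond [X in _ <= X]big_mkcond /=; apply: leq_sum => w _.
  case: ifP => // /andP[wP /eqP pw]; rewrite !inE pw eqxx andbT.
  by move: wP; rewrite in_setD1 => /andP[->].
by rewrite [#|childless|](cardsD1 r) => h; apply: leq_trans (leq_add (leq_b1 _) h) _.
Qed.

End Rooted.

Section Reroot.
Variables (N : nat) (c : nat -> G).
Hypothesis N0 : 0 < N.
Hypothesis c_inj : forall i j, i < (2 * N).+2 -> j < (2 * N).+2 -> c i = c j -> i = j.
Hypothesis c_adj : forall i, i < (2 * N).+2 -> adj (c i) (c i.+1).
Hypothesis c_nbr : forall i w, 0 < i < (2 * N).+2 -> adj (c i) w -> w = c i.-1 \/ w = c i.+1.

Let last := (2 * N).+1.
Let rho : {set G} := [set c 0; c last].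
Definition two_sided (s : bool) i := if s then c i else c (last - i).

(** Rooting the tree at c 0 makes the chain descend from c 0. Without the
    middle edge, the lower half of the chain is turned upwards to the new root at its
    other end; below this root nothing changes. *)
Lemma chain_rooted : exists par depth,
  [/\ forall x, x \notin rho -> adj x (par x) /\ depth (par x) < depth x,
      forall s i, i < N -> par (two_sided s i.+1) = two_sided s i,
      forall s i w, 0 < i <= N -> w \notin rho -> par w = two_sided s i ->
        i < N /\ w = two_sided s i.+1 &
      forall x y, adj x y -> [\/ x \notin rho /\ par x = y, y \notin rho /\ par y = x |
        [set x; y] = [set two_sided true N; two_sided false N]]].
Proof.
have [par [depth [root1 root2]]] := tree_rooted (c 0).
have cE i j : i <= last -> j <= last -> (c i == c j) = (i == j).
  by move=> il jl; apply/eqP/eqP => [/c_inj->|->].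
have l0 : 0 < last by [].
have par_c i : i < last -> c i.+1 != c 0 /\ par (c i.+1) = c i.
  move=> il; have n0 : c i.+1 != c 0 by rewrite cE.
  split=> //; elim: i il n0 => [|i IH] il n0.
    by have [[]|[]] // := root2 _ _ (c_adj (leqW il)); rewrite eqxx.
  have il' := ltnW il; have n0' : c i.+1 != c 0 by rewrite cE.
  have [[_]|[]] // := root2 _ _ (c_adj (leqW il)); rewrite IH // => /eqP.
  by rewrite cE //; [rewrite -addn2 -[X in X == _]addn0 eqn_add2l|apply: ltnW].
pose upper w := [pick j : 'I_last | (N < j) && (w == c j)].
pose par2 w := if upper w is Some j then c j.+1 else par w.
pose depth2 w := if upper w is Some j then depth (c last) + (last - j) else depth w.
have upperP w : (exists j, [/\ N < j, j < last, w = c j, par2 w = c j.+1 &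
      depth2 w = depth (c last) + (last - j)]) \/
    (forall j, j <= last -> w = c j -> j <= N \/ j = last) /\ par2 w = par w /\ depth2 w = depth w.
  rewrite /par2 /depth2 /upper; case: pickP => [j /andP[Nj /eqP wE]|none].
    by left; exists j; split.
  right; split=> // j jl wE; have [jN|Nj] := leqP j N; first by left.
  right; apply/eqP; rewrite eqn_leq jl /= leqNgt; apply/negP=> jl'.
  by have := none (Ordinal jl'); rewrite /= Nj wE eqxx.
have rhoP w : (w \in rho) = (w == c 0) || (w == c last) by rewrite !inE.
have c_rho j : j <= last -> (c j \in rho) = (j == 0) || (j == last).
  by move=> jl; rewrite rhoP !cE.
have up j : N < j -> j < last -> par2 (c j) = c j.+1 /\ depth2 (c j) = depth (c last) + (last - j).
  move=> Nj jl; have [[j' [_ j'l /eqP jj' -> ->]]|[H _]] := upperP (c j).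
    by move: jj'; rewrite cE // 1?ltnW // => /eqP->.
  have [|jN|jE] := H j (ltnW jl); first by [].
    by move: Nj; rewrite ltnNge jN.
  by move: jl; rewrite jE ltnn.
have low j : j <= N \/ j = last -> par2 (c j) = par (c j) /\ depth2 (c j) = depth (c j).
  move=> jN; have jl : j <= last by case: jN => [|->//]; rewrite /last; arith.
  have [[j' [Nj' j'l /eqP jj' _ _]]|[_ H]//] := upperP (c j).
  move: jj'; rewrite cE // 1?ltnW // => /eqP E; move: Nj' j'l; rewrite -E.
  by case: jN => [jN|->]; rewrite ?ltnn // ltnNge jN.
have par2_low j : j < N -> par2 (c j.+1) = c j.
  move=> jN; have [-> _] := low j.+1 (or_introl jN).
  by apply: (par_c _ _).2; rewrite /last; move: jN; arith.
have root_2 x : x \notin rho -> adj x (par2 x) /\ depth2 (par2 x) < depth2 x.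
  move=> xr; have [[j [Nj jl -> -> ->]]|[nx [-> ->]]] := upperP x.
    split; first by apply: c_adj; apply: leqW.
    have [jl'|jl'] := ltnP j.+1 last.
      by rewrite (up j.+1 (ltnW Nj) jl').2 ltn_add2l ltn_sub2l.
    have -> : j.+1 = last by apply/eqP; rewrite eqn_leq jl jl'.
    by rewrite (low last (or_intror erefl)).2 -[X in X < _]addn0 ltn_add2l subn_gt0.
  have x0 : x != c 0 by move: xr; rewrite rhoP negb_or => /andP[].
  have [ax lt] := root1 x x0; split=> //.
  have [[j [Nj jl pE _ _]]|[_ [_ ->]]//] := upperP (par x); exfalso.
  have j0 : 0 < j by apply: leq_trans Nj.
  have [||xE|xE] := @c_nbr j x.
  - by rewrite j0 leqW.
  - by rewrite -pE adj_sym.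
  - have [j1|j1] := posnP j.-1; first by move: x0; rewrite xE j1 eqxx.
    have [_ p2] := par_c j.-2 (leq_ltn_trans (leq_trans (leq_pred _) (leq_pred _)) jl).
    rewrite prednK // -xE pE in p2; move/eqP: p2; rewrite cE ?(ltnW jl) //; last first.
      by apply: leq_trans (ltnW jl); apply: leq_trans (leq_pred _) (leq_pred _).
    by move: j0; arith.
  - have [jN|jL] := nx j.+1 jl xE; first by move: Nj; rewrite ltnNge ltnW.
    by move: xr; rewrite xE c_rho // jL eqxx orbT.
exists par2, depth2; split=> //.
- move=> [] i iN; rewrite /two_sided; first exact: par2_low.
  rewrite (up _ _ _).1; [|by rewrite /last; arith..].
  by congr c; rewrite /last; arith.
- move=> s i w /andP[i0 iN] wr pw; have [aw _] := root_2 w wr.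
  pose a := if s then i else last - i.
  have [a0 al] : 0 < a /\ a < last by rewrite /a /last; case: (s); split; move: i0 iN; arith.
  have pwE : par2 w = c a by rewrite pw /two_sided /a; case: (s).
  rewrite pwE adj_sym in aw.
  have [||wE|wE] := @c_nbr a w; [by rewrite a0 leqW|by []| |].
  + have b0 : 0 < a.-1.
      rewrite lt0n; apply/eqP=> b0; move: wr; rewrite wE b0 c_rho //.
    have bl : a.-1 < last by apply: leq_ltn_trans al; apply: leq_pred.
    have aE : a = a.-1.+1 by rewrite prednK.
    have [Nb|bN] := ltnP N a.-1.
      move: wE aE Nb; rewrite /a /two_sided; case: (s) => wE aE Nb.
        by move: Nb; rewrite ltnNge; move: iN aE; arith.
      by rewrite wE /last; split; [|congr c]; move: Nb i0; rewrite /last; arith.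
    move: pwE; rewrite wE (low _ (or_introl bN)).1 -(prednK b0) (par_c _ _).2; last first.
      by apply: leq_ltn_trans bl; apply: leq_pred.
    move/eqP; rewrite cE ?(ltnW al) //; first by move: aE b0; arith.
    by apply: leq_trans (ltnW bl); apply: leq_pred.
  + have aL : a.+1 < last.
      rewrite ltn_neqAle al andbT; apply/eqP=> E; move: wr; rewrite wE c_rho // E eqxx orbT //.
    have [aN|Na] := leqP a.+1 N.
      move: wE aN; rewrite /a /two_sided; case: (s) => wE aN; first by [].
      by move: aN iN; rewrite /last; arith.
    move: pwE; rewrite wE (up _ Na aL).1 => /eqP; rewrite cE ?(ltnW al) //.
    by move/eqP; arith.
have key x : x != c 0 -> [\/ x \notin rho /\ par2 x = par x,
    par x \notin rho /\ par2 (par x) = x |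
    [set x; par x] = [set two_sided true N; two_sided false N]].
  move=> x0; have [[j [Nj jl xE _ _]]|[nx [p2 _]]] := upperP x.
    have jE : j = j.-1.+1 by rewrite prednK //; apply: leq_trans Nj.
    have j1l : j.-1 < last by apply: leq_ltn_trans jl; apply: leq_pred.
    have px : par x = c j.-1 by rewrite xE {1}jE (par_c _ j1l).2.
    have [Nj1|jN] := ltnP N j.-1.
      constructor 2; rewrite px (up _ Nj1 j1l).1 -jE xE c_rho ?(ltnW j1l) //.
      by rewrite (gtn_eqF (leq_trans _ Nj1)) // (ltn_eqF j1l).
    constructor 3; rewrite px xE setUC /two_sided.
    have -> : j.-1 = N by move: jN Nj jE; arith.
    by congr [set _; c _]; rewrite /last; move: jN Nj jE; arith.
  have [xl|xl] := eqVneq x (c last); last by constructor 1; rewrite rhoP negb_or x0.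
  have lt : 2 * N < last by [].
  have N2 : N < 2 * N by move: N0; arith.
  have px : par x = c (2 * N) by rewrite xl (par_c _ lt).2.
  constructor 2; rewrite px (up _ N2 lt).1 xl c_rho ?(ltnW lt) //.
  by rewrite (ltn_eqF lt) orbF; split=> //; move: N0; arith.
move=> x y /root2[[x0 <-]|[y0 <-]].
  by case: (key x x0) => [?|?|?]; [constructor 1|constructor 2|constructor 3].
by rewrite setUC; case: (key y y0) => [?|?|?]; [constructor 2|constructor 1|constructor 3].
Qed.

End Reroot.
End Tree.

(** * Numerical estimates *)

Lemma edges_complete n : edges (complete_graph n) = pairs_of 'I_n.
Proof.
apply/setP=> e; apply/imsetP/idP => [[[x y]]|].
  by rewrite inE /= => xy ->; rewrite pairs_ofE.
by rewrite inE => /cards2P[x [y [xy ->]]]; exists (x, y) => //; rewrite inE.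
Qed.

Lemma card_pairs_of n : #|pairs_of 'I_n| = 'C(n, 2).
Proof. by rewrite -[n in RHS]card_ord -card_draws; apply: eq_card => e; rewrite !inE. Qed.

Lemma embedding_wins (T : sgraph) n (f : T -> 'I_n) (M : {set {set 'I_n}}) : injective f ->
  (forall x y, adj x y -> [set f x; f y] \in M) -> wins (copies T (complete_graph n)) M.
Proof.
move=> injf fM.
pose g : {ffun T -> complete_graph n} := [ffun x => f x].
apply/existsP; exists [set g @: (e : {set T}) | e in edges T].
apply/andP; split.
  apply/imsetP; exists g => //; rewrite inE; apply/andP; split.
    by apply/injectiveP=> x y; rewrite !ffunE; apply: injf.
  apply/forallP=> x; apply/forallP=> y; apply/implyP=> xy; rewrite /= !ffunE /distinct.
  by apply: contraTneq xy => /injf ->; rewrite adj_irrefl.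
apply/subsetP=> e /imsetP[e' /imsetP[[x y]]]; rewrite inE /= => xy -> ->.
by rewrite imsetU1 imset_set1 !ffunE; apply: fM.
Qed.

Section Base.
Local Open Scope ring_scope.
Variable s : nat.
Hypothesis s0 : (0 < s)%N.

(** Small enough for removing a vertex of largest degree to pay for s moves,
    and large enough for its power with exponent 4s to be at least two. *)
Definition base_q : rat := 1 + (4 * s)%:R^-1.
Notation q := base_q.

Lemma base_q_gt1 : 1 < q.
Proof. by rewrite /q ltrDl invr_gt0 ltr0n muln_gt0 s0. Qed.

Lemma base_q1 : 1 <= q. Proof. exact: ltW base_q_gt1. Qed.

Lemma base_q_pow i : (i <= s)%N -> q ^+ i <= 1 + i%:R / (2 * s)%:R.
Proof.
have s0' : (0 : rat) < s%:R by rewrite ltr0n.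
elim: i => [|i IH] lt; first by rewrite expr0 mul0r addr0.
have q0 : 0 <= q by apply: le_trans base_q1.
rewrite exprS; apply: le_trans (ler_wpM2l q0 (IH (ltnW lt))) _.
have li : i%:R + 1 <= s%:R :> rat by rewrite natr1 ler_nat.
rewrite /q !natrM.
have -> : (1 + (4 * s%:R)^-1) * (1 + i%:R / (2 * s%:R)) =
   1 + (i%:R + 1) / (2 * s%:R) - (2 * s%:R - i%:R) / (8 * s%:R ^+ 2) :> rat.
  by field; rewrite lt0r_neq0.
rewrite -[i.+1%:R]natr1 gerBl divr_ge0 ?mulr_ge0 ?exprn_ge0 ?ler0n //.
have : (0 : rat) <= i%:R by rewrite ler0n.
lra.
Qed.

Lemma base_q_small s' : (s' <= s)%N ->
  (2 * s')%:R * ((q - 1) * q ^+ s') <= 1 :> rat.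
Proof.
move=> le; have s0' : (0 : rat) < s%:R by rewrite ltr0n.
have h1 := base_q_pow le.
have h2 : q ^+ s' <= 2.
  apply: le_trans h1 _; rewrite natrM.
  have : (s'%:R : rat) <= s%:R by rewrite ler_nat.
  have h : (s%:R : rat) / (2 * s%:R) = 1 / 2 by field; rewrite lt0r_neq0.
  move=> h3; have : (s'%:R : rat) / (2 * s%:R) <= s%:R / (2 * s%:R).
    by rewrite ler_wpM2r // invr_ge0 mulr_ge0 ?ler0n.
  rewrite h; lra.
rewrite /q addrAC subrr add0r.
apply: le_trans (_ : (2 * s)%:R * ((4 * s)%:R^-1 * 2) <= _).
  apply: ler_pM; rewrite ?mulr_ge0 ?invr_ge0 ?ler0n ?exprn_ge0 //.
  - exact: le_trans base_q1.
  - by rewrite ler_nat leq_mul2l.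
  - by rewrite ler_wpM2l ?invr_ge0 ?ler0n.
rewrite !natrM (_ : 2%:R * s%:R * ((4%:R * s%:R)^-1 * 2) = 1) //.
by field; rewrite lt0r_neq0.
Qed.

Lemma bernoulli (x : rat) m : 0 <= x -> 1 + m%:R * x <= (1 + x) ^+ m.
Proof.
move=> x0; elim: m => [|m IH]; first by rewrite expr0 mul0r addr0.
rewrite exprS; apply: le_trans (ler_wpM2l _ IH); last by rewrite addr_ge0.
rewrite -[m.+1%:R]natr1; have : 0 <= m%:R * x * x by rewrite !mulr_ge0 ?ler0n.
lra.
Qed.

Lemma base_q_double k : (2 ^ k)%:R <= q ^+ (4 * s * k).
Proof.
rewrite natrX exprM lerXn2r ?nnegrE ?exprn_ge0 ?ler0n //.
  exact: le_trans base_q1.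
apply: le_trans (bernoulli _ _); last by rewrite invr_ge0 ler0n.
by rewrite divff // pnatr_eq0 muln_eq0 -lt0n s0.
Qed.

Lemma base_q_grow m k e : (m <= 2 ^ k)%N -> m%:R * q ^+ e < q ^+ (e + 4 * s * k).+1.
Proof.
move=> le; have q0 : 0 < q by apply: lt_trans base_q_gt1.
rewrite exprS exprD; apply: le_lt_trans (_ : q ^+ (4 * s * k) * q ^+ e < _).
  rewrite ler_wpM2r ?exprn_ge0 ?(ltW q0) //; apply: le_trans (base_q_double k).
  by rewrite ler_nat.
rewrite [X in X < _]mulrC.
by rewrite ltr_pMl ?base_q_gt1 // mulr_gt0 ?exprn_gt0.
Qed.

End Base.

Definition poly_bounded (f : nat -> nat) :=
  exists c p, forall k, 0 < k -> f k <= c * k ^ p.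

Lemma poly_const c : poly_bounded (fun=> c).
Proof. by exists c, 0 => k _; rewrite muln1. Qed.

Lemma poly_id : poly_bounded id.
Proof. by exists 1, 1 => k _; rewrite mul1n. Qed.

Lemma poly_add f g : poly_bounded f -> poly_bounded g -> poly_bounded (fun k => f k + g k).
Proof.
move=> [c [p fP]] [d [r gP]]; exists (c + d), (p + r) => k k0.
rewrite mulnDl; apply: leq_add.
  apply: leq_trans (fP k k0) _; rewrite leq_mul2l leq_pexp2l ?orbT ?leq_addr //.
by apply: leq_trans (gP k k0) _; rewrite leq_mul2l leq_pexp2l ?orbT ?leq_addl.
Qed.

Lemma poly_mul f g : poly_bounded f -> poly_bounded g -> poly_bounded (fun k => f k * g k).
Proof.
move=> [c [p fP]] [d [r gP]]; exists (c * d), (p + r) => k k0.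
by rewrite expnD mulnACA leq_mul ?fP ?gP.
Qed.

Lemma poly_succ f : poly_bounded f -> poly_bounded (fun k => (f k).+1).
Proof.
move=> /poly_add/(_ (poly_const 1)) [c [p fP]]; exists c, p => k k0.
by rewrite -addn1 fP.
Qed.

(** With m = k / (p + 1) one has 2^k >= (m + 1)^(p + 1), so 2^k exceeds
    k^(p + 1) up to a constant factor. *)
Lemma poly_below_exp f : poly_bounded f -> exists k0, forall k, k0 <= k -> f k <= 2 ^ k.
Proof.
move=> [c [p fP]]; exists (c * p.+1 ^ p.+1).+1 => k le.
have k0 : 0 < k by apply: leq_trans le.
apply: leq_trans (fP k k0) _.
have p0 : 0 < p.+1 ^ p.+1 by rewrite expn_gt0.
rewrite -(leq_pmul2r p0); apply: leq_trans (_ : k ^ p.+1 <= _).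
  by rewrite mulnAC [k ^ p.+1]expnS leq_mul2r (ltnW le) orbT.
set m := k %/ p.+1.
have km : k <= m.+1 * p.+1 by apply/ltnW/ltn_ceil.
apply: leq_trans (_ : (m.+1 * p.+1) ^ p.+1 <= _); first by rewrite leq_exp2r.
rewrite expnMn leq_mul2r; apply/orP; right.
apply: leq_trans (_ : (2 ^ m) ^ p.+1 <= _); first by rewrite leq_exp2r // ltn_expl.
by rewrite -expnM leq_pexp2l // leq_trunc_div.
Qed.

Section TreeGame.
Variables (T : sgraph) (n Delta : nat).
Hypothesis tree : is_tree T.
Hypothesis cardT : #|T| = n.
Hypothesis degT : max_degree T <= Delta.
Notation Win := (winning (pairs_of 'I_n) (copies T (complete_graph n))).

Lemma cardVT : #|'I_n| = #|T|.
Proof. by rewrite card_ord cardT. Qed.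

Lemma rooted_copy_wins r par depth (f : T -> 'I_n) (M : {set {set 'I_n}}) : rooted r par depth ->
  partial_copy par [set r] [set: T] f M -> wins (copies T (complete_graph n)) M.
Proof.
move=> [_ root2] [_ inj E]; apply: (@embedding_wins T n f).
  by move=> x y; apply: inj; rewrite inE.
have E' x : x != r -> [set f (par x); f x] \in M.
  by move=> xr; have [||//] := E x; rewrite ?inE.
move=> x y /root2[[xr <-]|[yr <-]]; last exact: E'.
by rewrite setUC E'.
Qed.

End TreeGame.

(** * The theorem *)

(** Here k is the number of binary digits of n. Each threshold exceeds the
    previous ones by what the corresponding phase of the game needs; all that matters
    in the end is that they are polynomials in k. *)
Section Thresholds.
Variable Delta : nat.
Notation s := (3 + Delta).
Implicit Type k : nat.

Definition port_bound d k := d + 4 * s * k.+1.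
Definition port_size d k := 5 * slack (port_bound d k) + port_bound d k + 4.

Definition chain_deg1 k := 2 * (4 * k) + 3 + 4 * s * k.
Definition chain_rest k := (chain_deg1 k + 3) * (Delta + Delta * Delta).
Definition chain_deg2 k := chain_deg1 k + 2 + chain_rest k + 4 * s * k.
Definition chain_deg3 k := chain_deg2 k + 6 + 24 + 1 + 4 * s * k.
Definition chain_ports k := port_size (2 * chain_deg3 k + 7) k.
Definition chain_room k :=
  5 * (40 * (2 * chain_deg3 k + 7) * chain_ports k) + 80 * chain_ports k +
  80 * (chain_deg3 k + 7) + (3 * chain_deg1 k + 8 * Delta + 50) +
  (chain_deg1 k + 2 * chain_rest k + 3).
Definition chain_length k := chain_room k + (4 * k).+1.

Definition leaf_density k := 4 * (chain_length k).+1 * Delta.+1.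
Definition leaf_deg k := 64 * leaf_density k + 1 + 4 * s * k.
Definition leaf_rest k := (leaf_deg k + 3) * (Delta + Delta * Delta).
Definition leaf_ports_size k := port_size (leaf_deg k + leaf_rest k) k.
Definition leaf_number k :=
  16 * (2 * (3 * leaf_deg k + 2 * Delta + 16) + 2 * (leaf_deg k + 2 * leaf_rest k + 3) +
   20 * (leaf_deg k + leaf_rest k) * leaf_ports_size k + 8 * leaf_ports_size k +
   (4 * leaf_density k).+1).

Lemma poly_thresholds : poly_bounded (fun k => 2 * (leaf_density k * leaf_number k)).
Proof.
have pc c := poly_const c.
have pk : poly_bounded (fun k => k) := poly_id.
have p4 : poly_bounded (fun k => 4 * s * k) by apply: poly_mul.
have port d : poly_bounded d -> poly_bounded (fun k => port_size (d k) k).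
  move=> pd; have pb : poly_bounded (fun k => port_bound (d k) k).
    by apply: poly_add => //; apply: poly_mul => //; apply: poly_succ.
  rewrite /port_size /slack; apply: poly_add => //; apply: poly_add => //; apply: poly_mul => //.
  apply: poly_add; apply: poly_mul => //; apply: poly_mul => //; exact: poly_succ.
have c1 : poly_bounded chain_deg1.
  by apply: poly_add => //; apply: poly_add => //; apply: poly_mul => //; apply: poly_mul.
have cr : poly_bounded chain_rest by apply: poly_mul => //; apply: poly_add.
have c2 : poly_bounded chain_deg2.
  by apply: poly_add => //; apply: poly_add => //; apply: poly_add.
have c3 : poly_bounded chain_deg3 by do 4!apply: poly_add => //.
have c3' : poly_bounded (fun k => 2 * chain_deg3 k + 7).
  by apply: poly_add => //; apply: poly_mul.
have cp : poly_bounded chain_ports by apply: port.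
have cm : poly_bounded chain_room.
  apply: poly_add; last by apply: poly_add => //; apply: poly_add => //; apply: poly_mul.
  apply: poly_add; last by apply: poly_add => //; apply: poly_add => //; apply: poly_mul.
  apply: poly_add; last by apply: poly_mul => //; apply: poly_add.
  apply: poly_add; last by apply: poly_mul.
  by apply: poly_mul => //; apply: poly_mul => //; apply: poly_mul.
have cl : poly_bounded chain_length.
  by apply: poly_add => //; apply: poly_succ; apply: poly_mul.
have ld : poly_bounded leaf_density.
  by apply: poly_mul => //; apply: poly_mul => //; apply: poly_succ.
have lg : poly_bounded leaf_deg.
  by apply: poly_add => //; apply: poly_add => //; apply: poly_mul.
have lr : poly_bounded leaf_rest by apply: poly_mul => //; apply: poly_add.
have lgr : poly_bounded (fun k => leaf_deg k + leaf_rest k) by apply: poly_add.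
have lp : poly_bounded leaf_ports_size by apply: port.
apply: poly_mul => //; apply: poly_mul => //; apply: poly_mul => //.
apply: poly_add; last by apply: poly_succ; apply: poly_mul.
apply: poly_add; last by apply: poly_mul.
apply: poly_add; last by apply: poly_mul => //; apply: poly_mul.
apply: poly_add; apply: poly_mul => //.
  by apply: poly_add => //; apply: poly_add => //; apply: poly_mul.
by apply: poly_add => //; apply: poly_add => //; apply: poly_mul.
Qed.

End Thresholds.

Section TreeGame.
Variables (T : sgraph) (n Delta k : nat).
Hypothesis tree : is_tree T.
Hypothesis cardT : #|T| = n.
Hypothesis degT : max_degree T <= Delta.
Hypothesis n2k : n < 2 ^ k.
Notation Win := (winning (pairs_of 'I_n) (copies T (complete_graph n))).
Let s := 3 + Delta.
Let s0 : 0 < s. Proof. by []. Qed.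
Let q := base_q s.
Let q1 : (1 <= q)%R := base_q1 s0.
Let qs : ((2 * s)%:R * ((q - 1) * q ^+ s) <= 1 :> rat)%R := base_q_small s0 (leqnn s).
Let qs_le s' : s' <= s -> ((2 * s')%:R * ((q - 1) * q ^+ s') <= 1 :> rat)%R.
Proof. exact: base_q_small. Qed.

Let grow e : (#|'I_n|%:R * q ^+ e < q ^+ (e + 4 * s * k).+1)%R.
Proof. by rewrite card_ord; apply: base_q_grow => //; apply: ltnW. Qed.

Let grow2 d : ((2 * n.+1)%:R * q ^+ d < q ^+ (port_bound Delta d k).+1)%R.
Proof. by apply: base_q_grow; rewrite // expnS leq_mul2l. Qed.

Lemma port_size_bounds d : let D := port_bound Delta d k in let m := port_size Delta d k in
  [/\ slack D + 4 <= m, D + 3 <= m & 5 * slack D <= m].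
Proof. by rewrite /port_size; split; arith. Qed.

(** An eighth of L is embedded last; the other leaves in L are the reserve for
    the final repair. *)
Lemma leaves_win r par depth (L : {set T}) : rooted r par depth ->
  {in L, forall w, w != r /\ forall u, u != r -> par u != w} -> {in L &, injective par} ->
  n <= leaf_density Delta k * #|L| -> leaf_number Delta k <= #|L| -> Win n.+1 set0 set0.
Proof.
move=> root leafP injL dense big.
have [root1 _] := root.
have few := rooted_children root degT.
pose m := #|L| %/ 8.
have m8 : m * 8 <= #|L| := leq_trunc_div _ _.
have m8' : #|L| < m.+1 * 8 by apply: ltn_ceil.
pose Lr := [set x in take m (enum L)].
have sLr : Lr \subset L.
  by apply/subsetP=> x; rewrite inE => /mem_take; rewrite mem_enum.
have cLr : #|Lr| = m.
  rewrite cardsE; apply/eqP; rewrite -[X in _ == X](_ : size (take m (enum L)) = _); last first.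
    by rewrite size_take_min -cardE; apply/minn_idPl; move: m8; arith.
  by apply/eqP/card_uniqP; rewrite take_uniq ?enum_uniq.
pose G := L :\: Lr.
have cG : #|G| + m = #|L|.
  by rewrite -cLr cardsD (setIidPr sLr) subnK // subset_leq_card.
have LG : Lr :|: G = L by rewrite /G setDE setUIr setUCr setIT; apply/setUidPr.
have -> : n.+1 = #|T|.+1 by rewrite cardT.
have [pb1 pb2 pb3] := port_size_bounds (leaf_deg Delta k + leaf_rest Delta k).
have dens0 : 0 < leaf_density Delta k by [].
have bigs : [/\ 16 * (2 * (3 * leaf_deg Delta k + 2 * Delta + 16)) <= #|L|,
   16 * (2 * (leaf_deg Delta k + 2 * leaf_rest Delta k + 3)) <= #|L|,
   16 * (20 * (leaf_deg Delta k + leaf_rest Delta k) * leaf_ports_size Delta k) <= #|L|,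
   16 * (8 * leaf_ports_size Delta k) <= #|L| & 16 * (4 * leaf_density Delta k).+1 <= #|L|].
  by split; apply: leq_trans big; rewrite /leaf_number leq_mul2l; arith.
have m16 : #|L| <= 16 * m by case: bigs => + _ _ _ _; move: m8'; arith.
have big_m x : 16 * x <= #|L| -> x <= m.
  by move=> h; rewrite -(leq_pmul2l (isT : 0 < 16)); apply: leq_trans h m16.
case: bigs => /big_m b1 /big_m b2 /big_m b3 /big_m b4 /big_m b5.
have half : #|L| <= 2 * (#|G| - (leaf_deg Delta k + leaf_rest Delta k + m).+1).
  by move: cG m8 b2; arith.
apply: (@many_leaves_win 'I_n T _ par depth r Delta _ few _ _ Lr G _ _ _
  q (#|'I_n|%:R * q ^+ (64 * leaf_density Delta k + 1)) q
  ((2 * n.+1)%:R * q ^+ (leaf_deg Delta k + leaf_rest Delta k))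
  (leaf_deg Delta k) (64 * leaf_density Delta k)
  (port_bound Delta (leaf_deg Delta k + leaf_rest Delta k) k)
  (leaf_ports_size Delta k) (4 * leaf_density Delta k).+1)%R;
  rewrite ?cLr ?LG ?cardT -/(leaf_rest Delta k) //.
- by move=> x; rewrite inE => xr; have [] := root1 x xr.
- by rewrite card_ord.
- exact: (fun f M => @rooted_copy_wins T n r par depth f M root).
- by apply/setP=> x; rewrite in_setI in_setD in_set0; case: (x \in Lr).
- exact: (qs_le (s' := 1)).
- rewrite ler_wpM2r ?exprn_ge0 ?(le_trans ler01 q1) // ler_nat leq_mul2l /=.
  have cLT : #|L| <= n by rewrite -cardT max_card.
  by move: m8 cLT; arith.
- apply: leq_trans (_ : 4 * (leaf_density Delta k * (16 * m)) <= _); last by arith.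
  by rewrite leq_mul2l /=; apply: leq_trans dense _; rewrite leq_mul2l m16 orbT.
- apply: leq_ltn_trans (_ : (4 * leaf_density Delta k) *
     (#|G| - (leaf_deg Delta k + leaf_rest Delta k + m).+1) < _).
    apply: leq_trans (_ : 2 * (leaf_density Delta k * #|L|) <= _); first by rewrite leq_mul2l.
    have : leaf_density Delta k * #|L| <= leaf_density Delta k *
        (2 * (#|G| - (leaf_deg Delta k + leaf_rest Delta k + m).+1)) by rewrite leq_mul2l half orbT.
    by move: (_ - _); arith.
  by rewrite ltn_pmul2r //; move: half m16 b2; arith.
- by move: cG m8 b2 b5; arith.
Qed.

Lemma chain_win (c : nat -> T) (N := chain_length Delta k) :
  (forall i j, i < (2 * N).+2 -> j < (2 * N).+2 -> c i = c j -> i = j) ->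
  (forall i, i < (2 * N).+2 -> adj (c i) (c i.+1)) ->
  (forall i w, 0 < i < (2 * N).+2 -> adj (c i) w -> w = c i.-1 \/ w = c i.+1) ->
  Win n.+1 set0 set0.
Proof.
move=> c_inj c_adj c_nbr.
have x0 : N - (4 * k).+1 = chain_room Delta k by rewrite /N /chain_length addnK.
have room0 : 0 < chain_room Delta k by rewrite /chain_room; arith.
have JN : (4 * k).+1 < N by rewrite /N /chain_length; move: room0; arith.
have N0 : 0 < N by apply: leq_trans JN.
have [par [depth [root ch_par ch_closed edgeP]]] := chain_rooted tree N0 c_inj c_adj c_nbr.
set rho := [set c 0; c _] in root ch_closed edgeP.
set ch := two_sided N c in ch_par ch_closed edgeP.
have ch_inj s1 s2 i j : i <= N -> j <= N -> ch s1 i = ch s2 j -> s1 = s2 /\ i = j.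
  pose pos (t : bool) m := if t then m else (2 * N).+1 - m.
  have chE t m : ch t m = c (pos t m) by case: t.
  have bound t m : m <= N -> pos t m < (2 * N).+2 by case: t; rewrite /pos; arith.
  move=> iN jN; rewrite !chE => /c_inj E; move: (E (bound _ _ iN) (bound _ _ jN)); rewrite /pos.
  by move=> {E} E; case: s1 E; case: s2 => E; split=> //; move: iN jN E; arith.
have rhoE : rho = [set ch true 0; ch false 0] by rewrite /ch /two_sided subn0.
have ch_root s1 i : i <= N -> (ch s1 i \in rho) = (i == 0).
  move=> iN; rewrite rhoE !inE; apply/orP/eqP => [|->].
    by case=> /eqP/ch_inj[].
  by case: (s1); rewrite eqxx; [left|right].
have [m1 m2 m3] := port_size_bounds (2 * chain_deg3 Delta k + 7).
have -> : n.+1 = #|T|.+1 by rewrite cardT.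
pose d1 := chain_deg1 Delta k + 2 + chain_rest Delta k.
apply: (@long_chain_win 'I_n T _ par depth rho Delta _ _ _ ch N ch_inj ch_par ch_root ch_closed
  _ _ rhoE q (#|'I_n|%:R * q ^+ 1) (#|'I_n|%:R * q ^+ d1)
  (#|'I_n|%:R * q ^+ (chain_deg2 Delta k + 6 + 24 + 1)) q
  ((2 * n.+1)%:R * q ^+ (2 * chain_deg3 Delta k + 7))
  (chain_deg1 Delta k) (chain_deg2 Delta k) (chain_deg3 Delta k)
  (port_bound Delta (2 * chain_deg3 Delta k + 7) k) (4 * k) (chain_ports Delta k))%R;
  rewrite ?cardT -?/(chain_rest Delta k) ?x0 //.
- by move=> x /root[].
- by move=> v; apply: children_nbrs degT _ => x /root[].
- by rewrite card_ord.
- by move=> s1; rewrite ch_root.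
- move=> f M injf fM mid; apply: (embedding_wins injf) => x y /edgeP[[xr <-]|[yr <-]|E].
  + by rewrite setUC fM.
  + exact: fM.
  + by rewrite -!imset_set1 -imsetU E imsetU !imset_set1.
- exact: qs_le.
- exact: qs_le.
- rewrite -mulrA -exprD (_ : chain_deg1 Delta k = 1 + 2 * (4 * k).+1 + 4 * s * k) //.
  by rewrite /chain_deg1 /s; arith.
- (* 2 * 4 ^ 4 = 512 is less than 5 ^ 4 = 625 *)
  apply: leq_trans (_ : 5 ^ (4 * k) <= _); last by rewrite leq_pmulr // muln_gt0.
  rewrite !expnM; apply: leq_trans (_ : 512 ^ k <= _); last first.
    by have [->|k0] := posnP k; rewrite ?expn0 // leq_exp2r.
  by rewrite -[512]/(2 * 256) expnMn ltn_pmul2r ?expn_gt0.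
- by rewrite /chain_room; arith.
- by rewrite /chain_room; arith.
- by rewrite /chain_deg2 leq_addr.
- by rewrite /chain_deg3; arith.
- exact: qs_le.
- by rewrite /chain_room; arith.
- by rewrite /chain_room; arith.
- by rewrite /chain_room; arith.
Qed.

(** A tree without a long bare path has many leaves. *)
Theorem tree_win : 2 * (leaf_density Delta k * leaf_number Delta k) <= 2 ^ k ->
  2 ^ k <= 2 * n -> Win n.+1 set0 set0.
Proof.
move=> big n2; have wP : leaf_density Delta k * leaf_number Delta k <= n.
  by rewrite -(leq_pmul2l (isT : 0 < 2)); apply: leq_trans big n2.
have [[T0 _] _] := tree; have /card_gt0P[r _] := T0.
have [par [depth root]] := tree_rooted tree r.
set N := chain_length Delta k.
have [few|many] := ltnP (2 * #|childless r par| * (2 * N).+2) #|T|.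
  have [x H] := bare_chain few.
  have [c_inj c_adj c_nbr] := bare_path root H.
  exact: chain_win c_inj c_adj c_nbr.
have [L [leafP injL cL]] := leaves_apart root degT.
have L0 : 0 < #|L|.
  rewrite lt0n; apply/eqP=> E; move: cL many; rewrite E mul0n cardT => cL many.
  have n4 : n <= 4 * N.+1.
    apply: leq_trans many _; apply: leq_trans (_ : 2 * 1 * (2 * N).+2 <= _); last by arith.
    by rewrite leq_mul2r leq_mul2l cL orbT.
  have : 4 * N.+1 * 2 <= leaf_density Delta k * leaf_number Delta k.
    apply: leq_mul; last by rewrite /leaf_number; arith.
    by rewrite /leaf_density -/N leq_pmulr.
  by move: wP n4; arith.
have dense : n <= leaf_density Delta k * #|L|.
  rewrite -cardT; apply: leq_trans many _; rewrite /leaf_density -/N.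
  apply: leq_trans (_ : 2 * (#|L| * Delta).+1 * (2 * N).+2 <= _).
    by rewrite leq_mul2r leq_mul2l cL orbT.
  have : (#|L| * Delta).+1 <= Delta.+1 * #|L|.
    by rewrite mulSn [Delta * _]mulnC -add1n leq_add2r.
  move=> h; have : 4 * N.+1 * (#|L| * Delta).+1 <= 4 * N.+1 * (Delta.+1 * #|L|).
    by rewrite leq_mul2l h orbT.
  by arith.
apply: (leaves_win root leafP injL dense).
rewrite -(leq_pmul2l (_ : 0 < leaf_density Delta k)) //.
exact: leq_trans wP dense.
Qed.

End TreeGame.

Theorem theorem1p1 :
  forall Delta : nat, 0 < Delta ->
  exists n0 : nat, forall n : nat, n0 <= n ->
  forall T : sgraph, is_tree T -> #|T| = n -> max_degree T <= Delta ->
  maker_wins_within (edges (complete_graph n)) (copies T (complete_graph n))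
    n.+1.
Proof.
move=> Delta _; have [k0 k0P] := poly_below_exp (poly_thresholds Delta).
exists (2 ^ k0 + 7) => n le T tree cT degT.
have n7 : 7 <= n by apply: leq_trans le; apply: leq_addl.
have n0 : 0 < n by apply: leq_trans n7.
pose k := (trunc_log 2 n).+1.
have /andP[kn nk] := trunc_log_bounds (isT : 1 < 2) n0.
rewrite edges_complete; apply: winning_maker_wins.
  rewrite card_pairs_of bin2 -leq_double; apply: leq_trans (_ : n * n.-1 <= _).
    by move: n7; case: (n) => // m; rewrite /= -!muln2; nia.
  have : odd (n * n.-1) = false by rewrite oddM; case: (n) n0 => //= m _; case: (odd m).
  by move=> o; rewrite -[X in X <= _]odd_double_half o.
apply: (tree_win (k := k) tree cT degT nk).
- apply: k0P; apply: ltnW; rewrite -(ltn_exp2l _ _ (isT : 1 < 2)).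
  by apply: leq_ltn_trans nk; apply: leq_trans le; apply: leq_addr.
- by rewrite /k expnS leq_mul2l.
Qed.
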